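(* Let $m\ge3$ and let $(p,q)\in\{(m,0),(0,m)\}$. Then: (1) The action of $\operatorname{GL}^+(m,\mathbb{R})$ on $\mathcal{W}(p,q)$ and on $\mathcal{Z}(p,q)$ is proper. (2) $\tilde{\mathcal{W}}(p,q)$ and $\tilde{\mathcal{Z}}(p,q)$ are open dense subsets of $\mathcal{W}(p,q)$ and $\mathcal{Z}(p,q)$, respectively. (3) One can define natural smooth structures on the quotients $\tilde{\mathfrak{W}}^+(p,q):=\tilde{\mathcal{W}}(p,q)/\operatorname{GL}^+(m,\mathbb{R})$ and $\tilde{\mathfrak{Z}}^+(p,q):=\tilde{\mathcal{Z}}(p,q)/\operatorname{GL}^+(m,\mathbb{R})$ so that the projections $\tilde{\mathcal{W}}(p,q)\to\tilde{\mathfrak{W}}^+(p,q)$ and $\tilde{\mathcal{Z}}(p,q)\to\tilde{\mathfrak{Z}}^+(p,q)$ are smooth principal $\operatorname{GL}^+(m,\mathbb{R})$ bundles.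
   Context: $\mathcal{W}(m)=(\mathbb{R}^m)^*\otimes(\mathbb{R}^m)^*\otimes\mathbb{R}^m$ is the vector space of arrays $\Gamma=(\Gamma_{ij}{}^k)_{1\le i,j,k\le m}$ of real constants (constant Christoffel symbols on $\mathbb{R}^m$), and $\mathcal{Z}(m)\subset\mathcal{W}(m)$ is the subspace where $\Gamma_{ij}{}^k=\Gamma_{ji}{}^k$ (torsion free). Repeated indices are summed. The Ricci tensor of $\Gamma$ is $\rho_{\Gamma,jk}=\Gamma_{in}{}^i\Gamma_{jk}{}^n-\Gamma_{jn}{}^i\Gamma_{ik}{}^n$, and the symmetric Ricci tensor is $\rho_{s,\Gamma,jk}=\frac12(\rho_{\Gamma,jk}+\rho_{\Gamma,kj})$. For $p+q=m$, $\mathcal{W}(p,q)$ (resp. $\mathcal{Z}(p,q)$) is the set of $\Gamma\in\mathcal{W}(m)$ (resp. $\mathcal{Z}(m)$) for which $\rho_{s,\Gamma}$ is non-degenerate with signature $(p,q)$: $p$ negative and $q$ positive directions. Thus $(m,0)$ means negative definite and $(0,m)$ positive definite. $\operatorname{GL}^+(m,\mathbb{R})$ is the group of linear maps of $\mathbb{R}^m$ with positive determinant. It acts on $\mathcal{W}(m)$, preserving $\mathcal{Z}(m)$, by $(T\Gamma)(e_i,e_j,e^k)=\Gamma(Te_i,Te_j,Te^k)$, where $\Gamma(e_i,e_j,e^k)=\Gamma_{ij}{}^k$ and $T$ acts on covectors by the dual action (so that $\langle Te^k,Te_i\rangle=\delta^k_i$). Set $G_\Gamma^+:=\{T\in\operatorname{GL}^+(m,\mathbb{R}):T\Gamma=\Gamma\}$,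 $\tilde{\mathcal{W}}(p,q):=\{\Gamma\in\mathcal{W}(p,q):G_\Gamma^+=\{\operatorname{id}\}\}$, and $\tilde{\mathcal{Z}}(p,q):=\{\Gamma\in\mathcal{Z}(p,q):G_\Gamma^+=\{\operatorname{id}\}\}$. An action of a Lie group $G$ on a space $N$ is proper if whenever $P_n\in N$, $g_n\in G$ with $P_n\to P\in N$ and $g_nP_n\to\tilde P\in N$, some subsequence of $g_n$ converges in $G$. *)

(* Defs.v *)
From HB Require Import structures.
From mathcomp Require Import all_boot all_order all_algebra.
From mathcomp Require Import generic_quotient.
From mathcomp Require Import all_classical all_reals all_analysis.

Set Implicit Arguments.
Unset Strict Implicit.
Unset Printing Implicit Defensive.

Import Order.TTheory GRing.Theory Num.Theory.
Import numFieldNormedType.Exports.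

Local Open Scope classical_set_scope.
Local Open Scope quotient_scope.
Local Open Scope ring_scope.

Section SmoothMaps.
Context {R : realType}.

(* C^n on an open set U, through iterated directional derivatives.  This is   *)
(* the usual notion when V is finite dimensional, the only case used below.   *)
Fixpoint Cn_on (V W : normedModType R) (n : nat) (U : set V) (f : V -> W) :
    Prop :=
  (forall x, U x -> {for x, continuous f}) /\
  if n is n'.+1 then
    forall v : V,
      (forall x, U x -> derivable f x v) /\ Cn_on n' U (fun x => 'D_v f x)
  else True.

Definition Coo_on (V W : normedModType R) (U : set V) (f : V -> W) : Prop :=
  forall n, Cn_on n U f.

(* Smoothness of f : D -> W when D is seen, through iota, as an arbitrary     *)
(* subset of V: f extends locally to a smooth map on an open subset of V.     *)
(* If iota @` D is relatively open in a linear subspace of V, this is         *)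
(* smoothness with respect to that subspace.                                  *)
Definition smooth_along (T : Type) (V W : normedModType R) (iota : T -> V)
    (D : set T) (f : T -> W) : Prop :=
  forall x, D x -> exists U (F : V -> W),
    [/\ open U, U (iota x), Coo_on U F &
        forall y, D y -> U (iota y) -> f y = F (iota y)].

Definition smooth_on (V W : normedModType R) (D : set V) (f : V -> W) : Prop :=
  smooth_along id D f.

End SmoothMaps.

Section Manifolds.
Context {R : realType}.

Record chart (B : topologicalType) (d : nat) := Chart {
  chart_dom : set B ;
  chart_fun : B -> 'rV[R]_d ;
  chart_inv : 'rV[R]_d -> B ;
  chart_dom_open : open chart_dom ;
  chart_img_open : open (chart_fun @` chart_dom) ;
  chart_funK : forall x, chart_dom x -> chart_inv (chart_fun x) = x ;
  chart_fun_continuous : {within chart_dom, continuous chart_fun} ;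
  chart_inv_continuous :
    {within chart_fun @` chart_dom, continuous chart_inv} }.

Definition smooth_structure (B : topologicalType) (d : nat)
    (At : set (chart B d)) : Prop :=
  [/\ hausdorff_space B,
      @second_countable B,
      (forall b : B, exists2 c, At c & chart_dom c b) &
      forall c c', At c -> At c' ->
        smooth_on (chart_fun c @` (chart_dom c `&` chart_dom c'))
                  (chart_fun c' \o chart_inv c)].

End Manifolds.

Arguments chart : clear implicits.

Section Actions.
Context {R : realType} {V : normedModType R} {n : nat}.
Variables (G : set 'M[R]_n) (P : set V) (act : V -> 'M[R]_n -> V).

Definition right_action : Prop :=
  [/\ forall x g, P x -> G g -> P (act x g),
      forall x, P x -> act x 1%:M = x &
      forall x g h, P x -> G g -> G h -> act (act x g) h = act x (g *m h)].

Definition proper_action : Prop :=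
  right_action /\
  forall (x : nat -> V) (g : nat -> 'M[R]_n) (a b : V),
    (forall k, P (x k)) -> (forall k, G (g k)) -> P a -> P b ->
    x @ \oo --> a -> (fun k => act (x k) (g k)) @ \oo --> b ->
    exists (s : nat -> nat) (h : 'M[R]_n),
      [/\ {homo s : i j / (i < j)%N}, G h & (g \o s) @ \oo --> h].

Definition orbit_of (x : V) : set V := act x @` G.

Definition same_orbit (x y : P) : bool :=
  orbit_of (set_val x) == orbit_of (set_val y).

Fact same_orbit_refl : reflexive same_orbit.
Proof. by move=> x; exact: eqxx. Qed.

Fact same_orbit_sym : symmetric same_orbit.
Proof. by move=> x y; exact: eq_sym. Qed.

Fact same_orbit_trans : transitive same_orbit.
Proof. by move=> y x z /eqP xy /eqP yz; apply/eqP; rewrite xy. Qed.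

Definition orbit_equiv : equiv_rel P :=
  EquivRel same_orbit same_orbit_refl same_orbit_sym same_orbit_trans.

Definition orbit_space : topologicalType :=
  quotient_topology {eq_quot orbit_equiv}.

Definition orbit_proj (x : P) : orbit_space :=
  \pi_{eq_quot orbit_equiv} x.

Section Bundle.
Variables (B : topologicalType) (d : nat) (At : set (chart R B d)).
Variable proj : P -> B.

(* (proj, theta) : proj @^-1` U -> U * G is an equivariant diffeomorphism     *)
(* with inverse Psi.                                                          *)
Definition local_trivialization (U : set B) (theta : P -> 'M[R]_n)
    (Psi : B -> 'M[R]_n -> P) : Prop :=
  [/\ forall x, U (proj x) -> G (theta x) /\ Psi (proj x) (theta x) = x,
      forall b g, U b -> G g -> proj (Psi b g) = b /\ theta (Psi b g) = g,
      forall x y g, U (proj x) -> G g -> set_val y = act (set_val x) g ->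
        theta y = theta x *m g,
      smooth_along set_val (proj @^-1` U) theta &
      forall c, At c ->
        smooth_on ((chart_fun c @` (U `&` chart_dom c)) `*` G)
          (fun z : 'rV[R]_d * 'M[R]_n =>
             set_val (Psi (chart_inv c z.1) z.2) : V)].

Definition smooth_principal_bundle : Prop :=
  [/\ right_action /\
        smooth_on (P `*` G) (fun z : V * 'M[R]_n => act z.1 z.2),
      forall x g, P x -> G g -> act x g = x -> g = 1%:M,
      (forall b, exists x, proj x = b) /\
        (forall x y, proj x = proj y <->
           exists2 g, G g & set_val y = act (set_val x) g),
      continuous proj /\
        (forall c, At c ->
           smooth_along set_val (proj @^-1` chart_dom c)
             (chart_fun c \o proj)) &
      forall b, exists U theta Psi,
        [/\ open U, U b & local_trivialization U theta Psi]].

End Bundle.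

(* The topology of orbit_space is the quotient topology, and the projection   *)
(* of a principal bundle is a submersion, so that the smooth structure is the *)
(* unique one for which this can hold.                                        *)
Definition quotient_is_smooth_principal_bundle : Prop :=
  exists (d : nat) (At : set (chart R orbit_space d)),
    smooth_structure At /\ smooth_principal_bundle At orbit_proj.

End Actions.

Definition open_dense_in (T : topologicalType) (A B : set T) : Prop :=
  [/\ A `<=` B, exists2 O, open O & A = B `&` O & B `<=` closure A].

Section Christoffel.
Context {R : realType} {m : nat}.

(* An element of (R^m)^* (x) (R^m)^* (x) R^m is stored as a matrix whose rows *)
(* are indexed by the pair (i, j) and whose columns are indexed by k.         *)
Local Notation W := 'M[R]_((m * m)%N, m).

Definition chr (Gam : W) (i j k : 'I_m) : R := Gam (mxvec_index i j) k.

Definition chr_of (F : 'I_m -> 'I_m -> 'I_m -> R) : W :=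
  \matrix_(a, k) mxvec (\matrix_(i, j) F i j k) 0 a.

Lemma chr_ofE F i j k : chr (chr_of F) i j k = F i j k.
Proof. by rewrite /chr mxE mxvecE mxE. Qed.

Lemma chr_inj (G1 G2 : W) : (forall i j k, chr G1 i j k = chr G2 i j k) ->
  G1 = G2.
Proof. by move=> eqG; apply/matrixP => a k; case/mxvec_indexP: a => i j; exact: eqG. Qed.

Definition torsion_free : set W :=
  [set Gam | forall i j k, chr Gam i j k = chr Gam j i k].

Definition ricci (Gam : W) : 'M[R]_m :=
  \matrix_(j, k) \sum_i \sum_n
    (chr Gam i n i * chr Gam j k n - chr Gam j n i * chr Gam i k n).

Definition sym_ricci (Gam : W) : 'M[R]_m :=
  2^-1 *: (ricci Gam + (ricci Gam)^T).

Definition has_signature (A : 'M[R]_m) (p q : nat) : Prop :=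
  (p + q)%N = m /\
  exists2 S : 'M[R]_m, S \in unitmx &
    S^T *m A *m S = diag_mx (\row_i (if (i < p)%N then -1 else 1)).

Definition W_pq (p q : nat) : set W :=
  [set Gam | has_signature (sym_ricci Gam) p q].

Definition Z_pq (p q : nat) : set W := W_pq p q `&` torsion_free.

Definition GLplus : set 'M[R]_m := [set T | 0 < \det T].

Definition chr_eval (Gam : W) (u v : 'cV[R]_m) (w : 'rV[R]_m) : R :=
  \sum_i \sum_j \sum_k chr Gam i j k * u i 0 * v j 0 * w 0 k.

(* Vectors are columns and covectors are rows, and T acts on covectors by     *)
(* w |-> w *m invmx T.  With this convention S (T Gam) = (T S) Gam, so that   *)
(* the action is written on the right.                                        *)
Definition chr_act (Gam : W) (T : 'M[R]_m) : W :=
  chr_of (fun i j k =>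
    chr_eval Gam (T *m delta_mx i 0) (T *m delta_mx j 0)
             (delta_mx 0 k *m invmx T)).

Definition stab_plus (Gam : W) : set 'M[R]_m :=
  [set T | GLplus T /\ chr_act Gam T = Gam].

Definition tildeW_pq (p q : nat) : set W :=
  [set Gam | W_pq p q Gam /\ stab_plus Gam = [set 1%:M]].

Definition tildeZ_pq (p q : nat) : set W :=
  [set Gam | Z_pq p q Gam /\ stab_plus Gam = [set 1%:M]].

End Christoffel.

Arguments GLplus : clear implicits.
Arguments W_pq : clear implicits.
Arguments Z_pq : clear implicits.
Arguments tildeW_pq : clear implicits.
Arguments tildeZ_pq : clear implicits.

(* Main.v *)
(* The symmetric Ricci tensor is equivariant, rho(x T) = T^T rho(x) T, so when it
   is definite, a bounded family of x with bounded x T forces T to be bounded: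
   this gives properness.  A trivial stabilizer persists nearby, because a
   nontrivial element T has a power at a fixed positive distance from 1 and a
   limit of such powers would stabilize the limit point.  Trivial stabilizers are
   dense because there is a polynomial in x, a determinant of vectors built
   covariantly from x, which is nonzero only when the stabilizer is trivial, and
   which does not vanish identically on the torsion free arrays.

   For the bundle, let L(A) be the derivative of T |-> x0 T at 1; L is injective
   when x0 has trivial stabilizer.  If Lam is a linear left inverse of L, the map
   w |-> (x0 + w - L (Lam w)) (1 + Lam w) has derivative 1 at 0, and its smooth
   inverse writes every point near x0 as (x0 + k) T with k small in ker Lam and T
   near 1.  Properness makes this decomposition unique on the whole saturation
   of the slice x0 + ker Lam, so k is a chart of the orbit space and T is a
   trivialization.  Every step respects a linear subspace E stable under the
   action and under L, so both cases are handled at once. *)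
From HB Require Import structures.
Require Import Defs.
From mathcomp Require Import all_boot all_order all_algebra.
From mathcomp Require Import generic_quotient.
From mathcomp Require Import ring lra.
From mathcomp Require Import all_classical all_reals all_analysis.

Set Implicit Arguments.
Unset Strict Implicit.
Unset Printing Implicit Defensive.

Import Order.TTheory GRing.Theory Num.Theory.
Import numFieldNormedType.Exports.

Local Open Scope classical_set_scope.
Local Open Scope ring_scope.

(** * Maps of class C^k and smooth matrix-valued maps *)

(** The density polynomial must be nonzero at a torsion free array, so that one witness serves both
    families: the segment from a point of [E] to the witness then stays in [E]. Such an array is a
    commutative product on [R^m], where everything built from the torsion vanishes; hence the use of
    the trace form of left multiplication and of Krylov vectors.

    At every point of the free part [L] is injective, so a complement of its image in [E] always has
    dimension [\dim E - m * m], and all charts share one dimension.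

    The inverse function theorem is applied in the whole space of arrays, and its solutions are
    shown to lie in [E] afterwards. The local coordinates thus come with smooth extensions to open
    sets of the ambient space, which is what smoothness along a subset asks for. The theorem is used
    a second time to extract square roots near the identity, from which openness of definiteness
    follows without eigenvalues. *)

Section Ck.
Context {R : realType}.

(* The candidate derivatives [f'] are existentially quantified, so that the
   calculus rules below are equalities of functions on the whole of [V]. *)
Fixpoint Ck (V : normedModType R) (n : nat) (U : set V) (f : V -> R) : Prop :=
  (forall x, U x -> {for x, continuous f}) /\
  if n is n'.+1 then
    exists f' : V -> V -> R,
      (forall x, U x -> is_diff x f (f' x)) /\ forall v, Ck n' U (f' ^~ v)
  else True.

Definition Ck_mx (V : normedModType R) n (U : set V) a b
    (f : V -> 'M[R]_(a, b)) := forall i j, Ck n U (fun x => f x i j).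

Definition smooth_mx (V : normedModType R) (U : set V) a b
    (f : V -> 'M[R]_(a, b)) := forall n, Ck_mx n U f.

Section Operations.
Variable V : normedModType R.
Implicit Types (U : set V) (f g : V -> R).

Lemma Ck_continuous n U f x : Ck n U f -> U x -> {for x, continuous f}.
Proof. by case: n => [|n] [fc _]; exact: fc. Qed.

Lemma Ck_diff n U f x : Ck n.+1 U f -> U x -> differentiable f x.
Proof. by case=> _ [f' [df _]] Ux; have [] := df _ Ux. Qed.

Lemma is_diff_Ck n U f (f' : V -> V -> R) :
  (forall x, U x -> is_diff x f (f' x)) -> (forall v, Ck n U (f' ^~ v)) ->
  Ck n.+1 U f.
Proof.
move=> df cf; split; last by exists f'.
by move=> x Ux; apply: differentiable_continuous; have [] := df _ Ux.
Qed.

Lemma CkS n U f : Ck n.+1 U f -> Ck n U f.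
Proof.
elim: n f => [|n IH] f [fc]; first by [].
case=> f' [df cf]; split=> //; exists f'; split=> // v; exact: IH.
Qed.

Lemma Ck_sub n U U' f : U' `<=` U -> Ck n U f -> Ck n U' f.
Proof.
move=> sU; elim: n f => [|n IH] f [fc]; first by split=> // x /sU /fc.
case=> f' [df cf]; split; first by move=> x /sU /fc.
exists f'; split; [by move=> x /sU /df|by move=> v; apply: IH; exact: cf].
Qed.

Lemma Ck_cst n U (a : R) : Ck n U (fun=> a).
Proof.
elim: n a => [|n IH] a; first by split=> // x _; exact: cvg_cst.
by apply: (@is_diff_Ck _ _ _ (fun _ _ => 0)) => // x _; exact: is_diff_cst.
Qed.

Lemma Ck_add n U f g : Ck n U f -> Ck n U g -> Ck n U (fun x => f x + g x).
Proof.
elim: n f g => [|n IH] f g [fc Hf] [gc Hg].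
  by split=> // x Ux; apply: continuousD; [exact: fc|exact: gc].
case: Hf Hg => f' [df cf] [g' [dg cg]].
apply: (@is_diff_Ck _ _ _ (fun x v => f' x v + g' x v)) => [x Ux|v]; last exact: IH (cf v) (cg v).
by have := df _ Ux; have := dg _ Ux => ? ?; exact: is_diffD.
Qed.

Lemma Ck_mul n U f g : Ck n U f -> Ck n U g -> Ck n U (fun x => f x * g x).
Proof.
elim: n f g => [|n IH] f g Hf Hg.
  case: Hf Hg => fc _ [gc _].
  by split=> // x Ux; apply: continuousM; [exact: fc|exact: gc].
have cf0 := CkS Hf; have cg0 := CkS Hg.
case: Hf Hg => fc [f' [df cf]] [gc [g' [dg cg]]].
apply: (@is_diff_Ck _ _ _ (fun x v => f x * g' x v + g x * f' x v)) => [x Ux|v].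
  by have := df _ Ux; have := dg _ Ux => ? ?; exact: is_diffM.
by apply: Ck_add; [exact: IH cf0 (cg v)|exact: IH cg0 (cf v)].
Qed.

Lemma Ck_opp n U f : Ck n U f -> Ck n U (fun x => - f x).
Proof.
move=> cf; rewrite [X in Ck _ _ X](_ : _ = fun x => -1 * f x).
  by apply: Ck_mul => //; exact: Ck_cst.
by apply/funext => x; rewrite mulN1r.
Qed.

Lemma Ck_sum n U (I : Type) (r : seq I) (P : pred I) (F : I -> V -> R) :
  (forall i, P i -> Ck n U (F i)) -> Ck n U (fun x => \sum_(i <- r | P i) F i x).
Proof.
move=> cF; elim: r => [|i r IH].
  rewrite [X in Ck _ _ X](_ : _ = fun=> 0); first exact: Ck_cst.
  by apply/funext => x; rewrite big_nil.
rewrite [X in Ck _ _ X](_ : _ = fun x => (if P i then F i x else 0) +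
    \sum_(j <- r | P j) F j x).
  apply: Ck_add => //; case Pi: (P i); [exact: cF|exact: Ck_cst].
by apply/funext => x; rewrite big_cons; case: ifP => //; rewrite add0r.
Qed.

Lemma Ck_prod n U (I : Type) (r : seq I) (P : pred I) (F : I -> V -> R) :
  (forall i, P i -> Ck n U (F i)) -> Ck n U (fun x => \prod_(i <- r | P i) F i x).
Proof.
move=> cF; elim: r => [|i r IH].
  rewrite [X in Ck _ _ X](_ : _ = fun=> 1); first exact: Ck_cst.
  by apply/funext => x; rewrite big_nil.
rewrite [X in Ck _ _ X](_ : _ = fun x => (if P i then F i x else 1) *
    \prod_(j <- r | P j) F j x).
  apply: Ck_mul => //; case Pi: (P i); [exact: cF|exact: Ck_cst].
by apply/funext => x; rewrite big_cons; case: ifP => //; rewrite mul1r.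
Qed.

Lemma Ck_inv n U f : (forall x, U x -> f x != 0) -> Ck n U f ->
  Ck n U (fun x => (f x)^-1).
Proof.
move=> f0; elim: n f f0 => [|n IH] f f0 Hf.
  by case: Hf => fc _; split=> // x Ux; apply: continuousV; [exact: f0|exact: fc].
have cf0 := CkS Hf.
case: Hf => fc [f' [df cf]].
apply: (@is_diff_Ck _ _ _ (fun x v => - ((f x)^-1 * (f x)^-1) * f' x v)) => [x Ux|v].
  have [dfx <-] := df _ Ux; have fx0 := f0 _ Ux; split; first exact: differentiableV.
  rewrite diffV//; apply/funext => v.
  by rewrite /= -invfM -expr2.
have ci := IH _ f0 cf0.
exact: (Ck_mul (Ck_opp (Ck_mul ci ci)) (cf v)).
Qed.

Lemma Ck_lin n U (f : {linear V -> R}) : continuous f -> Ck n U f.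
Proof.
case: n => [|n] fc; first by split=> // x _; exact: fc.
apply: (@is_diff_Ck _ _ _ (fun _ => f)) => [x _|v]; last exact: Ck_cst.
by split; [exact: linear_differentiable|exact: diff_lin].
Qed.

Lemma is_diff_sum (W : normedModType R) (I : Type) (r : seq I)
    (F dF : I -> V -> W) x :
  (forall i, is_diff x (F i) (dF i)) ->
  is_diff x (fun y => \sum_(i <- r) F i y) (fun v => \sum_(i <- r) dF i v).
Proof.
move=> cF; elim: r => [|i r IH].
  have -> : (fun y => \sum_(i <- [::]) F i y) = cst 0.
    by apply/funext => y; rewrite big_nil.
  have -> : (fun y => \sum_(i <- [::]) dF i y) = 0.
    by apply/funext => y; rewrite big_nil.
  exact: is_diff_cst.
have di := cF i.
have -> : (fun y => \sum_(i <- i :: r) F i y) = F i + (fun y => \sum_(i <- r) F i y).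
  by apply/funext => y; rewrite big_cons.
have -> : (fun y => \sum_(i <- i :: r) dF i y) = dF i + (fun y => \sum_(i <- r) dF i y).
  by apply/funext => y; rewrite big_cons.
exact: is_diffD.
Qed.

Lemma is_diff_mx a b (f : V -> 'M[R]_(a, b)) (df : 'I_a -> 'I_b -> V -> R) x :
  (forall i j, is_diff x (fun y => f y i j) (df i j)) ->
  is_diff x f (fun v => \matrix_(i, j) df i j v).
Proof.
move=> dfx.
have H i j : is_diff x (fun y => f y i j *: (delta_mx i j : 'M[R]_(a, b)))
   (fun v => df i j v *: (delta_mx i j : 'M[R]_(a, b))).
  have [d e] := dfx i j; split; first exact: differentiableZl.
  by rewrite diffZl// e.
rewrite (_ : f = fun y => \sum_i \sum_j f y i j *: (delta_mx i j)); last first.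
  by apply/funext => y; exact: matrix_sum_delta.
rewrite [X in is_diff_def _ _ X](_ : _ =
    fun v => \sum_i \sum_j df i j v *: (delta_mx i j)); last first.
  apply/funext => v; rewrite [LHS]matrix_sum_delta.
  by apply: eq_bigr => i _; apply: eq_bigr => j _; rewrite mxE.
by apply: is_diff_sum => i; apply: is_diff_sum => j.
Qed.

End Operations.

Lemma continuous_mx (V : topologicalType) a b (f : V -> 'M[R]_(a, b)) x :
  (forall i j, {for x, continuous (fun y => f y i j)}) -> {for x, continuous f}.
Proof.
move=> fc; apply/cvg_mx_entourageP => A entA.
apply: filter_forall => i; apply: filter_forall => j.
by have /cvg_app_entourageP /(_ A entA) := fc i j;
  apply: filterS => y Ay; exact: mem_set.
Qed.

(** The direction [f' x v] fed to [g' (f x)] varies with [x], so the induction hypothesis cannot be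
    applied to it directly. Expanding over [delta_mx i j] fixes the directions and leaves sums of
    products of functions of class C^n. *)
Lemma Ck_comp (V : normedModType R) n (U : set V) a b (U' : set 'M[R]_(a, b))
    (g : 'M[R]_(a, b) -> R) (f : V -> 'M[R]_(a, b)) :
  (forall x, U x -> U' (f x)) ->
  (forall i j, Ck n U (fun x => f x i j)) -> Ck n U' g -> Ck n U (g \o f).
Proof.
move=> fU; elim: n f g fU => [|n IH] f g fU Hf Hg.
  split=> // x Ux; apply: continuous_comp.
    by apply: continuous_mx => i j; have [fc _] := Hf i j; exact: fc.
  by case: Hg => gc _; apply: gc; exact: fU.
have cfn i j := CkS (Hf i j); have cgn := CkS Hg.
have {}Hf i j : exists f' : V -> V -> R,
  (forall x, U x -> is_diff x (fun x => f x i j) (f' x)) /\ forall v, Ck n U (f' ^~ v).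
  by case: (Hf i j).
pose f' i j := sval (cid (Hf i j)).
have f'P i j : _ := svalP (cid (Hf i j)).
case: Hg => gc [g' [dg cg]].
apply: (@is_diff_Ck _ _ _ _ (fun x v => \sum_i \sum_j f' i j x v * g' (f x) (delta_mx i j))).
  move=> x Ux.
  have df : is_diff x f (fun v => \matrix_(i, j) f' i j x v).
    by apply: is_diff_mx => i j; exact: (f'P i j).1.
  have := dg _ (fU _ Ux) => dgx.
  have -> : (fun v => \sum_i \sum_j f' i j x v * g' (f x) (delta_mx i j)) =
     (g' (f x) \o (fun v => \matrix_(i, j) f' i j x v)).
    apply/funext => v /=; have [_ <-] := dgx.
    rewrite [X in 'd _ _ X]matrix_sum_delta linear_sum; apply: eq_bigr => i _.
    rewrite linear_sum; apply: eq_bigr => j _.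
    by rewrite linearZ mxE.
  exact: is_diff_comp.
move=> v; apply: Ck_sum => i _; apply: Ck_sum => j _; apply: Ck_mul.
  exact: (f'P i j).2.
by apply: (IH f (g' ^~ (delta_mx i j))) => //; exact: cg.
Qed.

Lemma eq_Cn_on (V W : normedModType R) n (U : set V) (f g : V -> W) :
  open U -> (forall x, U x -> f x = g x) -> Cn_on n U f -> Cn_on n U g.
Proof.
move=> oU; elim: n f g => [|n IH] f g fg [fc] Hf.
  split=> // x Ux; rewrite /prop_for /continuous_at -(fg _ Ux).
  apply: cvg_trans (fc _ Ux); apply: near_eq_cvg.
  by apply: filterS (open_nbhs_nbhs (conj oU Ux)) => y /fg.
split=> [x Ux|v].
  rewrite /prop_for /continuous_at -(fg _ Ux).
  apply: cvg_trans (fc _ Ux); apply: near_eq_cvg.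
  by apply: filterS (open_nbhs_nbhs (conj oU Ux)) => y /fg.
have [df cf] := Hf v; split.
  move=> x Ux; apply: near_eq_derivable (df _ Ux).
  by apply: filterS (open_nbhs_nbhs (conj oU Ux)) => y /fg.
apply: IH cf => x Ux; apply: near_eq_derive.
by apply: filterS (open_nbhs_nbhs (conj oU Ux)) => y /fg.
Qed.

(** The bridge from the entrywise Fréchet calculus to the directional derivatives of [Cn_on]. The
    formula for ['D_v f] holds on [U] only, hence the recourse to [eq_Cn_on]. *)
Lemma Cn_on_Ck (V : normedModType R) n (U : set V) a b (f : V -> 'M[R]_(a, b)) :
  open U -> (forall i j, Ck n U (fun x => f x i j)) -> Cn_on n U f.
Proof.
move=> oU; elim: n f => [|n IH] f cf.
  by split=> // x Ux; apply: continuous_mx => i j; exact: Ck_continuous (cf i j) Ux.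
have {}Hf i j : exists f' : V -> V -> R,
  (forall x, U x -> is_diff x (fun x => f x i j) (f' x)) /\ forall v, Ck n U (f' ^~ v).
  by case: (cf i j).
pose f' i j := sval (cid (Hf i j)).
have f'P i j : _ := svalP (cid (Hf i j)).
have derf x v : U x -> derivable f x v /\ 'D_v f x = \matrix_(i, j) f' i j x v.
  move=> Ux.
  have df : is_diff x f (fun v => \matrix_(i, j) f' i j x v).
    by apply: is_diff_mx => i j; exact: (f'P i j).1.
  case: df => df ef; split; first exact: diff_derivable.
  by rewrite deriveE// ef.
split=> [x Ux|v].
  by apply: continuous_mx => i j; exact: Ck_continuous (cf i j) Ux.
split=> [x Ux|]; first by have [] := derf x v Ux.
apply: (@eq_Cn_on _ _ _ _ (fun x => \matrix_(i, j) f' i j x v)) => //.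
  by move=> x Ux; have [] := derf x v Ux.
apply: IH => i j.
rewrite [X in Ck _ _ X](_ : _ = f' i j ^~ v); first exact: (f'P i j).2.
by apply/funext => x; rewrite mxE.
Qed.

Lemma Coo_on_smooth (V : normedModType R) (U : set V) a b (f : V -> 'M[R]_(a, b)) :
  open U -> smooth_mx U f -> Coo_on U f.
Proof. by move=> oU sf n; apply: Cn_on_Ck => // i j; exact: sf. Qed.

(** The explicit remainder lets a derivative be found by a direct estimate instead of the calculus
    rules. *)
Lemma is_diffP (V W : normedModType R) (f : V -> W) (A : {linear V -> W}) x :
  continuous A -> is_diff x f A <->
  forall e, 0 < e -> \forall h \near 0, `|f (h + x) - f x - A h| <= e * `|h|.
Proof.
move=> Ac; split.
  case=> /diff_locallyP [_ /eqaddoP fe] dE e e0; have := fe _ e0.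
  by apply: filterS => h; rewrite !fctE dE /= opprD addrA.
move=> H.
have fe : f \o shift x = cst (f x) + A +o_ 0 id.
  by apply/eqaddoP => e e0; apply: filterS (H e e0) => h; rewrite !fctE /= opprD addrA.
have dE : 'd f x = A :> (V -> W) by exact: diff_unique.
by split=> //; apply/diff_locallyP; rewrite dE.
Qed.

Lemma near_is_diff (V W : normedModType R) (f g df : V -> W) x :
  (\near x, f x = g x) -> is_diff x f df -> is_diff x g df.
Proof.
move=> fg [dfx <-]; have dc := diff_continuous dfx.
have fgx : f x = g x := nbhs_singleton fg.
apply/is_diffP => // e e0.
have /(is_diffP f x dc) /(_ e e0) : is_diff x f ('d f x) by split.
move: fg; rewrite (near_shift 0 x) subr0; apply: filterS2 => h /= fgh.
by rewrite fgh fgx.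
Qed.

Lemma eq_Ck (V : normedModType R) n (U : set V) (f g : V -> R) :
  open U -> (forall x, U x -> f x = g x) -> Ck n U f -> Ck n U g.
Proof.
move=> oU fg; have near_fg x : U x -> \near x, f x = g x.
  by move=> Ux; apply: filterS (open_nbhs_nbhs (conj oU Ux)) => y /fg.
case: n => [|n] [fc Hf].
  split=> // x Ux; rewrite /prop_for /continuous_at -(fg _ Ux).
  by apply: cvg_trans (fc _ Ux); apply: near_eq_cvg; exact: near_fg.
have [f' [df cf]] := Hf; apply: is_diff_Ck cf => x Ux.
by apply: near_is_diff (df _ Ux); exact: near_fg.
Qed.

Lemma Ck_d (V : normedModType R) n (U : set V) (f : V -> R) v :
  open U -> Ck n.+1 U f -> Ck n U (fun x => 'd f x v).
Proof.
move=> oU [_ [f' [df cf]]]; apply: eq_Ck (cf v) => // x Ux.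
by have [_ <-] := df x Ux.
Qed.

End Ck.

(** * Calculus of matrix-valued maps *)

Section SmoothMatrices.
Context {R : realType} {V : normedModType R}.
Implicit Types (U : set V) (n : nat).

Lemma linear_mx_entry a b c d (f : 'M[R]_(a, b) -> 'M[R]_(c, d)) : linear f ->
  forall A i j, f A i j = \sum_p \sum_q A p q * f (delta_mx p q) i j.
Proof.
move=> lf A i j.
pose fL := HB.pack_for {linear 'M[R]_(a, b) -> 'M[R]_(c, d)} f
  (GRing.isLinear.Build _ _ _ _ _ lf).
rewrite -[f]/(fL : _ -> _) {1}[A]matrix_sum_delta linear_sum summxE.
apply: eq_bigr => p _; rewrite linear_sum summxE.
by apply: eq_bigr => q _; rewrite linearZ mxE.
Qed.

Lemma Ck_mx_cst n U a b (A : 'M[R]_(a, b)) : Ck_mx n U (fun=> A).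
Proof. by move=> i j; exact: Ck_cst. Qed.

Lemma Ck_mx_add n U a b (f g : V -> 'M[R]_(a, b)) :
  Ck_mx n U f -> Ck_mx n U g -> Ck_mx n U (fun x => f x + g x).
Proof.
move=> cf cg i j; rewrite [X in Ck _ _ X](_ : _ = fun x => f x i j + g x i j).
  exact: Ck_add.
by apply/funext => x; rewrite mxE.
Qed.

Lemma Ck_mx_mul n U a b c (f : V -> 'M[R]_(a, b)) (g : V -> 'M[R]_(b, c)) :
  Ck_mx n U f -> Ck_mx n U g -> Ck_mx n U (fun x => f x *m g x).
Proof.
move=> cf cg i j; rewrite [X in Ck _ _ X](_ : _ = fun x => \sum_k f x i k * g x k j).
  by apply: Ck_sum => k _; exact: Ck_mul.
by apply/funext => x; rewrite mxE.
Qed.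

Lemma Ck_mx_lin n U a b c d (g : 'M[R]_(a, b) -> 'M[R]_(c, d)) (f : V -> 'M[R]_(a, b)) :
  linear g -> Ck_mx n U f -> Ck_mx n U (fun x => g (f x)).
Proof.
move=> lg cf i j; rewrite [X in Ck _ _ X](_ : _ = fun x =>
    \sum_p \sum_q f x p q * g (delta_mx p q) i j).
  by apply: Ck_sum => p _; apply: Ck_sum => q _; apply: Ck_mul => //; exact: Ck_cst.
by apply/funext => x; rewrite (linear_mx_entry lg).
Qed.

Lemma Ck_mx_tr n U a b (f : V -> 'M[R]_(a, b)) :
  Ck_mx n U f -> Ck_mx n U (fun x => (f x)^T).
Proof. by apply: Ck_mx_lin => k A B; rewrite linearP. Qed.

Lemma Ck_mx_sub n U a b (f g : V -> 'M[R]_(a, b)) :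
  Ck_mx n U f -> Ck_mx n U g -> Ck_mx n U (fun x => f x - g x).
Proof.
move=> cf cg; apply: Ck_mx_add => //.
by apply: (@Ck_mx_lin _ _ _ _ _ _ -%R) => // k A B; rewrite opprD scalerN.
Qed.

Lemma Ck_det n U a (f : V -> 'M[R]_a) : Ck_mx n U f -> Ck n U (fun x => \det (f x)).
Proof.
move=> cf; apply: Ck_sum => s _; apply: Ck_mul; first exact: Ck_cst.
by apply: Ck_prod => i _.
Qed.

Lemma Ck_mx_inv n U a (f : V -> 'M[R]_a) : (forall x, U x -> f x \in unitmx) ->
  open U -> Ck_mx n U f -> Ck_mx n U (fun x => invmx (f x)).
Proof.
move=> uf oU cf i j.
(* Cramer's formula, which agrees with [invmx] on invertible matrices, hence on [U]. *)
apply: (@eq_Ck _ _ _ _ (fun x => (\det (f x))^-1 *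
   ((-1) ^+ (j + i) * \det (row' j (col' i (f x)))))) => //.
  by move=> x Ux; rewrite /invmx (uf x Ux) !mxE.
apply: Ck_mul.
  apply: Ck_inv; last exact: Ck_det.
  by move=> x /uf; rewrite unitmxE unitfE.
apply: Ck_mul; first exact: Ck_cst.
apply: Ck_det => k l.
rewrite [X in Ck _ _ X](_ : _ = fun x => f x (lift j k) (lift i l)); first exact: cf.
by apply/funext => x; rewrite !mxE.
Qed.

End SmoothMatrices.

Section SmoothMatrixMaps.
Context {R : realType}.

Lemma Ck_mx_id n a b (U : set 'M[R]_(a, b)) : Ck_mx n U id.
Proof.
move=> i j.
have lc : linear (fun A : 'M[R]_(a, b) => A i j : R^o) by move=> k A B; rewrite !mxE.
pose cL := HB.pack_for {linear 'M[R]_(a, b) -> R^o} (fun A : 'M[R]_(a, b) => A i j : R^o)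
  (GRing.isLinear.Build _ _ _ _ _ lc).
exact: (@Ck_lin _ _ _ _ cL (@coord_continuous _ _ _ _ _)).
Qed.

Lemma Ck_mx_comp (V : normedModType R) n (U : set V) a b c d (U' : set 'M[R]_(a, b))
    (g : 'M[R]_(a, b) -> 'M[R]_(c, d)) (f : V -> 'M[R]_(a, b)) :
  (forall x, U x -> U' (f x)) -> Ck_mx n U f -> Ck_mx n U' g -> Ck_mx n U (g \o f).
Proof. by move=> fU cf cg i j; exact: (Ck_comp fU cf (cg i j)). Qed.

Lemma Ck_mx_fst n a b c d (U : set ('M[R]_(a, b) * 'M[R]_(c, d))%type) :
  Ck_mx n U (fun z => z.1).
Proof.
move=> i j.
have lc : linear (fun z : ('M[R]_(a, b) * 'M[R]_(c, d))%type => z.1 i j : R^o).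
  by move=> k A B; rewrite !mxE.
pose cL := HB.pack_for {linear ('M[R]_(a, b) * 'M[R]_(c, d))%type -> R^o}
  (fun z : ('M[R]_(a, b) * 'M[R]_(c, d))%type => z.1 i j : R^o)
  (GRing.isLinear.Build _ _ _ _ _ lc).
apply: (@Ck_lin _ _ _ _ cL) => z.
apply: (@continuous_comp _ _ _ (@fst _ _) (fun A : 'M[R]_(a, b) => A i j)).
  exact: cvg_fst.
exact: coord_continuous.
Qed.

Lemma Ck_mx_snd n a b c d (U : set ('M[R]_(a, b) * 'M[R]_(c, d))%type) :
  Ck_mx n U (fun z => z.2).
Proof.
move=> i j.
have lc : linear (fun z : ('M[R]_(a, b) * 'M[R]_(c, d))%type => z.2 i j : R^o).
  by move=> k A B; rewrite !mxE.
pose cL := HB.pack_for {linear ('M[R]_(a, b) * 'M[R]_(c, d))%type -> R^o}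
  (fun z : ('M[R]_(a, b) * 'M[R]_(c, d))%type => z.2 i j : R^o)
  (GRing.isLinear.Build _ _ _ _ _ lc).
apply: (@Ck_lin _ _ _ _ cL) => z.
apply: (@continuous_comp _ _ _ (@snd _ _) (fun A : 'M[R]_(c, d) => A i j)).
  exact: cvg_snd.
exact: coord_continuous.
Qed.

Lemma Ck_mx_continuous (V : normedModType R) n (U : set V) a b (f : V -> 'M[R]_(a, b)) x :
  Ck_mx n U f -> U x -> {for x, continuous f}.
Proof. by move=> cf Ux; apply: continuous_mx => i j; exact: Ck_continuous (cf i j) Ux. Qed.

Lemma linear_mx_continuous a b c d (g : 'M[R]_(a, b) -> 'M[R]_(c, d)) :
  linear g -> continuous g.
Proof.
move=> lg x; apply: (@Ck_mx_continuous _ 0 setT) => //.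
by apply: Ck_mx_lin => //; exact: Ck_mx_id.
Qed.

End SmoothMatrixMaps.

(** * The inverse function theorem *)

Section MatrixNorm.
Context {R : realType}.

Lemma ler_entry_norm a b (A : 'M[R]_(a, b)) i j : `|A i j| <= `|A|.
Proof.
rewrite [leRHS]/Num.Def.normr /= mx_normrE.
exact: (le_bigmax _ (fun p : 'I_a * 'I_b => `|A p.1 p.2|) (i, j)).
Qed.

Lemma mx_norm_le a b (A : 'M[R]_(a, b)) c :
  0 <= c -> (forall i j, `|A i j| <= c) -> `|A| <= c.
Proof.
move=> c0 Ac; rewrite [leLHS]/Num.Def.normr /= mx_normrE.
by apply: bigmax_le => // -[i j] _; exact: Ac.
Qed.

Lemma norm_mulmx a b c (A : 'M[R]_(a, b)) (B : 'M[R]_(b, c)) :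
  `|A *m B| <= b%:R * `|A| * `|B|.
Proof.
apply: mx_norm_le => [|i j]; first by rewrite !mulr_ge0.
rewrite mxE; apply: le_trans (ler_norm_sum _ _ _) _.
rewrite -mulrA mulr_natl -[X in _ *+ X]card_ord -sumr_const.
by apply: ler_sum => k _; rewrite normrM ler_pM // ler_entry_norm.
Qed.

Lemma norm_trmx a b (A : 'M[R]_(a, b)) : `|A^T| = `|A|.
Proof.
by apply/eqP; rewrite eq_le; apply/andP; split;
  apply: mx_norm_le => // i j; rewrite ?mxE ?ler_entry_norm //;
  have := ler_entry_norm A^T j i; rewrite mxE.
Qed.

Lemma nbhs_mxP a b (x : 'M[R]_(a, b)) (P : set 'M[R]_(a, b)) :
  nbhs x P <-> exists2 r, 0 < r & forall y, `|y - x| < r -> P y.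
Proof.
split=> [/nbhs_ballP [r r0 rP]|[r r0 rP]].
  by exists r => // y xy; apply: rP; rewrite -ball_normE /= distrC.
apply/nbhs_ballP; exists r => // y; rewrite -ball_normE /= distrC.
exact: rP.
Qed.

Lemma open_mxP a b (A : set 'M[R]_(a, b)) :
  open A <-> forall x, A x -> exists2 r, 0 < r & forall y, `|y - x| < r -> A y.
Proof.
rewrite openE; split=> H x Ax; first by apply/nbhs_mxP; exact: H.
by apply/nbhs_mxP; exact: H.
Qed.

Lemma open_ball_mx a b (x : 'M[R]_(a, b)) r : open [set y | `|y - x| < r].
Proof.
apply/open_mxP => y /= yx; exists (r - `|y - x|); first by rewrite subr_gt0.
move=> z zy; apply: le_lt_trans (ler_distD y _ _) _.
by rewrite -ltrBrDr.
Qed.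

Lemma continuous_mxP a b c d (f : 'M[R]_(a, b) -> 'M[R]_(c, d)) x :
  {for x, continuous f} <-> forall e, 0 < e ->
    exists2 r, 0 < r & forall y, `|y - x| < r -> `|f y - f x| < e.
Proof.
split=> [/cvgrPdist_lt fc e e0|H].
  have [r r0 rP] := (nbhs_mxP _ _).1 (fc e e0).
  by exists r => // y /rP /=; rewrite distrC.
apply/(cvgrPdist_lt (FF := nbhs_filter x)) => e e0; apply/nbhs_mxP.
by have [r r0 rP] := H e e0; exists r => // y /rP; rewrite distrC.
Qed.

Lemma closed_ball_mx a b r : closed [set y : 'M[R]_(a, b) | `|y| <= r].
Proof.
rewrite (_ : mkset _ = ~` [set y | r < `|y|]); last first.
  by apply/seteqP; split=> y /=; rewrite leNgt => /negP.
apply: open_closedC; apply/open_mxP => y /= ry.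
exists (`|y| - r); first by rewrite subr_gt0.
move=> z; rewrite distrC => zy; rewrite -ltrN2 -(ltrD2l `|y|).
by apply: le_lt_trans zy; apply: lerB_dist.
Qed.

Lemma lin_mx_unit a b (f : {linear 'M[R]_(a, b) -> 'M[R]_(a, b)}) :
  (forall v, f v = 0 -> v = 0) -> lin_mx f \in unitmx.
Proof.
move=> f0; rewrite -row_free_unit; apply/inj_row_free => v.
rewrite -[v]vec_mxK mul_vec_lin => fv.
by rewrite (f0 (vec_mx v)) ?linear0 // -[LHS]mxvecK fv linear0.
Qed.

End MatrixNorm.

HB.instance Definition _ (R : realType) a b := Complete.on 'M[R]_(a, b).

Section InverseFunction.
Context {R : realType} {a b : nat}.
Local Notation E := 'M[R]_(a, b).
Variables (F : E -> E) (U : set E).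
Hypotheses (oU : open U) (U0 : U 0) (sF : smooth_mx U F).
Hypothesis dF0 : forall v, 'd F 0 v = v.

Lemma ift_entry_diff i j x : U x -> differentiable (fun y => F y i j) x.
Proof. exact: Ck_diff (sF 1 i j). Qed.

Lemma ift_is_diff x : U x ->
  is_diff x F (fun v => \matrix_(i, j) 'd (fun y => F y i j) x v).
Proof.
move=> Ux; apply: is_diff_mx => i j.
by split=> //; exact: ift_entry_diff.
Qed.

Lemma ift_diffE x v i j : U x -> 'd F x v i j = 'd (fun y => F y i j) x v.
Proof. by move=> Ux; have [_ ->] := ift_is_diff Ux; rewrite mxE. Qed.

Lemma ift_near_id : exists2 r, 0 < r & forall x, `|x| < r ->
  U x /\ forall v, `|'d F x v - v| <= 2^-1 * `|v|.
Proof.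
(* An entry of ['d F x v - v] is a sum of [a * b] terms of size at most [c * |v|], and
   [a * b * c <= 1/2]; the added 1 keeps [N] positive for empty matrices. *)
pose N : R := (a * b)%N%:R + 1.
have N0 : 0 < N by rewrite ltr_wpDl.
pose c : R := (2 * N)^-1.
have c0 : 0 < c by rewrite invr_gt0 mulr_gt0.
have H : \forall x \near (0 : E), forall i j p q,
    `|'d (fun y => F y i j) x (delta_mx p q) - (delta_mx p q : E) i j| <= c.
  pose P i j p q x :=
    `|'d (fun y => F y i j) x (delta_mx p q) - (delta_mx p q : E) i j| <= c.
  apply: (@filter_forall _ _ (fun i x => forall j p q, P i j p q x) (nbhs _) _) => i.
  apply: (@filter_forall _ _ (fun j x => forall p q, P i j p q x) (nbhs _) _) => j.
  apply: (@filter_forall _ _ (fun p x => forall q, P i j p q x) (nbhs _) _) => p.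
  apply: (@filter_forall _ _ (P i j p) (nbhs _) _) => q; rewrite {}/P.
  have cd : {for 0, continuous (fun x => 'd (fun y => F y i j) x (delta_mx p q))}.
    by apply: (@Ck_continuous _ _ 0 U) => //; apply: Ck_d => //; exact: sF.
  move/cvgrPdist_le : cd => /(_ _ c0); apply: filterS => x.
  have <- : 'd (fun y => F y i j) 0 (delta_mx p q) = (delta_mx p q : E) i j.
    by rewrite -(ift_diffE (delta_mx p q) i j U0) dF0.
  move=> h; rewrite distrC; exact: h.
have [r1 r10 rP1] := (nbhs_mxP _ _).1 (open_nbhs_nbhs (conj oU U0)).
have [r2 r20 rP2] := (nbhs_mxP (0 : E) _).1 H.
exists (Num.min r1 r2); first by rewrite lt_min r10.
move=> x; rewrite lt_min => /andP[xr1 xr2].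
have Ux : U x by apply: rP1; rewrite subr0.
have dx := rP2 x ltac:(by rewrite subr0).
split=> // v; apply: mx_norm_le => [|i j]; first by rewrite mulr_ge0.
rewrite mxE [(- v) i j]mxE (ift_diffE v i j Ux).
have -> : 'd (fun y => F y i j) x v - v i j = \sum_p \sum_q
   v p q * ('d (fun y => F y i j) x (delta_mx p q) - (delta_mx p q : E) i j).
  rewrite {1}[v]matrix_sum_delta linear_sum /= {2}[v]matrix_sum_delta summxE -sumrB.
  apply: eq_bigr => p _; rewrite linear_sum summxE -sumrB.
  by apply: eq_bigr => q _; rewrite linearZ mulrBr; congr (_ - _); rewrite mxE.
apply: (@le_trans _ _ (\sum_(p < a) \sum_(q < b) `|v| * c)).
  apply: le_trans (ler_norm_sum _ _ _) _; apply: ler_sum => p _.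
  apply: le_trans (ler_norm_sum _ _ _) _; apply: ler_sum => q _.
  by rewrite normrM ler_pM // ler_entry_norm.
rewrite !sumr_const !card_ord -mulrnA mulnC -[leLHS]mulr_natr -mulrA mulrC.
rewrite ler_wpM2r //.
have cN : c * (2 * N) = 1 by rewrite mulVf // lt0r_neq0 // mulr_gt0.
move: cN c0; rewrite /N; set k : R := _%:R => cN c0; nra.
Qed.

(** The mean value theorem is applied to each entry of [F - id] on the segment from [x] to [y]; with
    the max norm every entry may have its own intermediate point. *)
Lemma ift_lipschitz r : (forall x, `|x| < r ->
    U x /\ forall v, `|'d F x v - v| <= 2^-1 * `|v|) ->
  forall x y, `|x| < r -> `|y| < r ->
  `|(F y - y) - (F x - x)| <= 2^-1 * `|y - x|.
Proof.
move=> rP x y xr yr; apply: mx_norm_le => [|i j]; first by rewrite mulr_ge0.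
pose g (t : R) : E := x + t *: (y - x).
have gr (t : R) : 0 <= t -> t <= 1 -> `|g t| < r.
  move=> t0 t1; have -> : g t = (1 - t) *: x + t *: y.
    by apply/matrixP => p q; rewrite !mxE; ring.
  apply: le_lt_trans (ler_normD _ _) _; rewrite !normrZ !ger0_norm ?subr_ge0//.
  have [->|tn] := eqVneq t 0; first by rewrite mul0r addr0 subr0 mul1r.
  have : (1 - t) * `|x| + t * `|y| < (1 - t) * r + t * r.
    rewrite ler_ltD //; first by rewrite ler_wpM2l ?subr_ge0 // ltW.
    by rewrite ltr_pM2l // lt_def tn.
  by rewrite -mulrDl subrK mul1r.
pose s (t : R) : R := F (g t) i j - g t i j.
have gd t : is_diff t g (fun h => h *: (y - x)).
  pose k : R -> E := fun h => h *: (y - x).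
  have dk : is_diff t k k by exact: is_diff_scalel.
  have := is_diffD (is_diff_cst x t) dk.
  by rewrite add0r.
have sd (t : R) : 0 <= t -> t <= 1 -> is_derive t 1 s ('d F (g t) (y - x) i j - (y - x) i j).
  move=> t0 t1; have [Ug _] := rP _ (gr t t0 t1).
  have h1 : is_diff t ((fun z => F z i j) \o g) 
      ('d (fun z => F z i j) (g t) \o (fun h => h *: (y - x))).
    by apply: is_diff_comp; split=> //; exact: ift_entry_diff.
  have h2 : is_diff t ((fun z : E => z i j) \o g) ((fun z : E => z i j) \o (fun h => h *: (y - x))).
    apply: is_diff_comp; split; first exact: differentiable_coord.
    have lc : linear (fun A : E => A i j : R^o) by move=> k A B; rewrite !mxE.
    pose cL := HB.pack_for {linear E -> R^o} (fun A : E => A i j : R^o)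
      (GRing.isLinear.Build _ _ _ _ _ lc).
    exact: (@diff_lin _ _ _ cL _ (@coord_continuous _ _ _ i j)).
  have [ds es] := is_diffB h1 h2.
  apply: DeriveDef; first exact: diff_derivable ds.
  rewrite deriveE; last exact: ds.
  by rewrite -[LHS]/('d _ _ _) es !fctE /= scale1r ift_diffE.
have [||t /[!in_itv] /= /andP[t0 t1]] := @MVT_segment R s
    (fun t => 'd F (g t) (y - x) i j - (y - x) i j) 0 1 ler01.
- by move=> t /[!in_itv] /= /andP[/ltW t0 /ltW t1]; exact: sd.
- apply: derivable_within_continuous => t /[!in_itv] /= /andP[t0 t1].
  by have [] := sd t t0 t1.
rewrite subr0 mulr1 /s /g scale0r addr0 scale1r [x + _]addrC subrK => e.
rewrite !mxE in e *; rewrite e.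
have [_ /(_ (y - x))] := rP _ (gr t t0 t1); apply: le_trans.
apply: le_trans (ler_entry_norm _ i j).
by rewrite /g [in leRHS]mxE [X in _ <= `|_ + X|]mxE !mxE.
Qed.


Theorem inverse_function : exists (V0 W : set E) (G : E -> E),
  [/\ open V0, V0 0, V0 `<=` U & open W] /\
  [/\ forall x, V0 x -> W (F x) /\ G (F x) = x,
      forall y, W y -> V0 (G y) /\ F (G y) = y & smooth_mx W G].
Proof.
have [r r0 rP] := ift_near_id.
have lip := ift_lipschitz rP.
(* As [F - id] is Lipschitz with constant 1/2, [F] shrinks distances at most by half: this yields
   injectivity and a Lipschitz bound for the inverse. *)
have expand x y : `|x| < r -> `|y| < r -> `|y - x| <= 2 * `|F y - F x|.
  move=> xr yr; have := lip x y xr yr.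
  have -> : F y - y - (F x - x) = (F y - F x) - (y - x).
    by apply/matrixP => ? ?; rewrite !mxE; ring.
  have := lerB_dist (y - x) (F y - F x); rewrite (distrC (y - x)).
  set p := `|y - x|; set q := `|F y - F x|; set t := `|_ - _ - _|; lra.
(* A preimage is a fixed point of the contraction [h]. It preserves the ball of radius [r / 2]: at
   most [r / 4] comes from [y - F 0], and [r / 4] from the Lipschitz bound. *)
have Fsurj y : `|y - F 0| < r / 4 -> exists2 x, `|x| < r & F x = y.
  move=> yF; pose h x := y - (F x - x).
  have hC : {homo h : x / `|x| <= r / 2 >-> `|x| <= r / 2}.
    move=> x xr; have := lip 0 x; rewrite normr0 => /(_ r0) /(_ ltac:(lra)).
    rewrite !subr0 => l; have -> : h x = (y - F 0) - (F x - x - F 0).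
      by apply/matrixP => ? ?; rewrite /h !mxE; ring.
    have := ler_normB (y - F 0) (F x - x - F 0); move: l yF.
    by set p := `|y - _|; set q := `|_ - _ - F 0|; move: `|x| `|_ - _| xr => /= *; lra.
  pose C := [set x : E | `|x| <= r / 2].
  have hctr : is_contraction (mkfun hC : {fun C >-> C}).
    exists (2^-1)%:nng; split=> /=; first by lra.
    case=> u v /= [ur vr]; rewrite /C /= in ur vr; have := lip v u ltac:(lra) ltac:(lra).
    rewrite (distrC (F u - u)); congr (`|_| <= _).
    by apply/matrixP => ? ?; rewrite /mkfun /h !mxE; ring.
  have C0 : [set x : E | `|x| <= r / 2] !=set0.
    by exists 0; rewrite /= normr0; lra.
  have [x xr /= xh] := banach_fixed_point hctr (@closed_ball_mx _ _ _ _) C0.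
  exists x; first by move: xr; rewrite /C /=; lra.
  have -> : F x = y + x - (y - (F x - x)).
    by apply/matrixP => ? ?; rewrite !mxE; ring.
  by rewrite -[y - _]/(mkfun hC x) -xh addrK.
pose V0 := [set x : E | `|x| < r /\ `|F x - F 0| < r / 4].
pose W := [set y : E | `|y - F 0| < r / 4].
have [G GP] : exists G : E -> E, forall y, W y -> V0 (G y) /\ F (G y) = y.
  have H y : exists x, W y -> V0 x /\ F x = y.
    have [Wy|nW] := pselect (W y); last by exists 0.
    by have [x xr Fx] := Fsurj y Wy; exists x => _; rewrite /V0 /= Fx.
  by exists (fun y => sval (cid (H y))) => y; exact: (svalP (cid (H y))).
have GK x : V0 x -> W (F x) /\ G (F x) = x.
  move=> [xr Wx]; split=> //; have [[Gr _] FG] := GP _ Wx.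
  have := expand _ _ xr Gr; rewrite FG subrr normr0 mulr0 normr_le0 subr_eq0.
  by move/eqP.
have Vr x : V0 x -> `|x| < r by case.
have oV0 : open V0.
  apply/open_mxP => x [xr Fx].
  have Fc : {for x, continuous F}.
    by apply: (Ck_mx_continuous (sF 0)); have [] := rP x xr.
  have [d d0 dP] := (continuous_mxP _ _).1 Fc (r / 4 - `|F x - F 0|) ltac:(by rewrite subr_gt0).
  have := @open_ball_mx R a b 0 r; move/open_mxP => /(_ x ltac:(by rewrite /= subr0)) [d' d'0 d'P].
  exists (Num.min d d'); first by rewrite lt_min d0.
  move=> y; rewrite lt_min => /andP[yd yd']; split.
    by have := d'P y yd'; rewrite /= subr0.
  apply: le_lt_trans (ler_distD (F x) _ _) _.
  by rewrite -ltrBrDr; exact: dP.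
exists V0, W, G; split; first split=> //.
- by rewrite /V0 /= normr0 subrr normr0; split=> //; rewrite divr_gt0.
- by move=> x [/rP []].
- exact: open_ball_mx.
split=> //.
have oW : open W by exact: open_ball_mx.
(* The matrix of the derivative on flattened matrices; [|'d F x v - v| <= |v| / 2] excludes a
   kernel. *)
pose J x := lin_mx ('d F x).
have Ju x : `|x| < r -> J x \in unitmx.
  move=> xr; apply: lin_mx_unit => v dv; have [_ /(_ v)] := rP x xr.
  rewrite dv sub0r normrN => vle; apply/eqP; rewrite -normr_le0.
  by have := normr_ge0 v; lra.
have Ux x : V0 x -> U x by move=> /Vr /rP [].
have JC n : Ck_mx n V0 J.
  move=> p q; case/mxvec_indexP: q => i j.
  apply: (@eq_Ck _ _ _ _ (fun x => 'd (fun y => F y i j) x (vec_mx (delta_mx 0 p)))) => //.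
    by move=> x Vx; rewrite /J /lin_mx mxE /= mxvecE (ift_diffE _ i j (Ux _ Vx)).
  apply: Ck_d => //; apply: Ck_sub (sF n.+1 i j); exact: Ux.
pose A y v : E := vec_mx (mxvec v *m invmx (J (G y))).
have Alin y : linear (A y) by move=> k u v; rewrite /A !linearP /= mulmxDl -scalemxAl linearP.
have Gdiff y : W y -> is_diff y G (A y).
  move=> Wy; have [Vx Fx] := GP y Wy.
  pose AL := HB.pack_for {linear E -> E} (A y) (GRing.isLinear.Build _ _ _ _ _ (Alin y)).
  have Ac : continuous AL by apply: linear_mx_continuous; exact: Alin.
  apply/(@is_diffP _ _ _ G AL) => // e e0.
  have [C C0 CP] := linear_lipschitz Ac.
  have Fd : is_diff (G y) F ('d F (G y)).
    by have [? _] := ift_is_diff (Ux _ Vx); split.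
  have dFc : continuous ('d F (G y)) by case: Fd => ? _; exact: diff_continuous.
  (* The increment of [G] is at most twice that of [y], and the inverse derivative multiplies norms
     by at most [C]. *)
  have e'0 : 0 < e / (2 * C) by rewrite divr_gt0 // mulr_gt0.
  have /nbhs_mxP [d d0 dP] := (is_diffP _ _ dFc).1 Fd _ e'0.
  move/open_mxP: oW => /(_ y Wy) [d' d'0 d'P].
  apply/nbhs_mxP; exists (Num.min d' (d / 2)); first by rewrite lt_min d'0 divr_gt0.
  move=> k; rewrite subr0 lt_min => /andP[kd' kd].
  have Wk : W (k + y) by apply: d'P; rewrite addrK.
  have [Vk Fk] := GP _ Wk.
  pose h := G (k + y) - G y.
  have hk : `|h| <= 2 * `|k|.
    by have := expand _ _ (Vr _ Vx) (Vr _ Vk); rewrite Fk Fx addrK.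
  have := dP h; rewrite subr0 => /(_ ltac:(lra)).
  rewrite {1}/h subrK Fk Fx addrK => dk.
  have -> : G (k + y) - G y - AL k = - AL (k - 'd F (G y) h).
    rewrite linearB opprB; congr (_ - _).
    rewrite -/h /AL /= /A -mul_vec_lin -mulmxA mulmxV ?mulmx1 ?mxvecK //.
    exact/Ju/Vr.
  rewrite normrN; apply: le_trans (CP _) _.
  apply: le_trans (_ : C * (e / (2 * C) * (2 * `|k|)) <= _).
    rewrite ler_pM2l //; apply: le_trans dk _.
    by rewrite ler_pM2l.
  rewrite le_eqVlt; apply/orP; left; apply/eqP; field.
  by rewrite gt_eqF.
(* Bootstrap: the derivative of [G] at [y] is the inverse of [J (G y)], which is of class C^n as
   soon as [G] is. *)
elim=> [|n IH].
  move=> i j; split=> // y Wy; have [Gd _] := Gdiff y Wy.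
  have Gc := differentiable_continuous Gd.
  exact: (continuous_comp Gc (@coord_continuous _ _ _ i j _)).
move=> i j; apply: (@is_diff_Ck _ _ _ _ _ (fun y v => A y v i j)).
  move=> y Wy; have [Gd Ge] := Gdiff y Wy.
  have := @is_diff_comp _ _ _ _ G (A y) (fun z : E => z i j) (fun z : E => z i j) y.
  apply; first by split.
  have lc : linear (fun A : E => A i j : R^o) by move=> k B C; rewrite !mxE.
  pose cL := HB.pack_for {linear E -> R^o} (fun A : E => A i j : R^o)
    (GRing.isLinear.Build _ _ _ _ _ lc).
  split; first exact: differentiable_coord.
  exact: (@diff_lin _ _ _ cL _ (@coord_continuous _ _ _ i j)).
move=> v.
have : Ck_mx n W (fun y => A y v).
  apply: Ck_mx_lin; first by move=> k B C; rewrite linearP.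
  apply: Ck_mx_mul; first exact: Ck_mx_cst.
  apply: (@Ck_mx_comp _ _ _ _ _ _ _ _ V0 (fun x => invmx (J x)) G) => //.
    by move=> y /GP [].
  by apply: Ck_mx_inv => // x /Vr; exact: Ju.
exact.
Qed.

End InverseFunction.

(** * Left multiplications, the action and its derivative *)

Section Multiplication.
Context {R : realType} {m : nat}.
Local Notation W := 'M[R]_((m * m)%N, m).
Implicit Types (Gam : W) (T S A : 'M[R]_m) (u v : 'cV[R]_m).

(** [Gam] is read as a bilinear product on [R^m], and this is left multiplication by [u]. Index
    computations become matrix identities. *)
Definition lmul Gam u : 'M[R]_m := \matrix_(k, j) \sum_i chr Gam i j k * u i 0.

Lemma lmul_delta Gam i j k : lmul Gam (delta_mx i 0) k j = chr Gam i j k.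
Proof.
rewrite mxE (bigD1 i) //= mxE !eqxx mulr1 big1 ?addr0 // => l li.
by rewrite mxE (negPf li) mulr0.
Qed.

Lemma lmul_inj Gam Gam' : (forall u, lmul Gam u = lmul Gam' u) -> Gam = Gam'.
Proof. by move=> e; apply: chr_inj => i j k; rewrite -!lmul_delta e. Qed.

Lemma chrP a Gam Gam' i j k :
  chr (a *: Gam + Gam') i j k = a * chr Gam i j k + chr Gam' i j k.
Proof. by rewrite /chr !mxE. Qed.

Lemma lmulPl a Gam Gam' u : lmul (a *: Gam + Gam') u = a *: lmul Gam u + lmul Gam' u.
Proof.
apply/matrixP => k j; rewrite !mxE mulr_sumr -big_split /=.
by apply: eq_bigr => i _; rewrite chrP; ring.
Qed.

Lemma lmulPr a Gam u v : lmul Gam (a *: u + v) = a *: lmul Gam u + lmul Gam v.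
Proof.
apply/matrixP => k j; rewrite !mxE mulr_sumr -big_split /=.
by apply: eq_bigr => i _; rewrite !mxE; ring.
Qed.

Lemma lmul0l u : lmul 0 u = 0.
Proof. by apply/matrixP => k j; rewrite !mxE big1 // => i _; rewrite /chr mxE mul0r. Qed.

Lemma lmulDl Gam Gam' u : lmul (Gam + Gam') u = lmul Gam u + lmul Gam' u.
Proof. by have := lmulPl 1 Gam Gam' u; rewrite !scale1r. Qed.

Lemma lmulNl Gam u : lmul (- Gam) u = - lmul Gam u.
Proof. by have := lmulPl (-1) Gam 0 u; rewrite lmul0l !scaleN1r !addr0. Qed.

Lemma lmulDr Gam u v : lmul Gam (u + v) = lmul Gam u + lmul Gam v.
Proof. by have := lmulPr 1 Gam u v; rewrite !scale1r. Qed.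

Lemma lmul_sum Gam u : lmul Gam u = \sum_i u i 0 *: lmul Gam (delta_mx i 0).
Proof.
apply/matrixP => k j; rewrite summxE mxE; apply: eq_bigr => i _.
by rewrite mxE lmul_delta mulrC.
Qed.

Lemma chr_actE Gam T i j k : chr (chr_act Gam T) i j k =
  \sum_b \sum_c \sum_a chr Gam a b c * T a i * T b j * invmx T k c.
Proof.
have e1 a l : (T *m delta_mx l 0 : 'cV_m) a 0 = T a l by rewrite -colE mxE.
have e2 c : (delta_mx 0 k *m invmx T : 'rV_m) 0 c = invmx T k c by rewrite -rowE mxE.
rewrite /chr_act chr_ofE /chr_eval exchange_big.
apply: eq_bigr => b _; rewrite exchange_big.
by apply: eq_bigr => c _; apply: eq_bigr => a _; rewrite !e1 e2.
Qed.

(** In other words, [T] is an isomorphism from the product of [chr_act Gam T] to that of [Gam]. *)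
Lemma lmul_chr_act Gam T u : T \in unitmx ->
  lmul (chr_act Gam T) u = invmx T *m lmul Gam (T *m u) *m T.
Proof.
move=> uT; apply/matrixP => k j.
rewrite [LHS]mxE; under eq_bigr do rewrite chr_actE mulr_suml.
rewrite [RHS]mxE exchange_big; apply: eq_bigr => b _ /=.
rewrite mxE mulr_suml; under eq_bigr do rewrite mulr_suml.
rewrite exchange_big; apply: eq_bigr => c _ /=.
under eq_bigr do rewrite mulr_suml.
rewrite exchange_big /= mxE mulr_sumr mulr_suml; apply: eq_bigr => a _.
rewrite mxE !mulr_sumr mulr_suml; apply: eq_bigr => i _; ring.
Qed.

Lemma GLplus_unit T : GLplus R m T -> T \in unitmx.
Proof. by rewrite unitmxE unitfE => /lt0r_neq0. Qed.

Lemma GLplus1 : GLplus R m 1%:M.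
Proof. by rewrite /GLplus /= det1. Qed.

Lemma GLplusM T S : GLplus R m T -> GLplus R m S -> GLplus R m (T *m S).
Proof. by rewrite /GLplus /= det_mulmx; exact: mulr_gt0. Qed.

Lemma GLplusV T : GLplus R m T -> GLplus R m (invmx T).
Proof. by rewrite /GLplus /= det_inv invr_gt0. Qed.

Lemma chr_act1 Gam : chr_act Gam 1%:M = Gam.
Proof.
apply: lmul_inj => u; rewrite lmul_chr_act ?unitmx1 // invmx1.
by rewrite !mul1mx mulmx1.
Qed.

Lemma invmxM T S : T \in unitmx -> S \in unitmx ->
  invmx (T *m S) = invmx S *m invmx T.
Proof.
move=> uT uS; apply: (can_inj (mulKmx (_ : T *m S \in unitmx))).
  by rewrite unitmx_mul uT.
rewrite mulmxV ?unitmx_mul ?uT // mulmxA -[T *m S *m _]mulmxA mulmxV // mulmx1.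
by rewrite mulmxV.
Qed.

Lemma chr_actM Gam T S : T \in unitmx -> S \in unitmx ->
  chr_act (chr_act Gam T) S = chr_act Gam (T *m S).
Proof.
move=> uT uS; apply: lmul_inj => u.
by rewrite !lmul_chr_act ?unitmx_mul ?uT // invmxM // !mulmxA.
Qed.

Lemma chr_act_linear T : T \in unitmx -> linear (chr_act ^~ T).
Proof.
move=> uT a G1 G2; apply: lmul_inj => u.
by rewrite lmulPl !lmul_chr_act // lmulPl mulmxDr mulmxDl -scalemxAr -scalemxAl.
Qed.

(** For constant symbols the curvature operator of [e_i, e_j] is the commutator of the two left
    multiplications, and the Ricci tensor is its trace in [i]. *)
Lemma ricciE Gam j k : ricci Gam j k =
  \sum_i (lmul Gam (delta_mx i 0) *m lmul Gam (delta_mx j 0) -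
          lmul Gam (delta_mx j 0) *m lmul Gam (delta_mx i 0)) i k.
Proof.
rewrite mxE; apply: eq_bigr => i _; rewrite mxE [X in _ + X]mxE !mxE -sumrB.
by apply: eq_bigr => n _; rewrite !lmul_delta.
Qed.

(** The action conjugates the commutators by [T] and mixes their indices; in the trace over [i] the
    factor [T a i] cancels against [invmx T], leaving one [T] for each free index. *)
Lemma ricci_act Gam T : T \in unitmx ->
  ricci (chr_act Gam T) = T^T *m ricci Gam *m T.
Proof.
move=> uT; apply/matrixP => j k; rewrite ricciE.
pose C a b := lmul Gam (delta_mx a 0) *m lmul Gam (delta_mx b 0) -
              lmul Gam (delta_mx b 0) *m lmul Gam (delta_mx a 0).
have Tcol i : T *m delta_mx i 0 = col i T by rewrite colE.
have comm i : lmul (chr_act Gam T) (delta_mx i 0) *m lmul (chr_act Gam T) (delta_mx j 0) -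
          lmul (chr_act Gam T) (delta_mx j 0) *m lmul (chr_act Gam T) (delta_mx i 0) =
     \sum_a \sum_b (T a i * T b j) *: (invmx T *m C a b *m T).
  rewrite !lmul_chr_act // !Tcol !mulmxA.
  rewrite -![_ *m T *m invmx T]mulmxA !mulmxV // !mulmx1.
  rewrite -mulmxBl -![invmx T *m _ *m _]mulmxA -mulmxBr.
  transitivity (invmx T *m (\sum_a \sum_b (T a i * T b j) *: C a b) *m T).
    congr (_ *m _ *m _).
    rewrite (lmul_sum Gam (col i T)) (lmul_sum Gam (col j T)).
    under [RHS]eq_bigr do under eq_bigr do rewrite scalerBr.
    under [RHS]eq_bigr do rewrite sumrB.
    rewrite sumrB; congr (_ - _).
      rewrite mulmx_suml; apply: eq_bigr => a _; rewrite mulmx_sumr.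
      by apply: eq_bigr => b _; rewrite !mxE -scalemxAl -scalemxAr scalerA.
    rewrite mulmx_sumr; apply: eq_bigr => a _; rewrite mulmx_suml.
    by apply: eq_bigr => b _; rewrite !mxE -scalemxAl -scalemxAr scalerA mulrC.
  rewrite mulmx_sumr mulmx_suml; apply: eq_bigr => a _.
  rewrite mulmx_sumr mulmx_suml; apply: eq_bigr => b _.
  by rewrite -scalemxAr -scalemxAl.
under eq_bigr do rewrite comm summxE.
rewrite exchange_big /=.
transitivity (\sum_a \sum_b T b j * (C a b *m T) a k).
  apply: eq_bigr => a _.
  under eq_bigr do rewrite summxE.
  rewrite exchange_big; apply: eq_bigr => b _ /=.
  transitivity (T b j * (\sum_i (row a T) 0 i * (invmx T *m (C a b *m T)) i k)).
    by rewrite mulr_sumr; apply: eq_bigr => i _; rewrite mxE [row a T _ _]mxE mulmxA; ring.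
  congr (_ * _).
  transitivity ((row a T *m (invmx T *m (C a b *m T))) 0 k); first by rewrite mxE.
  by move: (C a b *m T) => X; rewrite mulmxA -row_mul mulmxV // -row_mul mul1mx mxE.
rewrite exchange_big mxE /=.
transitivity (\sum_b \sum_c T b j * (ricci Gam b c * T c k)).
  apply: eq_bigr => b _; rewrite -!mulr_sumr; congr (_ * _).
  under [RHS]eq_bigr do rewrite ricciE mulr_suml.
  rewrite exchange_big; apply: eq_bigr => a _ /=.
  by rewrite mxE.
rewrite exchange_big; apply: eq_bigr => c _ /=.
by rewrite [(T^T *m _) j c]mxE mulr_suml; apply: eq_bigr => b _; rewrite [T^T j b]mxE mulrA.
Qed.

Lemma sym_ricci_act Gam T : T \in unitmx ->
  sym_ricci (chr_act Gam T) = T^T *m sym_ricci Gam *m T.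
Proof.
move=> uT; rewrite /sym_ricci ricci_act // -scalemxAr -scalemxAl; congr (_ *: _).
by rewrite !trmx_mul trmxK mulmxDr mulmxDl !mulmxA.
Qed.

Lemma sym_ricci_sym Gam : (sym_ricci Gam)^T = sym_ricci Gam.
Proof. by rewrite /sym_ricci linearZ /= linearD /= trmxK addrC. Qed.

Lemma torsion_freeP Gam :
  torsion_free Gam <-> forall u v, lmul Gam u *m v = lmul Gam v *m u.
Proof.
split=> [tf u v|H i j k].
  apply/matrixP => k l; rewrite ord1 !mxE.
  under eq_bigr do rewrite mxE mulr_suml; rewrite exchange_big.
  apply: eq_bigr => i _; rewrite mxE mulr_suml; apply: eq_bigr => j _.
  by rewrite tf; ring.
have := H (delta_mx i 0) (delta_mx j 0); move/matrixP/(_ k 0).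
by rewrite -!colE !mxE -!lmul_delta !mxE.
Qed.

Lemma torsion_free_act Gam T : T \in unitmx ->
  torsion_free Gam -> torsion_free (chr_act Gam T).
Proof.
move=> uT /torsion_freeP tf; apply/torsion_freeP => u v.
by rewrite !lmul_chr_act // -!mulmxA; congr (_ *m _); rewrite tf.
Qed.

(* The derivative of [T |-> chr_act Gam T] at the identity. *)
Definition chr_deriv Gam A : W :=
  chr_of (fun i j k => (lmul Gam (col i A) + lmul Gam (delta_mx i 0) *m A -
                        A *m lmul Gam (delta_mx i 0)) k j).

(** Applied to [v], the right side is [(A u) v + u (A v) - A (u v)]: the kernel of [chr_deriv Gam]
    consists of the derivations of the product. *)
Lemma lmul_chr_deriv Gam A u : lmul (chr_deriv Gam A) u =
  lmul Gam (A *m u) + lmul Gam u *m A - A *m lmul Gam u.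
Proof.
rewrite lmul_sum.
have -> : \sum_i u i 0 *: lmul (chr_deriv Gam A) (delta_mx i 0) =
  \sum_i u i 0 *: (lmul Gam (col i A) + lmul Gam (delta_mx i 0) *m A -
                        A *m lmul Gam (delta_mx i 0)).
  apply: eq_bigr => i _; congr (_ *: _); apply/matrixP => k j.
  by rewrite lmul_delta chr_ofE.
under eq_bigr do rewrite scalerBr scalerDr.
rewrite sumrB big_split /= [in RHS](lmul_sum Gam u); congr (_ + _ - _).
- rewrite (lmul_sum Gam (A *m u)).
  under eq_bigr do rewrite lmul_sum scaler_sumr.
  rewrite exchange_big; apply: eq_bigr => a _ /=.
  rewrite mxE scaler_suml; apply: eq_bigr => i _.
  by rewrite scalerA mxE mulrC.
- by rewrite mulmx_suml; apply: eq_bigr => i _; rewrite scalemxAl.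
- by rewrite mulmx_sumr; apply: eq_bigr => i _; rewrite scalemxAr.
Qed.

Lemma chr_deriv_linear Gam : linear (chr_deriv Gam).
Proof.
move=> a A B; apply: lmul_inj => u; rewrite lmulPl !lmul_chr_deriv.
rewrite mulmxDl -scalemxAl lmulPr mulmxDr -scalemxAr mulmxDl -scalemxAl.
by apply/matrixP => i j; rewrite !mxE; ring.
Qed.

Lemma torsion_free_deriv Gam A : torsion_free Gam -> torsion_free (chr_deriv Gam A).
Proof.
move=> /torsion_freeP tf; apply/torsion_freeP => u v.
rewrite !lmul_chr_deriv !mulmxDl !mulNmx -!mulmxA (tf u v) (tf (A *m u) v) (tf (A *m v) u).
by congr (_ - _); rewrite addrC.
Qed.

End Multiplication.

Section SmoothAction.
Context {R : realType} {m : nat}.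
Local Notation W := 'M[R]_((m * m)%N, m).

Lemma Ck_chr_act (V : normedModType R) n (U : set V) (X : V -> W) (T : V -> 'M[R]_m) :
  open U -> (forall x, U x -> T x \in unitmx) ->
  Ck_mx n U X -> Ck_mx n U T -> Ck_mx n U (fun x => chr_act (X x) (T x)).
Proof.
move=> oU uT cX cT p k; case/mxvec_indexP: p => i j.
have cN : Ck_mx n U (fun x => invmx (T x)) by exact: Ck_mx_inv.
rewrite [X in Ck _ _ X](_ : _ = fun x =>
  \sum_b \sum_c \sum_a chr (X x) a b c * T x a i * T x b j * invmx (T x) k c).
  apply: Ck_sum => b _; apply: Ck_sum => c _; apply: Ck_sum => a _.
  by apply: Ck_mul => //; apply: Ck_mul => //; apply: Ck_mul => //; exact: cX.
by apply/funext => x; rewrite -chr_actE.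
Qed.

Lemma Ck_sym_ricci n (U : set W) : Ck_mx n U sym_ricci.
Proof.
have chrC i j k : Ck n U (fun G => chr G i j k) by exact: Ck_mx_id.
have ricC : Ck_mx n U ricci.
  move=> j k; rewrite [X in Ck _ _ X](_ : _ = fun G => \sum_i \sum_n
    (chr G i n i * chr G j k n + - (chr G j n i * chr G i k n))).
    apply: Ck_sum => i _; apply: Ck_sum => l _; apply: Ck_add; first exact: Ck_mul.
    by apply: Ck_opp; exact: Ck_mul.
  by apply/funext => G; rewrite mxE.
apply: (@Ck_mx_lin _ _ _ _ _ _ _ _ ( *:%R 2^-1) (fun G => ricci G + (ricci G)^T)).
  by move=> k A B; rewrite scalerDr !scalerA mulrC.
by apply: Ck_mx_add => //; exact: Ck_mx_tr.
Qed.

End SmoothAction.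

(** * Properness *)

Section Sequences.
Context {R : realType}.

Lemma cvg_seq_mxP a b (u : nat -> 'M[R]_(a, b)) (h : 'M[R]_(a, b)) :
  u @ \oo --> h <-> forall e, 0 < e ->
    exists N, forall n, (N <= n)%N -> `|u n - h| < e.
Proof.
split=> [/cvgrPdist_lt uh e e0|H].
  by have [N _ NP] := uh e e0; exists N => n /NP /=; rewrite distrC.
apply/cvgrPdist_lt => e e0; have [N NP] := H e e0.
by exists N => // n /NP /=; rewrite distrC.
Qed.

Lemma cvg_mx {T : Type} (F : set_system T) {FF : Filter F} a b
    (f : T -> 'M[R]_(a, b)) (h : 'M[R]_(a, b)) :
  (forall i j, (fun x => f x i j) @ F --> h i j) -> f @ F --> h.
Proof.
move=> fc; apply/cvg_mx_entourageP => A entA.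
apply: (@filter_forall _ _ (fun i x => forall j, (h i j, f x i j) \in A) F _) => i.
apply: (@filter_forall _ _ (fun j x => (h i j, f x i j) \in A) F _) => j.
have /cvg_app_entourageP /(_ A entA) := fc i j.
by apply: filterS => y Ay; exact: mem_set.
Qed.

Lemma cvg_entry {T : Type} (F : set_system T) {FF : Filter F} a b
    (f : T -> 'M[R]_(a, b)) (h : 'M[R]_(a, b)) i j :
  f @ F --> h -> (fun x => f x i j) @ F --> h i j.
Proof.
move=> fh; apply: (@continuous_cvg _ _ _ F _ f (fun M : 'M[R]_(a, b) => M i j)) => //.
exact: coord_continuous.
Qed.

Lemma cvg_sumr {T I : Type} (F : set_system T) {FF : Filter F} (r : seq I)
    (f : I -> T -> R) (h : I -> R) :
  (forall i, f i @ F --> h i) ->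
  (fun x => \sum_(i <- r) f i x) @ F --> \sum_(i <- r) h i.
Proof.
move=> fh; elim: r => [|i r IH].
  rewrite big_nil [X in X @ _ --> _](_ : _ = fun=> 0); first exact: cvg_cst.
  by apply/funext => x; rewrite big_nil.
rewrite big_cons [X in X @ _ --> _](_ : _ = fun x => f i x + \sum_(i <- r) f i x).
  exact: cvgD.
by apply/funext => x; rewrite big_cons.
Qed.

Lemma cvg_mulmx {T : Type} (F : set_system T) {FF : Filter F} a b c
    (f : T -> 'M[R]_(a, b)) (g : T -> 'M[R]_(b, c)) (A : 'M[R]_(a, b)) (B : 'M[R]_(b, c)) :
  f @ F --> A -> g @ F --> B -> (fun x => f x *m g x) @ F --> A *m B.
Proof.
move=> fA gB; apply: cvg_mx => i j; rewrite mxE.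
rewrite [X in X @ _ --> _](_ : _ = fun x => \sum_k f x i k * g x k j).
  by apply: cvg_sumr => k; apply: cvgM; exact: cvg_entry.
by apply/funext => x; rewrite mxE.
Qed.

Lemma leq_homo_ltn (s : nat -> nat) : {homo s : i j / (i < j)%N} -> forall n, (n <= s n)%N.
Proof. by move=> hs; elim=> // n IH; apply: leq_ltn_trans IH (hs _ _ _). Qed.

Lemma cvg_subsequence {T : topologicalType} (u : nat -> T) (s : nat -> nat) (l : T) :
  {homo s : i j / (i < j)%N} -> u @ \oo --> l -> (u \o s) @ \oo --> l.
Proof.
move=> hs ul; apply: cvg_trans ul => A [N _ NA]; exists N => // n /= Nn.
by apply: NA => /=; apply: leq_trans Nn _; exact: leq_homo_ltn.
Qed.

Lemma bolzano_weierstrass_mx a b (u : nat -> 'M[R]_(a, b)) C :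
  (forall n, `|u n| <= C) ->
  exists (s : nat -> nat) (h : 'M[R]_(a, b)), {homo s : i j / (i < j)%N} /\ (u \o s) @ \oo --> h.
Proof.
move=> uC.
(* Successive extraction, one matrix entry at a time. *)
have H (l : seq ('I_a * 'I_b)) : exists s, {homo s : i j / (i < j)%N} /\
    forall p, p \in l -> cvgn (fun n => u (s n) p.1 p.2).
  elim: l => [|p l [s [hs cs]]]; first by exists id; split.
  have bs : bounded_fun (fun n => u (s n) p.1 p.2).
    exists C; split; first exact: num_real.
    move=> M CM n _; apply: le_trans (ltW CM); apply: le_trans (uC (s n)).
    exact: ler_entry_norm.
  have [f fi fc] := bolzano_weierstrass bs.
  have hf : {homo f : i j / (i < j)%N} by move=> i j; rewrite !ltnNge -!leEnat fi.
  exists (s \o f); split; first by move=> i j /hf /hs.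
  move=> q; rewrite inE => /orP[/eqP->//|/cs /cvg_ex [c qc]].
  by apply/cvg_ex; exists c; exact: (cvg_subsequence hf qc).
have [s [hs cs]] := H (enum {: 'I_a * 'I_b}).
exists s, (\matrix_(i, j) lim ((fun n => u (s n) i j) @ \oo)); split=> //.
apply: cvg_mx => i j; rewrite mxE.
by have := cs (i, j); rewrite mem_enum => /(_ isT).
Qed.

Lemma cvg_inv_seq a b (u : nat -> 'M[R]_(a, b)) (x : 'M[R]_(a, b)) :
  (forall n, `|u n - x| < n.+1%:R^-1) -> u @ \oo --> x.
Proof.
move=> ux; apply/cvg_seq_mxP => e e0.
have [N _ NP] := near_infty_natSinv_lt (PosNum e0).
by exists N => n /NP /=; apply: lt_trans; exact: ux.
Qed.

End Sequences.

Section OpenGroups.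
Context {R : realType}.

Lemma open_unitmx k : open [set A : 'M[R]_k | A \in unitmx].
Proof.
rewrite (_ : mkset _ = (fun A : 'M[R]_k => \det A) @^-1` [set x | x != 0]); last first.
  by apply/seteqP; split=> A /=; rewrite unitmxE unitfE.
apply: open_comp; last exact: open_neq.
move=> A _; apply: (@Ck_continuous _ _ 0 setT) => //.
by apply: Ck_det; exact: Ck_mx_id.
Qed.

Lemma open_GLplus m : open (GLplus R m).
Proof.
apply: (@open_comp _ _ (fun A : 'M[R]_m => \det A) [set x | 0 < x]); last exact: open_gt.
move=> A _; apply: (@Ck_continuous _ _ 0 setT) => //.
by apply: Ck_det; exact: Ck_mx_id.
Qed.

End OpenGroups.

(** * Arrays with definite symmetric Ricci tensor *)

Section Definite.
Context {R : realType} {m : nat}.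
Local Notation W := 'M[R]_((m * m)%N, m).
Variable eps : R.
Hypothesis eps2 : eps * eps = 1.

(** With [eps = 1] or [-1] this is the normal form of a definite signature, so one argument covers
    both signs. *)
Definition definite : set W := [set Gam |
  exists2 S : 'M[R]_m, S \in unitmx & S^T *m sym_ricci Gam *m S = eps%:M].

Lemma definite_act Gam T : T \in unitmx -> definite Gam -> definite (chr_act Gam T).
Proof.
move=> uT [S uS SG]; exists (invmx T *m S); first by rewrite unitmx_mul unitmx_inv uT.
rewrite sym_ricci_act // trmx_mul -!mulmxA mulKVmx // -SG.
by rewrite (mulmxA (invmx T)^T) -trmx_mul mulmxV // trmx1 mul1mx mulmxA.
Qed.

(** With [h = invmx S *m g] one has [g^T A g = eps h^T h], and the diagonal of [h^T h] dominates the
    squares of the entries of [h]. A nearby [A'] costs a multiple of [|g|^2] that is absorbed on the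
    left. *)
Lemma definite_bound (A S : 'M[R]_m) : S \in unitmx -> S^T *m A *m S = eps%:M ->
  exists d K, [/\ 0 < d, 0 <= K &
   forall (A' g : 'M[R]_m), `|A' - A| < d -> `|g| ^+ 2 <= K * `|g^T *m A' *m g|].
Proof.
move=> uS SA; pose M : R := m%:R.
have M0 : 0 <= M by [].
have AE : A = (invmx S)^T *m eps%:M *m invmx S.
  rewrite -SA !mulmxA -trmx_mul mulmxV // trmx1 mul1mx.
  by rewrite -mulmxA mulmxV // mulmx1.
pose K0 := (M * `|S|) ^+ 2.
have K00 : 0 <= K0 by exact: sqr_ge0.
have sqA (g : 'M[R]_m) : `|g| ^+ 2 <= K0 * `|g^T *m A *m g|.
  pose h := invmx S *m g.
  have gh : g = S *m h by rewrite mulKVmx.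
  have gAg : g^T *m A *m g = eps *: (h^T *m h).
    rewrite AE !mulmxA -trmx_mul -/h -!mulmxA -/h.
    by rewrite mul_scalar_mx -scalemxAr.
  have abse : `|eps| = 1.
    by apply/eqP; rewrite -sqrp_eq1 // -normrX expr2 eps2 normr1.
  have hh : `|h| ^+ 2 <= `|h^T *m h|.
    have sqh i j : `|h i j| ^+ 2 <= `|h^T *m h|.
      apply: le_trans (ler_entry_norm _ j j); rewrite [(h^T *m h) j j]mxE.
      have ge0 k : 0 <= h^T j k * h k j by rewrite mxE -expr2 sqr_ge0.
      rewrite [leRHS]ger0_norm ?sumr_ge0 // (bigD1 i) //= [h^T j i]mxE -expr2.
      by rewrite real_normK ?num_real // lerDl sumr_ge0.
    rewrite -[leRHS]sqr_sqrtr // lerXn2r ?nnegrE ?sqrtr_ge0 //.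
    apply: mx_norm_le; first exact: sqrtr_ge0.
    by move=> i j; rewrite -[leLHS]sqrtr_sqr ler_wsqrtr // -real_normK ?num_real // sqh.
  rewrite gAg normrZ abse mul1r; apply: le_trans (_ : K0 * `|h| ^+ 2 <= _); last first.
    exact: ler_wpM2l.
  rewrite /K0 -exprMn lerXn2r ?nnegrE ?mulr_ge0 //.
  by rewrite {1}gh; exact: norm_mulmx.
(* For [|A' - A| < D^-1] the perturbation term is at most [|g|^2 / 2], whence the factor 2 in
   [2 * K0]. *)
pose D := 2 * (K0 * M ^+ 2 + 1).
have D0 : 0 < D by rewrite mulr_gt0 // ltr_wpDl // mulr_ge0 // sqr_ge0.
exists D^-1, (2 * K0); split; [by rewrite invr_gt0|by rewrite mulr_ge0|].
move=> A' g dA; have := sqA g.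
have gE : g^T *m A *m g = g^T *m A' *m g - g^T *m (A' - A) *m g.
  by rewrite mulmxBr mulmxBl opprB addrC subrK.
have n1 : `|g^T *m A *m g| <= `|g^T *m A' *m g| + M ^+ 2 * `|g| ^+ 2 * `|A' - A|.
  rewrite gE; apply: le_trans (ler_normB _ _) _; rewrite lerD2l.
  apply: le_trans (norm_mulmx _ _) _.
  apply: (@le_trans _ _ (M * (M * `|g^T| * `|A' - A|) * `|g|)).
    by rewrite ler_wpM2r // ler_wpM2l // norm_mulmx.
  by rewrite norm_trmx le_eqVlt; apply/orP; left; apply/eqP; ring.
have n2 : K0 * (M ^+ 2 * `|g| ^+ 2 * `|A' - A|) <= `|g| ^+ 2 / 2.
  apply: (@le_trans _ _ (K0 * M ^+ 2 * `|g| ^+ 2 * D^-1)).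
    by rewrite !mulrA ler_wpM2l ?(ltW dA) // !mulr_ge0 // sqr_ge0.
  rewrite ler_pdivrMr // /D.
  have := sqr_ge0 `|g|; have : 0 <= K0 * M ^+ 2 by rewrite mulr_ge0 // sqr_ge0.
  set p := K0 * M ^+ 2; set q := `|g| ^+ 2; nra.
move=> n0; have {n0} := le_trans n0 (ler_wpM2l K00 n1).
rewrite mulrDr; move: n2; set p := K0 * (_ * _ * _); set q := `|g| ^+ 2.
by set t := `|g^T *m A' *m g| => *; rewrite -mulrA; lra.
Qed.

Lemma sym_ricci_cvg (x : nat -> W) (a : W) : x @ \oo --> a ->
  (sym_ricci \o x) @ \oo --> sym_ricci a.
Proof.
move=> xa; apply: (continuous_cvg _ (h := sym_ricci)); last exact: xa.
by apply: (@Ck_mx_continuous _ _ 0 setT) => //; exact: Ck_sym_ricci.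
Qed.

Lemma sym_ricci_det Gam : definite Gam -> \det (sym_ricci Gam) != 0.
Proof.
case=> S uS /(congr1 determinant); rewrite !det_mulmx det_tr det_scalar => e.
have eps0 : eps != 0.
  by apply: contra_eq_neq eps2 => ->; rewrite mul0r eq_sym oner_eq0.
apply: contra_eq_neq e => ->; rewrite mulr0 mul0r eq_sym; exact: expf_neq0.
Qed.

Lemma right_action_definite : right_action (GLplus R m) definite chr_act.
Proof.
split=> [x g Px /GLplus_unit gu|x _|x g h _ /GLplus_unit gu /GLplus_unit hu].
- exact: definite_act.
- exact: chr_act1.
- exact: chr_actM.
Qed.

Theorem proper_definite : proper_action (GLplus R m) definite chr_act.
Proof.
split; first exact: right_action_definite.
move=> x g a b Px Gg Pa Pb xa xgb.
have ra := sym_ricci_cvg xa; have rb := sym_ricci_cvg xgb.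
have gu k : g k \in unitmx by exact: GLplus_unit.
have rE : sym_ricci \o (fun k => chr_act (x k) (g k)) =
    fun k => (g k)^T *m sym_ricci (x k) *m g k.
  by apply/funext => k /=; rewrite sym_ricci_act.
rewrite rE in rb.
have [S uS SA] := Pa.
have [d [K [d0 K0 dK]]] := definite_bound uS SA.
have [N1 N1P] := (cvg_seq_mxP _ _).1 ra d d0.
have [N2 N2P] := (cvg_seq_mxP _ _).1 rb 1 ltr01.
pose N := maxn N1 N2.
(* The last 1 turns a bound on [|g|^2] into one on [|g|]: either [|g| <= 1] or [|g| <= |g|^2]. *)
pose C := K * (`|sym_ricci b| + 1) + 1.
have gC k : `|g (N + k)%N| <= C.
  have := dK _ (g (N + k)%N) (N1P (N + k)%N _).
  rewrite (leq_trans (leq_maxl N1 N2)) ?leq_addr // => /(_ isT) /= gk.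
  have := N2P (N + k)%N; rewrite (leq_trans (leq_maxr N1 N2)) ?leq_addr // => /(_ isT).
  move: gk; set r := (_ *m _ *m _) => gk rk.
  have rle : `|r| <= `|sym_ricci b| + 1.
    rewrite -[r](subrK (sym_ricci b)) addrC; apply: le_trans (ler_normD _ _) _.
    by rewrite lerD2l ltW.
  have {rle} := ler_wpM2l K0 rle; move: gk (normr_ge0 (g (N + k)%N)); rewrite /C.
  set p := `|g _|; set q := K * `|r|; set t := K * (_ + _) => gk p0 qt.
  have : p ^+ 2 <= t by apply: le_trans qt.
  by have [|] := lerP p 1; nra.
have [s [h [hs sh]]] := bolzano_weierstrass_mx gC.
exists (fun n => N + s n)%N, h.
have hs' : {homo (fun n => N + s n)%N : i j / (i < j)%N} by move=> i j /hs; rewrite ltn_add2l.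
have sh' : (fun n => g (N + s n)%N) @ \oo --> h := sh.
split=> //.
rewrite /GLplus /=.
have ra' := cvg_subsequence hs' ra; have rb' := cvg_subsequence hs' rb.
have lim_r : (fun n => (g (N + s n)%N)^T *m sym_ricci (x (N + s n)%N) *m g (N + s n)%N) @ \oo
   --> h^T *m sym_ricci a *m h.
  apply: cvg_mulmx; last exact: sh'.
  apply: cvg_mulmx; last exact: ra'.
  apply: cvg_mx => i j; rewrite mxE.
  rewrite [X in X @ _ --> _](_ : _ = fun n => g (N + s n)%N j i).
    exact: (cvg_entry (i := j) (j := i) sh).
  by apply/funext => n; rewrite mxE.
have e : h^T *m sym_ricci a *m h = sym_ricci b.
  exact: (cvg_unique _ lim_r rb').
(* The limit has nonnegative determinant; it stays in [GLplus] because the Ricci tensor of [b] is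
   nondegenerate. *)
have deth : \det h != 0.
  apply: contraNneq (sym_ricci_det Pb) => h0.
  by rewrite -e !det_mulmx h0 mulr0.
rewrite lt_def deth /=.
have detc : (fun n => \det (g (N + s n)%N)) @ \oo --> \det h.
  apply: (continuous_cvg _ (h := fun A : 'M[R]_m => \det A)); last exact: sh.
  by apply: (@Ck_continuous _ _ 0 setT) => //; apply: Ck_det; exact: Ck_mx_id.
have <- : lim ((fun n => \det (g (N + s n)%N)) @ \oo) = \det h by exact: cvg_lim.
apply: limr_ge; first by apply/cvg_ex; exists (\det h).
by apply: nearW => n; apply: ltW; exact: Gg.
Qed.

Lemma chr_act_cvg (x : nat -> W) (g : nat -> 'M[R]_m) (a : W) (h : 'M[R]_m) :
  h \in unitmx -> x @ \oo --> a -> g @ \oo --> h ->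
  (fun n => chr_act (x n) (g n)) @ \oo --> chr_act a h.
Proof.
move=> uh xa gh.
pose U := [set z : (W * 'M[R]_m)%type | z.2 \in unitmx].
have oU : open U.
  apply: (@open_comp _ _ (@snd W 'M[R]_m) [set A | A \in unitmx]); last exact: open_unitmx.
  by move=> z _; exact: cvg_snd.
have cU : Ck_mx 0 U (fun z => chr_act z.1 z.2).
  by apply: Ck_chr_act => //; [exact: Ck_mx_fst|exact: Ck_mx_snd].
apply: (continuous_cvg _ (h := fun z : (W * 'M[R]_m)%type => chr_act z.1 z.2)
  (f := fun n => (x n, g n)) (a := (a, h))); last exact: (cvg_pair xa gh).
exact: (Ck_mx_continuous cU).
Qed.

(* Compactness form of properness: [chr_act x g] can be close to [b] with [x]
   close to [a] only for [g] close to some element carrying [a] to [b]. *)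
Lemma proper_near (a b : W) (O : set 'M[R]_m) : definite a -> definite b ->
  open O -> (forall g, GLplus R m g -> chr_act a g = b -> O g) ->
  exists2 d, 0 < d & forall x g, definite x -> GLplus R m g ->
    `|x - a| < d -> `|chr_act x g - b| < d -> O g.
Proof.
move=> Pa Pb oO Oab; apply: contrapT => nH.
have H n : exists z : W * 'M[R]_m, [/\ definite z.1, GLplus R m z.2,
    `|z.1 - a| < n.+1%:R^-1, `|chr_act z.1 z.2 - b| < n.+1%:R^-1 & ~ O z.2].
  apply: contrapT => nz; apply: nH; exists n.+1%:R^-1; first by rewrite invr_gt0.
  move=> x g Px Gg xa xgb; apply: contrapT => nO; apply: nz.
  by exists (x, g).
pose z n := sval (cid (H n)).
have zP n := svalP (cid (H n)); rewrite -/(z _) in zP.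
have xa : (fun n => (z n).1) @ \oo --> a.
  by apply: cvg_inv_seq => n; have [] := zP n.
have xgb : (fun n => chr_act (z n).1 (z n).2) @ \oo --> b.
  by apply: cvg_inv_seq => n; have [] := zP n.
have [_ /(_ (fun n => (z n).1) (fun n => (z n).2) a b)] := proper_definite.
move=> /(_ _ _ Pa Pb xa xgb) [||s [h [hs Gh sh]]].
- by move=> n; have [] := zP n.
- by move=> n; have [] := zP n.
have xa' := cvg_subsequence hs xa; have xgb' := cvg_subsequence hs xgb.
have e : chr_act a h = b.
  exact: (cvg_unique _ (chr_act_cvg (GLplus_unit Gh) xa' sh) xgb').
have [r r0 rP] := (open_mxP O).1 oO h (Oab _ Gh e).
have [N NP] := (cvg_seq_mxP _ _).1 sh r r0.
have := rP _ (NP N (leqnn _)).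
by have [_ _ _ _] := zP (s N).
Qed.

(** Near [a], in the basis [S], the form is [eps] times [1 + f x] with [f x] small and symmetric. A
    symmetric square root [X] of [1 + f x] makes [S *m invmx X] a normalizing basis. *)
Lemma open_definite : open definite.
Proof.
apply/open_mxP => a [S uS SA].
pose U := [set H : 'M[R]_m | 1%:M + 2^-1 *: H \in unitmx].
(* The square root is sought as [1 + H / 2], so that [F] has the identity as derivative at 0. *)
pose F (H : 'M[R]_m) := H + 4^-1 *: (H *m H).
have sqF H : 1%:M + F H = (1%:M + 2^-1 *: H) *m (1%:M + 2^-1 *: H).
  rewrite mulmxDl !mulmxDr !mulmx1 mul1mx -scalemxAl -scalemxAr scalerA /F.
  have -> : 2^-1 * 2^-1 = 4^-1 :> R by field.
  rewrite -!addrA; congr (_ + _); rewrite addrA; congr (_ + _).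
  by rewrite -scalerDl -[LHS]scale1r; congr (_ *: _); field.
have oU : open U.
  apply: (@open_comp _ _ (fun H : 'M[R]_m => 1%:M + 2^-1 *: H) [set A | A \in unitmx]).
    2: exact: open_unitmx.
  move=> H _; apply: (@Ck_mx_continuous _ _ 0 setT) => //.
  apply: Ck_mx_add; first exact: Ck_mx_cst.
  apply: (@Ck_mx_lin _ _ _ _ _ _ _ _ ( *:%R 2^-1) id); last exact: Ck_mx_id.
  by move=> k A B; rewrite scalerDr !scalerA mulrC.
have sF : smooth_mx U F.
  move=> n; apply: Ck_mx_add; first exact: Ck_mx_id.
  apply: (@Ck_mx_lin _ _ _ _ _ _ _ _ ( *:%R 4^-1) (fun H => H *m H)).
    by move=> k A B; rewrite scalerDr !scalerA mulrC.
  by apply: Ck_mx_mul; exact: Ck_mx_id.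
have F0 : F 0 = 0 by rewrite /F mul0mx scaler0 addr0.
have dF v : 'd F 0 v = v.
  suff [_ ->] : is_diff (0 : 'M[R]_m) F idfun by [].
  apply/(@is_diffP _ _ _ F idfun) => [x|e e0]; first exact: cvg_id.
  have m1 : 0 < m%:R + 1 :> R by rewrite ltr_wpDl.
  apply/nbhs_mxP; exists (e / (m%:R + 1)); first exact: divr_gt0.
  move=> h; rewrite subr0 ltr_pdivlMr // => he; rewrite addr0 F0 subr0 /F addrC addKr.
  rewrite normrZ ger0_norm ?invr_ge0 //; have := norm_mulmx h h.
  have := normr_ge0 h; move: he; move: (ler0n R m); set k : R := m%:R; set t := `|h|.
  by set z := `|_ *m _| => *; nra.
have U0 : U 0 by rewrite /U /= scaler0 addr0 unitmx1.
have [V0 [V [G [[oV0 V00 V0U oV] [FK GK sG]]]]] := inverse_function oU U0 sF dF.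
have [r r0 rP] := (open_mxP _).1 oV0 _ V00.
have [V_0 G0] := FK 0 V00; rewrite F0 in V_0 G0.
have Gc : {for 0, continuous G} by exact: (Ck_mx_continuous (sG 0)).
have [r1 r10 r1P] := (continuous_mxP _ _).1 Gc r r0.
have [r2 r20 r2P] := (open_mxP _).1 oV _ V_0.
pose f (x : W) := eps *: (S^T *m sym_ricci x *m S) - 1%:M.
have fc : {for a, continuous f}.
  apply: (@Ck_mx_continuous _ _ 0 setT) => //.
  apply: Ck_mx_sub; last exact: Ck_mx_cst.
  apply: (@Ck_mx_lin _ _ _ _ _ _ _ _ ( *:%R eps) (fun x => S^T *m sym_ricci x *m S)).
    by move=> k A B; rewrite scalerDr !scalerA mulrC.
  apply: Ck_mx_mul; last exact: Ck_mx_cst.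
  by apply: Ck_mx_mul; [exact: Ck_mx_cst|exact: Ck_sym_ricci].
have fa : f a = 0 by rewrite /f SA scale_scalar_mx eps2 subrr.
have [d d0 dP] := (continuous_mxP _ _).1 fc (Num.min r1 r2) ltac:(by rewrite lt_min r10).
exists d => // x /dP; rewrite fa subr0 lt_min => /andP[fr1 fr2].
pose H := G (f x).
have Vf : V (f x) by apply: r2P; rewrite subr0.
have [V0H FH] := GK _ Vf.
have Hr : `|H| < r by have := r1P (f x); rewrite !subr0 G0 subr0; apply.
(* [F] commutes with transposition and is injective on [V0], which contains a ball around 0 that is
   stable under transposition and contains [H]. *)
have HT : H^T = H.
  have V0T : V0 H^T by apply: rP; rewrite subr0 norm_trmx.
  rewrite -[LHS](FK _ V0T).2 -[RHS](FK _ V0H).2; congr G.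
  have -> : F H^T = (F H)^T by rewrite /F linearD linearZ /= trmx_mul.
  rewrite FH /f linearB linearZ /= trmx1; congr (_ *: _ - _).
  by rewrite !trmx_mul trmxK sym_ricci_sym mulmxA.
pose X := 1%:M + 2^-1 *: H.
have uX : X \in unitmx by exact: V0U.
have XT : X^T = X by rewrite /X linearD linearZ /= trmx1 HT.
have XX : S^T *m sym_ricci x *m S = eps *: (X^T *m X).
  rewrite XT -sqF FH /f addrC subrK scalerA eps2 scale1r //.
exists (S *m invmx X); first by rewrite unitmx_mul unitmx_inv uS.
rewrite trmx_mul.
transitivity ((invmx X)^T *m (S^T *m sym_ricci x *m S) *m invmx X).
  by rewrite !mulmxA.
rewrite XX -scalemxAr -scalemxAl !mulmxA -trmx_mul mulmxV // trmx1 mul1mx.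
by rewrite mulmxV // scalemx1.
Qed.

End Definite.

(** * Trivial stabilizers: openness and infinitesimal freeness *)

Section Powers.
Context {R : realType} {m : nat}.
Implicit Types (T A : 'M[R]_m).

Fixpoint mxpow T n : 'M[R]_m := if n is n'.+1 then mxpow T n' *m T else 1%:M.

Lemma mxpowSl T n : mxpow T n.+1 = T *m mxpow T n.
Proof.
elim: n => [|n IH] /=; first by rewrite mul1mx mulmx1.
by rewrite mulmxA -IH.
Qed.

Lemma GLplus_mxpow T n : GLplus R m T -> GLplus R m (mxpow T n).
Proof. by move=> GT; elim: n => [|n IH]; [exact: GLplus1|exact: GLplusM]. Qed.

(** Since [|A *m B| <= m |A| |B|], a power this close to 1 makes the correction [(T^n - 1)(T - 1)]
    at most [|T - 1| / 2]; [m + 1] avoids a zero denominator. *)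
Definition escape_radius : R := (2 * (m%:R + 1))^-1.

Lemma escape_radius_gt0 : 0 < escape_radius.
Proof. by rewrite invr_gt0 mulr_gt0 // ltr_wpDl. Qed.

(* [T^(n+1) - 1 = (T^n - 1) + (T - 1) + (T^n - 1)(T - 1)]: as long as the powers
   stay close to the identity, they move away from it at linear speed. *)
Lemma mxpow_escape T n : (forall j, (j < n)%N -> `|mxpow T j - 1%:M| <= escape_radius) ->
  n%:R / 2 * `|T - 1%:M| <= `|mxpow T n - 1%:M|.
Proof.
move=> H; pose D n := mxpow T n - 1%:M - n%:R *: (T - 1%:M).
have DS k : D k.+1 = D k + (mxpow T k - 1%:M) *m (T - 1%:M).
  rewrite /D /= mulmxBl mul1mx mulmxBr mulmx1 -natr1 scalerDl scale1r.
  by apply/matrixP => i j; rewrite !mxE; ring.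
have Dn k : (k <= n)%N -> `|D k| <= k%:R / 2 * `|T - 1%:M|.
  elim: k => [|k IH] kn; first by rewrite /D /= subrr scale0r subrr normr0 !mul0r.
  rewrite DS; apply: le_trans (ler_normD _ _) _.
  rewrite -natr1 !mulrDl lerD //; first exact/IH/ltnW.
  apply: le_trans (norm_mulmx _ _) _; rewrite ler_wpM2r //.
  apply: le_trans (ler_wpM2l _ (H k kn)) _ => //.
  rewrite /escape_radius ler_pdivrMr ?mulr_gt0 ?ltr_wpDl //.
  by rewrite mulrA divfK // mul1r; rewrite lerDl.
have := Dn n (leqnn n); rewrite /D.
set p := mxpow T n - 1%:M; set q := T - 1%:M => le1.
have := lerB_dist (n%:R *: q) p; rewrite (distrC (_ *: _)) normrZ ger0_norm //; lra.
Qed.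

Lemma mxpow_bounded T : (forall j, `|mxpow T j - 1%:M| <= escape_radius) -> T = 1%:M.
Proof.
move=> H; apply/eqP; rewrite -subr_eq0 -normr_eq0; apply: contraT => n0.
have t0 : 0 < `|T - 1%:M| by rewrite lt_def n0 normr_ge0.
pose n := (Num.truncn (2 * escape_radius / `|T - 1%:M|)).+1.
have := @mxpow_escape T n (fun j _ => H j); move: (H n) => Hn Hn'.
have := truncnS_gt (2 * escape_radius / `|T - 1%:M|); rewrite -/n ltr_pdivrMr //.
have := le_trans Hn' Hn; set t := `|_|; set k : R := n%:R; lra.
Qed.

Lemma near_one : exists2 d, 0 < d & forall T, `|T - 1%:M| < d ->
  [/\ GLplus R m T, `|T| <= 2, `|invmx T| <= 2 & `|T - 1%:M| <= escape_radius].
Proof.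
have n1 : `|1%:M : 'M[R]_m| <= 1.
  apply: mx_norm_le => // i j; rewrite mxE; case: (i == j); first by rewrite normr1.
  by rewrite normr0.
have [d1 d10 d1P] := (open_mxP _).1 (@open_GLplus R m) _ GLplus1.
have cinv : {for (1%:M : 'M[R]_m), continuous (@invmx R m)}.
  apply: (@Ck_mx_continuous _ _ 0 [set A : 'M[R]_m | A \in unitmx]); last exact: unitmx1.
  by apply: Ck_mx_inv => //; [exact: open_unitmx|exact: Ck_mx_id].
have [d2 d20 d2P] := (continuous_mxP _ _).1 cinv 1 ltr01.
exists (Num.min (Num.min d1 d2) (Num.min 1 escape_radius)).
  by rewrite !lt_min d10 d20 ltr01 escape_radius_gt0.
move=> T; rewrite !lt_min => /andP[/andP[Td1 Td2] /andP[T1 Te]]; split.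
- exact: d1P.
- rewrite -[T](subrK 1%:M); apply: le_trans (ler_normD _ _) _.
  by move: T1; set t := `|T - _|; lra.
- have := d2P _ Td2; rewrite invmx1 => ?; rewrite -[invmx T](subrK 1%:M).
  apply: le_trans (ler_normD _ _) _; lra.
- exact: ltW.
Qed.

End Powers.

Section Free.
Context {R : realType} {m : nat}.
Local Notation W := 'M[R]_((m * m)%N, m).
Implicit Types (x a : W) (T A : 'M[R]_m).
Variable eps : R.
Hypothesis eps2 : eps * eps = 1.
Local Notation definite := (@definite R m eps).

Definition stab_trivial x := forall T, GLplus R m T -> chr_act x T = x -> T = 1%:M.

Lemma stab_trivialP x : stab_plus x = [set 1%:M] <-> stab_trivial x.
Proof.
split=> [e T GT Tx|H].
  by have : stab_plus x T by []; rewrite e.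
apply/seteqP; split=> [T [GT Tx]|T ->] /=; first exact: H.
by split; [exact: GLplus1|exact: chr_act1].
Qed.

Lemma stab_mxpow x T n : GLplus R m T -> chr_act x T = x -> chr_act x (mxpow T n) = x.
Proof.
move=> GT Tx; elim: n => [|n IH]; first exact: chr_act1.
by rewrite /= -chr_actM ?IH //; apply: GLplus_unit => //; exact: GLplus_mxpow.
Qed.

Lemma stab_trivial_near a : definite a -> stab_trivial a ->
  exists2 d, 0 < d & forall x, definite x -> `|x - a| < d -> stab_trivial x.
Proof.
move=> Pa fa.
have [||d d0 dP] := @proper_near R m eps eps2 a a
  [set T | `|T - 1%:M| < escape_radius (R := R) (m := m)] Pa Pa.
- exact: open_ball_mx.
- by move=> g Gg /fa -> //=; rewrite subrr normr0 escape_radius_gt0.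
exists d => // x Px xa T GT Tx; apply: mxpow_bounded => n; apply: ltW.
by apply: (dP x) => //; [exact: GLplus_mxpow|rewrite stab_mxpow].
Qed.

Lemma norm_chr_act_le x T : `|T| <= 2 -> `|invmx T| <= 2 ->
  `|chr_act x T| <= m%:R ^+ 3 * 8 * `|x|.
Proof.
move=> T2 N2; apply: mx_norm_le; first by rewrite !mulr_ge0 // exprn_ge0.
move=> p k; case/mxvec_indexP: p => i j; rewrite -/(chr _ i j k) chr_actE.
have -> : m%:R ^+ 3 * 8 * `|x| = \sum_(b < m) \sum_(c < m) \sum_(a < m) (`|x| * 2 * 2 * 2).
  by rewrite !sumr_const !card_ord -!mulrnA -[RHS]mulr_natr !natrM; ring.
apply: le_trans (ler_norm_sum _ _ _) _; apply: ler_sum => b _.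
apply: le_trans (ler_norm_sum _ _ _) _; apply: ler_sum => c _.
apply: le_trans (ler_norm_sum _ _ _) _; apply: ler_sum => a _.
rewrite !normrM; apply: ler_pM; rewrite ?mulr_ge0 //.
  apply: ler_pM; rewrite ?mulr_ge0 //.
    by apply: ler_pM => //; [exact: ler_entry_norm|exact: le_trans (ler_entry_norm _ _ _) T2].
  exact: le_trans (ler_entry_norm _ _ _) T2.
exact: le_trans (ler_entry_norm _ _ _) N2.
Qed.

(** For a derivation the first order term drops out exactly: with [T = 1 + s A], the defect is [s^2]
    times [invmx T *m lmul a (A *m u) *m A]. The bound on [invmx T] makes [C] independent of [s]. *)
Lemma chr_act_deriv0 a A : chr_deriv a A = 0 -> exists2 C, 0 <= C & forall s,
  1%:M + s *: A \in unitmx -> `|invmx (1%:M + s *: A)| <= 2 ->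
  `|chr_act a (1%:M + s *: A) - a| <= s ^+ 2 * C.
Proof.
move=> dA0; pose c i := m%:R * (m%:R * 2 * `|lmul a (A *m delta_mx i 0)|) * `|A|.
have c0 i : 0 <= c i by rewrite !mulr_ge0.
exists (\sum_i c i) => [|s uT N2]; first by apply: sumr_ge0.
set T := 1%:M + s *: A in uT N2 *.
have key u : lmul (chr_act a T - a) u = s ^+ 2 *: (invmx T *m lmul a (A *m u) *m A).
  rewrite lmulDl lmulNl lmul_chr_act //.
  have -> : lmul a u = invmx T *m (T *m lmul a u) by rewrite mulKmx.
  rewrite -mulmxA -mulmxBr -mulmxA scalemxAr; congr (_ *m _).
  have Au : lmul a (T *m u) = lmul a u + s *: lmul a (A *m u).
    by rewrite addrC -lmulPr mulmxDl mul1mx -scalemxAl addrC.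
  have dE : A *m lmul a u = lmul a (A *m u) + lmul a u *m A.
    by apply/eqP; rewrite eq_sym -subr_eq0 -lmul_chr_deriv dA0 lmul0l.
  rewrite Au /T mulmxDr mulmx1 mulmxDl mul1mx -scalemxAl dE -!scalemxAr mulmxDl -scalemxAl.
  rewrite scalerDr scalerA -expr2 scalerDr.
  by apply/matrixP => k j; rewrite !mxE; ring.
apply: mx_norm_le => [|p k]; first by rewrite mulr_ge0 ?sqr_ge0 ?sumr_ge0.
case/mxvec_indexP: p => i j.
rewrite -/(chr _ i j k) -lmul_delta key mxE normrM ger0_norm ?sqr_ge0 // ler_wpM2l ?sqr_ge0 //.
apply: le_trans (ler_entry_norm _ _ _) _; apply: le_trans (norm_mulmx _ _) _.
apply: (@le_trans _ _ (c i)); last by rewrite (bigD1 i) //= lerDl sumr_ge0.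
rewrite ler_wpM2r // ler_wpM2l //; apply: le_trans (norm_mulmx _ _) _.
by rewrite ler_wpM2r // ler_wpM2l.
Qed.

(* If [A] is a derivation, the powers of [1 + s A] almost fix [a] until they
   leave a given neighbourhood of the identity, after about [1/s] steps; this
   replaces the one-parameter group [exp (t A)]. *)
Lemma chr_deriv_inj a A : definite a -> stab_trivial a -> chr_deriv a A = 0 -> A = 0.
Proof.
move=> Pa fa dA0; apply/eqP; apply: contraT => An0.
have A0 : 0 < `|A| by rewrite normr_gt0.
have [r r0 rP] := @near_one R m.
have [C2 C20 C2P] := chr_act_deriv0 dA0.
have [||d d0 dP] := @proper_near R m eps eps2 a a [set T | `|T - 1%:M| < r] Pa Pa.
- exact: open_ball_mx.
- by move=> g Gg /fa -> //=; rewrite subrr normr0.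
pose C : R := m%:R ^+ 3 * 8.
have C0 : 0 <= C by rewrite mulr_ge0 // exprn_ge0.
(* [s * Q] bounds the total drift before escape: at most [1 + 2 r / (s |A|)] steps, each moving the
   array by at most [C s^2 C2]. *)
pose Q := C * C2 * (1 + 2 * r / `|A|) + 1.
have Q0 : 0 < Q by rewrite ltr_wpDl // !mulr_ge0 // addr_ge0 // !mulr_ge0 ?ltW // invr_gt0.
pose s := Num.min 1 (Num.min (r / (2 * `|A|)) (d / (2 * Q))).
have s0 : 0 < s by rewrite !lt_min ltr01 !divr_gt0 // mulr_gt0.
have s1 : s <= 1 by rewrite ge_min lexx.
have sA : s * `|A| < r.
  apply: (@le_lt_trans _ _ (r / (2 * `|A|) * `|A|)).
    by rewrite ler_wpM2r // !ge_min lexx orbT.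
  have -> : r / (2 * `|A|) * `|A| = r / 2 by field; rewrite gt_eqF.
  by rewrite ltr_pdivrMr // mulr_natr mulr2n ltrDl.
have sd : s * Q < d.
  apply: (@le_lt_trans _ _ (d / (2 * Q) * Q)).
    by rewrite ler_wpM2r ?(ltW Q0) // !ge_min lexx !orbT.
  have -> : d / (2 * Q) * Q = d / 2 by field; rewrite gt_eqF.
  by rewrite ltr_pdivrMr // mulr_natr mulr2n ltrDl.
pose T := 1%:M + s *: A.
have T1 : T - 1%:M = s *: A by rewrite /T addrC addKr.
have Ts : `|T - 1%:M| = s * `|A| by rewrite T1 normrZ gtr0_norm.
have [GT T2 N2 _] := rP T ltac:(by rewrite Ts).
(* [n] is the first exponent whose power leaves the ball of radius [r]; there is one because a
   matrix with all powers near 1 equals 1. *)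
have [n nP nmin] : exists2 n, r <= `|mxpow T n - 1%:M| &
    forall j, (j < n)%N -> `|mxpow T j - 1%:M| < r.
  have ex : exists n, r <= `|mxpow T n - 1%:M|.
    apply: contrapT => nex; case/negP: An0.
    have : T = 1%:M.
      apply: mxpow_bounded => j; have [|_ _ _ //] := rP (mxpow T j).
      by rewrite ltNge; apply/negP => h; apply: nex; exists j.
    move/eqP; rewrite -subr_eq0 T1 scaler_eq0 gt_eqF //=.
  case: (ex_minnP ex) => n nP nmin; exists n => // j jn.
  by rewrite ltNge; apply: contraTN jn => /nmin; rewrite -leqNgt.
(* Telescoping: as the action is linear in the array, each step contributes the defect of a single
   [T], carried by a power that is still near 1. *)
have small k : (k <= n)%N -> `|chr_act a (mxpow T k) - a| <= k%:R * (C * (s ^+ 2 * C2)).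
  elim: k => [|k IH] kn; first by rewrite chr_act1 subrr normr0 mul0r.
  have Gk := GLplus_mxpow k GT.
  rewrite mxpowSl -chr_actM ?GLplus_unit //.
  have -> : chr_act (chr_act a T) (mxpow T k) =
     chr_act (chr_act a T - a) (mxpow T k) + chr_act a (mxpow T k).
    have := chr_act_linear (GLplus_unit Gk) 1 (chr_act a T - a) a.
    by rewrite !scale1r subrK.
  rewrite -addrA; apply: le_trans (ler_normD _ _) _.
  rewrite -natr1 mulrDl mul1r [leLHS]addrC; apply: lerD; first exact: (IH (ltnW kn)).
  have [_ k2 ki2 _] := rP _ (nmin k kn).
  apply: le_trans (norm_chr_act_le _ k2 ki2) _; rewrite -/C ler_wpM2l //.
  exact: C2P (GLplus_unit GT) N2.
have n0 : (0 < n)%N.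
  by rewrite lt0n; apply: contraTneq nP => ->; rewrite /= subrr normr0 -ltNge.
(* The power [n - 1] is still within [r] of 1, while the distance has grown at linear speed. *)
have nle : n%:R <= 1 + 2 * r / (s * `|A|).
  rewrite -(prednK n0) -natr1 addrC lerD2l ler_pdivlMr ?mulr_gt0 //.
  have /mxpow_escape : forall j, (j < n.-1)%N ->
      `|mxpow T j - 1%:M| <= escape_radius (R := R) (m := m).
    move=> j jn; have [|_ _ _ //] := rP (mxpow T j).
    by apply: nmin; exact: leq_trans jn (leq_pred _).
  have := nmin n.-1; rewrite prednK // => /(_ (leqnn _)); rewrite Ts.
  by set k : R := _%:R; set t := `|mxpow _ _ - _|; set w := s * `|A|; lra.
have : `|mxpow T n - 1%:M| < r.
  apply: (dP a (mxpow T n) Pa); rewrite ?subrr ?normr0 //; first exact: GLplus_mxpow.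
  apply: le_lt_trans (small n (leqnn _)) _; apply: le_lt_trans sd.
  apply: (@le_trans _ _ ((1 + 2 * r / (s * `|A|)) * (C * (s ^+ 2 * C2)))).
    by apply: ler_wpM2r => //; apply: mulr_ge0 => //; apply: mulr_ge0 => //; exact: sqr_ge0.
  have -> : (1 + 2 * r / (s * `|A|)) * (C * (s ^+ 2 * C2)) =
     s * (C * C2 * (s + 2 * r / `|A|)) by field; rewrite !gt_eqF.
  rewrite ler_pM2l // /Q.
  apply: le_trans (_ : C * C2 * (1 + 2 * r / `|A|) <= _); last by rewrite lerDl.
  by rewrite ler_wpM2l ?mulr_ge0 // lerD2r.
by rewrite ltNge nP.
Qed.

End Free.

(** * Density of trivial stabilizers *)

Section Covariants.
Context {S : comNzRingType} {m : nat}.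
Implicit Type F : 'I_m -> 'I_m -> 'I_m -> S.

(** The form [u |-> tr (lmul u)]. The coefficients lie in any commutative ring, so that the
    invariants can also be formed over polynomials. *)
Definition cov_trace F : 'rV[S]_m := \row_i \sum_a F i a a.

Definition cov_form F : 'M[S]_m := \matrix_(i, j) \sum_k F i j k * cov_trace F 0 k.

(** The vector dual to the trace form under [cov_form], up to the determinant: the adjugate avoids a
    division and keeps everything polynomial. *)
Definition cov_vec F : 'cV[S]_m := \adj (cov_form F) *m (cov_trace F)^T.

Definition cov_endo F : 'M[S]_m := \matrix_(k, j) \sum_i F i j k * cov_vec F i 0.

(** A matrix that fixes the vector and commutes with the endomorphism fixes every column, so it is 1
    when the columns form a basis. *)
Definition cov_krylov F : 'M[S]_m :=
  \matrix_(i, n) (iter n (mulmx (cov_endo F)) (cov_vec F)) i 0.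

Definition cov_disc F : S := \det (cov_krylov F) * \det (cov_form F).

End Covariants.

Lemma cov_disc_morph (S S' : comNzRingType) m (f : {rmorphism S -> S'})
    (F : 'I_m -> 'I_m -> 'I_m -> S) :
  cov_disc (fun i j k => f (F i j k)) = f (cov_disc F).
Proof.
have e1 : cov_trace (fun i j k => f (F i j k)) = map_mx f (cov_trace F).
  by apply/matrixP => i j; rewrite !mxE rmorph_sum.
have e2 : cov_form (fun i j k => f (F i j k)) = map_mx f (cov_form F).
  apply/matrixP => i j; rewrite mxE e1 !mxE rmorph_sum.
  by apply: eq_bigr => k _; rewrite mxE rmorphM.
have e3 : cov_vec (fun i j k => f (F i j k)) = map_mx f (cov_vec F).
  by rewrite /cov_vec e1 e2 map_mxM map_mx_adj map_trmx.
have e4 : cov_endo (fun i j k => f (F i j k)) = map_mx f (cov_endo F).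
  apply/matrixP => i j; rewrite mxE e3 !mxE rmorph_sum.
  by apply: eq_bigr => k _; rewrite mxE rmorphM.
have e5 : cov_krylov (fun i j k => f (F i j k)) = map_mx f (cov_krylov F).
  apply/matrixP => i n; rewrite !mxE e3 e4.
  have -> : iter n (mulmx (map_mx f (cov_endo F))) (map_mx f (cov_vec F)) =
     map_mx f (iter n (mulmx (cov_endo F)) (cov_vec F)).
    by elim: (n : nat) => //= k ->; rewrite map_mxM.
  by rewrite mxE.
by rewrite /cov_disc e5 e2 !det_map_mx rmorphM.
Qed.

Section Density.
Context {R : realType} {m : nat}.
Local Notation W := 'M[R]_((m * m)%N, m).
Implicit Types (x a : W) (T A : 'M[R]_m).

Lemma cov_disc_stab x : cov_disc (chr x) != 0 -> stab_trivial x.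
Proof.
rewrite mulf_eq0 negb_or => /andP[K0 B0] T GT Tx.
have uT := GLplus_unit GT.
set w := cov_trace (chr x); set B := cov_form (chr x) in B0.
set v := cov_vec (chr x); set L := cov_endo (chr x).
have lT u : lmul x (T *m u) *m T = T *m lmul x u.
  by rewrite -[in RHS]Tx lmul_chr_act // !mulmxA mulmxV // mul1mx.
have wE u : (w *m u) 0 0 = \tr (lmul x u).
  rewrite mxE /mxtrace; under [RHS]eq_bigr do rewrite mxE.
  rewrite exchange_big; apply: eq_bigr => i _; rewrite mxE mulr_suml.
  by apply: eq_bigr.
have wT : w *m T = w.
  have col0 (z : 'rV[R]_m) j : z 0 j = (z *m (delta_mx j 0 : 'cV_m)) 0 0.
    by rewrite -colE [RHS]mxE.
  apply/rowP => j; rewrite !col0 -mulmxA !wE.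
  have -> : lmul x (T *m delta_mx j 0) = T *m lmul x (delta_mx j 0) *m invmx T.
    by rewrite -lT -mulmxA mulmxV // mulmx1.
  by rewrite mxtrace_mulC mulmxA mulVmx // mul1mx.
have BE u z : u^T *m B *m z = w *m lmul x u *m z.
  congr (_ *m z); apply/rowP => j; rewrite !mxE.
  under [RHS]eq_bigr do rewrite [lmul _ _ _ _]mxE mulr_sumr.
  rewrite exchange_big; apply: eq_bigr => i _; rewrite !mxE mulr_sumr.
  by apply: eq_bigr => k _; ring.
have Bv : B *m v = \det B *: w^T by rewrite /v /cov_vec mulmxA mul_mx_adj mul_scalar_mx.
have bv u : w *m lmul x u *m v = \det B *: (w *m u).
  rewrite -BE -mulmxA Bv -scalemxAr -trmx_mul; congr (_ *: _).
  by apply/matrixP => i j; rewrite !ord1 mxE.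
have uB : B \in unitmx by rewrite unitmxE unitfE.
(* [B] is invariant and [B(u, v) = \det B * w u]. Hence [B(T u, T v) = B(u, v) = B(T u, v)] for all
   [u], because [w] is invariant too; then [B] is cancelled. *)
have Tv : T *m v = v.
  apply: (can_inj (mulKmx uB)); apply/eqP; rewrite -subr_eq0 -mulmxBr; apply/eqP/colP => i.
  rewrite [RHS]mxE; pose u : 'cV[R]_m := invmx T *m delta_mx i 0.
  have uE : T *m u = delta_mx i 0 by rewrite mulKVmx.
  have -> : (B *m (T *m v - v)) i 0 = ((T *m u)^T *m B *m (T *m v - v)) 0 0.
    by rewrite uE trmx_delta -mulmxA -rowE [RHS]mxE.
  have e1 : w *m lmul x (T *m u) *m (T *m v) = w *m lmul x u *m v.
    by rewrite mulmxA -[w *m _ *m T]mulmxA lT [w *m (T *m _)]mulmxA wT.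
  by rewrite BE mulmxBr e1 !bv [w *m (T *m u)]mulmxA wT subrr mxE.
have LE : L = lmul x v by apply/matrixP => k j; rewrite !mxE.
have LT : L *m T = T *m L by rewrite LE -{1}Tv lT.
have TK : T *m cov_krylov (chr x) = cov_krylov (chr x).
  have it n : T *m iter n (mulmx L) v = iter n (mulmx L) v.
    by elim: n => //= n IH; rewrite mulmxA -LT -mulmxA IH.
  apply/matrixP => i n; rewrite [RHS]mxE -/L -/v -it !mxE.
  by apply: eq_bigr => k _; rewrite mxE.
have uK : cov_krylov (chr x) \in unitmx by rewrite unitmxE unitfE.
by rewrite -[T]mulmx1 -(mulmxV uK) mulmxA TK.
Qed.

End Density.

Section Witness.
Context {R : realType} {m' : nat}.
Local Notation m := m'.+1.
Local Notation W := 'M[R]_((m * m)%N, m).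

Let om (i : 'I_m) : R := i.+1%:R.

(* The commutative algebra [e_i e_j = 0] for [i <> j],
   [e_i e_i = om_i e_i + (om_i - om_i^2) e_0]: its trace form is [om], the
   covariant vector is proportional to [(1, ..., 1)], and left multiplication by
   that vector has the distinct eigenvalues [om_i] up to a factor. *)
Definition rigid_witness : W := chr_of (fun i j k =>
  (i == j)%:R * (om i * (k == i)%:R + (om i - om i ^+ 2) * (k == 0)%:R)).

Lemma rigid_witness_tf : torsion_free rigid_witness.
Proof.
move=> i j k; rewrite !chr_ofE eq_sym; case: eqP => [->//|_].
by rewrite !mul0r.
Qed.

Lemma rigid_witness_disc : cov_disc (chr rigid_witness) != 0.
Proof.
have om0 i : om i != 0 by rewrite pnatr_eq0.
have om_0 : om 0 = 1 by [].
set F := chr rigid_witness.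
have FE i j k : F i j k = (i == j)%:R * (om i * (k == i)%:R + (om i - om i ^+ 2) * (k == 0)%:R).
  exact: chr_ofE.
have Fd (G : 'I_m -> R) j k : \sum_i F i j k * G i = F j j k * G j.
  rewrite (bigD1 j) //= big1 ?addr0 // => i ij.
  by rewrite FE (negPf ij) !mul0r.
have wE : cov_trace F = \row_i om i.
  apply/rowP => i; rewrite !mxE (bigD1 i) //= big1 ?addr0 => [|a ai].
    rewrite FE !eqxx mul1r mulr1; case: eqP => [->|_]; last by rewrite mulr0 addr0.
    by rewrite om_0 expr1n subrr mul0r addr0.
  by rewrite FE eq_sym (negPf ai) mul0r.
have kron (a b : R) (G : 'I_m -> R) (i : 'I_m) :
    \sum_k (a * (k == i)%:R + b * (k == 0)%:R) * G k = a * G i + b * G 0.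
  have one (c : R) l : \sum_k c * (k == l)%:R * G k = c * G l.
    rewrite (bigD1 l) //= eqxx mulr1 big1 ?addr0 // => k kl.
    by rewrite (negPf kl) mulr0 mul0r.
  by under eq_bigr do rewrite mulrDl; rewrite big_split /= !one.
(* The coefficient [om_i - om_i^2] was chosen so that the trace form takes the value [om_i] on
   [e_i e_i]; as the trace form itself is [om], the dual vector is constant. *)
have BE : cov_form F = diag_mx (\row_i om i).
  apply/matrixP => i j; rewrite !mxE wE.
  have [<-|ij] := eqVneq i j; last first.
    by rewrite big1 // => k _; rewrite FE (negPf ij) !mul0r.
  under eq_bigr do rewrite FE eqxx mul1r.
  by rewrite kron !mxE om_0 mulr1 mulr1n; ring.
pose beta : R := \det (cov_form F).
have b0 : beta != 0.
  rewrite /beta BE det_diag; apply/prodf_neq0 => i _; rewrite mxE; exact: om0.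
have uB : cov_form F \in unitmx by rewrite unitmxE unitfE.
have vE : cov_vec F = const_mx beta.
  apply: (can_inj (mulKmx uB)); rewrite /cov_vec mulmxA mul_mx_adj -/beta wE mul_scalar_mx BE.
  by apply/colP => i; rewrite mul_diag_mx !mxE mulrC.
set L := cov_endo F.
have LE k j : L k j = beta * (om j * (k == j)%:R + (om j - om j ^+ 2) * (k == 0)%:R).
  by rewrite mxE Fd vE mxE FE eqxx mul1r mulrC.
(* The rows of [P] are left eigenvectors of [L]: [om] for the index 0, coordinate forms otherwise.
   They turn the Krylov matrix into a diagonal matrix times a Vandermonde matrix with distinct
   nodes. *)
pose P : 'M[R]_m := \matrix_(i, j) if i == 0 then om j else (i == j)%:R.
have PL : P *m L = diag_mx (\row_i (beta * om i)) *m P.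
  apply/matrixP => i j; rewrite mul_diag_mx [RHS]mxE [X in X * _]mxE [LHS]mxE.
  have -> : \sum_k P i k * L k j = beta * (om j * P i j + (om j - om j ^+ 2) * P i 0).
    rewrite -kron mulr_sumr; apply: eq_bigr => k _; rewrite LE; ring.
  rewrite !mxE; have [->|i0] := eqVneq i 0; first by rewrite om_0; ring.
  by have [->|_] := eqVneq i j; rewrite /=; ring.
pose d : 'rV[R]_m := \row_i (P *m cov_vec F) i 0.
have PK : P *m cov_krylov F = diag_mx d *m (Vandermonde m (\row_i (beta * om i)))^T.
  have it n : P *m iter n (mulmx L) (cov_vec F) =
      \col_i ((beta * om i) ^+ n * d 0 i).
    elim: n => [|n IH] /=; first by apply/colP => i; rewrite !mxE expr0 mul1r.
    rewrite mulmxA PL -mulmxA IH; apply/colP => i.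
    by rewrite mul_diag_mx !mxE exprS mulrA.
  apply/matrixP => i n; rewrite mul_diag_mx [RHS]mxE.
  rewrite [X in _ * X]mxE [X in _ * X]mxE [X in _ * X ^+ _]mxE.
  rewrite mulrC; have /colP/(_ i) := it n; rewrite [RHS]mxE => <-.
  by rewrite !mxE; apply: eq_bigr => k _; rewrite [cov_krylov F k n]mxE.
have d0 i : d 0 i != 0.
  have -> : d 0 i = beta * \sum_j P i j.
    by rewrite !mxE mulr_sumr; apply: eq_bigr => j _; rewrite vE [X in _ * X]mxE mulrC.
  rewrite mulf_neq0 //.
  have -> : \sum_j P i j = if i == 0 then \sum_j om j else 1.
    under eq_bigr do rewrite mxE.
    case: (i == 0) => //; rewrite (bigD1 i) //= eqxx big1 ?addr0 // => j ji.
    by rewrite eq_sym (negPf ji).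
  case: (i == 0); last exact: oner_neq0.
  rewrite gt_eqF // (bigD1 0) //= om_0; apply: ltr_pwDl; first exact: ltr01.
  by apply: sumr_ge0 => j _; rewrite /om ler0n.
rewrite /cov_disc mulf_neq0 //.
have : \det (P *m cov_krylov F) != 0.
  rewrite PK det_mulmx det_diag det_tr det_Vandermonde mulf_neq0 //.
    by apply/prodf_neq0 => i _.
  apply/prodf_neq0 => i _; apply/prodf_neq0 => j ij; rewrite !mxE -mulrBr mulf_neq0 //.
  by rewrite subr_eq0 eqr_nat eqSS gtn_eqF.
by rewrite det_mulmx mulf_eq0 negb_or => /andP[].
Qed.

(* Along a segment ending at the witness, the discriminant is a nonzero polynomial. *)
Lemma stab_trivial_segment (x : W) (r : R) : 0 < r ->
  exists t, [/\ 0 < t, t < r & stab_trivial (x + t *: (rigid_witness - x))].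
Proof.
move=> r0; pose y := rigid_witness - x.
pose F i j k : {poly R} := (chr x i j k)%:P + 'X * (chr y i j k)%:P.
pose p := cov_disc F.
have pE t : p.[t] = cov_disc (chr (x + t *: y)).
  transitivity (cov_disc (fun i j k => horner_eval t (F i j k))).
    by rewrite (cov_disc_morph (horner_eval t) F).
  congr cov_disc; apply/funext => i; apply/funext => j; apply/funext => k.
  by rewrite /F /horner_eval !hornerE addrC [RHS]mxE [X in _ = _ + X]mxE addrC.
have p0 : p != 0.
  apply: contraNneq rigid_witness_disc => p0.
  have <- : x + 1 *: y = rigid_witness by rewrite scale1r addrC subrK.
  by rewrite -pE p0 horner0.
(* These are [size p] distinct points, more than the roots of a nonzero [p]; denominators start at 2
   to stay strictly below [r]. *)
pose ts := [seq r / k.+2%:R | k <- iota 0 (size p)].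
have uts : uniq ts.
  rewrite map_inj_uniq ?iota_uniq // => k l /(mulfI (lt0r_neq0 r0)) /invr_inj.
  by move/eqP; rewrite eqr_nat => /eqP [].
have : ~~ all (root p) ts.
  apply: contraL (leqnn (size p)) => al; rewrite -ltnNge.
  by have := max_poly_roots p0 al uts; rewrite size_map size_iota.
move/allPn => [t /mapP[k _ tE] nr].
exists t; split.
- by rewrite tE divr_gt0.
- by rewrite tE ltr_pdivrMr // ltr_pMr // ltr1n.
- by apply: cov_disc_stab; rewrite -pE.
Qed.

End Witness.

(** * Slices *)

Section LinearSlice.
Context {R : realType} {m : nat}.
Local Notation W := 'M[R]_((m * m)%N, m).

Lemma vspace_coordinates (K : {vspace W}) d : \dim K = d ->
  exists (b : 'rV[R]_d -> W) (co : W -> 'rV[R]_d), [/\ linear b, linear co,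
    forall z, b z \in K, forall z, co (b z) = z & forall k, k \in K -> b (co k) = k].
Proof.
move=> <-.
exists (fun z : 'rV[R]_(\dim K) => \sum_(i < \dim K) z 0 i *: (vbasis K)`_i),
  (fun w => \row_(i < \dim K) coord (vbasis K) i w).
split.
- move=> a u v; rewrite scaler_sumr -big_split; apply: eq_bigr => i _ /=.
  by rewrite !mxE scalerDl scalerA.
- by move=> a u v; apply/rowP => i; rewrite !mxE linearP.
- move=> z; apply: memv_suml => i _; apply: memvZ.
  by apply: vbasis_mem; rewrite mem_nth // size_tuple.
- move=> z; apply/rowP => i; rewrite mxE coord_sum_free //.
  exact: basis_free (vbasisP K).
- move=> k Kk; rewrite [RHS](coord_vbasis Kk); apply: eq_bigr => i _.
  by rewrite mxE.
Qed.

(** [K] is a complement of the image of [L] inside [E], and [Lam] projects onto the image along [K]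
    and then inverts [L]. *)
Lemma complement_projection (E : {vspace W}) (L : 'M[R]_m -> W) :
  linear L -> (forall A, L A = 0 -> A = 0) -> (forall A, L A \in E) ->
  exists (Lam : W -> 'M[R]_m) (K : {vspace W}),
   [/\ linear Lam, \dim K = (\dim E - m * m)%N, forall A, Lam (L A) = A,
      (forall k, k \in K -> Lam k = 0 /\ k \in E) &
      forall w, w \in E -> w - L (Lam w) \in K].
Proof.
move=> lL L0 LE.
pose fL := HB.pack_for {linear 'M[R]_m -> W} L (GRing.isLinear.Build _ _ _ _ _ lL).
pose f := linfun fL.
have fE A : f A = L A by rewrite lfunE.
have f0 : lker f == 0%VS.
  by apply/lker0P => A B; rewrite !fE => e; apply/eqP; rewrite -subr_eq0; apply/eqP/L0;
    rewrite -[L _]/(fL _) linearB /= e subrr.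
pose K := (E :\: limg f)%VS.
have fsE : (limg f <= E)%VS.
  by apply/subvP => _ /memv_imgP[A _ ->]; rewrite fE.
have KI : (K :&: limg f = 0)%VS by exact: capv_diff.
have IK : (limg f :&: K = 0)%VS by rewrite capvC.
have KE : (limg f + K)%VS = E.
  by rewrite addvC -[RHS](addv_diff_cap E (limg f)) (capv_idPr fsE).
pose p w := daddv_pi (limg f) K w.
have pimg w : p w \in limg f by exact: memv_pi.
have pK k : k \in K -> p k = 0.
  move=> Kk; have := @daddv_pi_add _ _ (limg f) K k IK.
  rewrite (daddv_pi_id KI Kk) => /(_ (subvP (addvSr _ _) _ Kk)).
  by move/eqP; rewrite addrC -subr_eq0 addrAC subrr add0r => /eqP.
exists (fun w => (f^-1)%VF (p w)), K; split.
- by move=> a u v; rewrite /p !linearP.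
- have := dimv_cap_compl E (limg f); rewrite (capv_idPr fsE).
  rewrite limg_dim_eq; last by rewrite (eqP f0) capv0.
  by rewrite dimvf /dim /= => <-; rewrite addKn.
- move=> A; rewrite /p daddv_pi_id //; last by rewrite -fE memv_img ?memvf.
  by rewrite -fE lker0_lfunK.
- move=> k Kk; split; first by rewrite pK // linear0.
  by apply: subvP Kk; exact: diffvSl.
move=> w wE; rewrite -fE limg_lfunVK //.
rewrite -[X in X - _](@daddv_pi_add _ _ (limg f) K w IK) ?KE //.
by rewrite addrC addKr memv_pi.
Qed.

Lemma linear_mx0 a b c d (f : 'M[R]_(a, b) -> 'M[R]_(c, d)) : linear f -> f 0 = 0.
Proof. by move=> lf; have := lf (-1) 0 0; rewrite scaler0 addr0 scaleN1r addNr. Qed.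

Lemma linear_mx_bound a b c d (f : 'M[R]_(a, b) -> 'M[R]_(c, d)) : linear f ->
  exists2 C, 0 <= C & forall w, `|f w| <= C * `|w|.
Proof.
move=> lf; pose fL := HB.pack_for {linear 'M[R]_(a, b) -> 'M[R]_(c, d)} f
  (GRing.isLinear.Build _ _ _ _ _ lf).
have [C C0 CP] := @linear_lipschitz _ _ _ fL (linear_mx_continuous lf).
by exists C => //; exact: ltW.
Qed.

Lemma norm_lmul (x : W) (u : 'cV[R]_m) : `|lmul x u| <= m%:R * `|x| * `|u|.
Proof.
apply: mx_norm_le => [|k j]; first by rewrite !mulr_ge0.
rewrite mxE; apply: le_trans (ler_norm_sum _ _ _) _.
rewrite -mulrA mulr_natl -[X in _ *+ X]card_ord -sumr_const.
by apply: ler_sum => i _; rewrite normrM ler_pM // ler_entry_norm.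
Qed.

End LinearSlice.

Section Slice.
Context {R : realType} {m : nat}.
Local Notation W := 'M[R]_((m * m)%N, m).
Implicit Types (x a w : W) (T A g : 'M[R]_m).
Variable eps : R.
Hypothesis eps2 : eps * eps = 1.
Variable E : {vspace W}.
Hypothesis E_act : forall x T, T \in unitmx -> x \in E -> chr_act x T \in E.
Hypothesis E_deriv : forall x A, x \in E -> chr_deriv x A \in E.

Definition free_part : set W :=
  [set x | [/\ x \in E, definite eps x & stab_trivial x]].
Local Notation P := free_part.

Lemma chr_actK x T : T \in unitmx -> chr_act (chr_act x T) (invmx T) = x.
Proof. by move=> uT; rewrite chr_actM ?unitmx_inv // mulmxV // chr_act1. Qed.

Lemma stab_trivial_act x g : GLplus R m g -> stab_trivial x -> stab_trivial (chr_act x g).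
Proof.
move=> Gg fx T GT; have ug := GLplus_unit Gg; have uT := GLplus_unit GT.
rewrite chr_actM // => e.
have : chr_act x (g *m T *m invmx g) = x.
  by rewrite -chr_actM ?unitmx_inv ?unitmx_mul ?ug // e chr_actK.
move/(fx _ (GLplusM (GLplusM Gg GT) (GLplusV Gg))) => e1.
by rewrite -(mulKmx ug T) -[g *m T](mulmxKV ug) e1 mul1mx mulVmx.
Qed.

Lemma free_part_act x g : P x -> GLplus R m g -> P (chr_act x g).
Proof.
move=> [xE Px fx] Gg; have ug := GLplus_unit Gg; split.
- exact: E_act.
- exact: definite_act.
- exact: stab_trivial_act.
Qed.

Lemma free_part_act_inj x g h : P x -> GLplus R m g -> GLplus R m h ->
  chr_act x g = chr_act x h -> g = h.
Proof.
move=> [_ _ fx] Gg Gh e; have ug := GLplus_unit Gg; have uh := GLplus_unit Gh.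
have : chr_act x (g *m invmx h) = x.
  by rewrite -chr_actM ?unitmx_inv // e chr_actK.
move/(fx _ (GLplusM Gg (GLplusV Gh))) => e1.
by rewrite -[g](mulmxKV uh) e1 mul1mx.
Qed.

Section AtPoint.
Variables (x0 : W) (Lam : W -> 'M[R]_m).
Hypothesis lLam : linear Lam.
Hypothesis LamL : forall A, Lam (chr_deriv x0 A) = A.

Let hor w := w - chr_deriv x0 (Lam w).
Let F w := chr_act (x0 + hor w) (1%:M + Lam w) - x0.
Let U : set W := [set w | GLplus R m (1%:M + Lam w)].

Lemma slice_hor_linear : linear hor.
Proof.
move=> a u v; rewrite /hor lLam chr_deriv_linear scalerBr.
by rewrite opprD addrACA.
Qed.

Lemma slice_T_Ck n V : Ck_mx n V (fun w => 1%:M + Lam w).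
Proof.
apply: Ck_mx_add; first exact: Ck_mx_cst.
by apply: (@Ck_mx_lin _ _ _ _ _ _ _ _ Lam id) => //; exact: Ck_mx_id.
Qed.

Lemma slice_U_open : open U.
Proof.
apply: (@open_comp _ _ (fun w => 1%:M + Lam w) (GLplus R m)); last exact: open_GLplus.
by move=> w _; apply: (@Ck_mx_continuous _ _ 0 setT) => //; exact: slice_T_Ck.
Qed.

Lemma Lam0 : Lam 0 = 0.
Proof. exact: linear_mx0. Qed.

Lemma slice_U0 : U 0.
Proof. by rewrite /U /= Lam0 addr0; exact: GLplus1. Qed.

Lemma slice_smooth : smooth_mx U F.
Proof.
move=> n; apply: Ck_mx_sub; last exact: Ck_mx_cst.
apply: Ck_chr_act; [exact: slice_U_open|by move=> w; exact: GLplus_unit| |exact: slice_T_Ck].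
apply: Ck_mx_add; first exact: Ck_mx_cst.
by apply: (@Ck_mx_lin _ _ _ _ _ _ _ _ hor id); [exact: slice_hor_linear|exact: Ck_mx_id].
Qed.

(** The choice of [hor] cancels all terms linear in [w]: each remaining summand has two factors
    linear in [w], so [F] is the identity to first order. *)
Lemma slice_remainder w u : GLplus R m (1%:M + Lam w) ->
  lmul (F w - w) u = invmx (1%:M + Lam w) *m
   (lmul x0 (Lam w *m u) *m Lam w + lmul (hor w) u *m Lam w +
    lmul (hor w) (Lam w *m u) *m (1%:M + Lam w) - Lam w *m lmul w u).
Proof.
move=> GT; have uT := GLplus_unit GT; set T := 1%:M + Lam w in uT *.
have dE : lmul (hor w) u =
    lmul w u - (lmul x0 (Lam w *m u) + lmul x0 u *m Lam w - Lam w *m lmul x0 u).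
  by rewrite /hor lmulDl lmulNl lmul_chr_deriv.
have -> : lmul (F w - w) u = invmx T *m lmul (x0 + hor w) (T *m u) *m T - lmul (x0 + w) u.
  by rewrite /F -addrA -opprD [LHS]lmulDl lmulNl lmul_chr_act.
have -> : lmul (x0 + w) u = invmx T *m (T *m lmul (x0 + w) u) by rewrite mulKmx.
rewrite -mulmxA -mulmxBr; congr (_ *m _).
have -> : T *m u = u + Lam w *m u by rewrite mulmxDl mul1mx.
rewrite (lmulDl x0 (hor w)) (lmulDl x0 w) !lmulDr dE /T.
move: (lmul x0 u) (lmul w u) (Lam w) => a b l.
rewrite !(mulmxDl, mulmxDr, mulNmx, mulmxN, mulmx1, mul1mx, opprD, opprK).
by apply/matrixP => i j; rewrite !mxE; ring.
Qed.

Lemma slice_quadratic : exists r C, [/\ 0 < r, 0 <= C &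
  forall w, `|w| < r -> `|F w - w| <= C * `|w| ^+ 2].
Proof.
have [c1 c10 c1P] := linear_mx_bound lLam.
have [c2 c20 c2P] := linear_mx_bound slice_hor_linear.
have [d d0 dP] := @near_one R m.
pose M : R := m%:R; have M0 : 0 <= M by [].
pose C := M * (M * `|x0| * (M * c1)) * c1 + M * (M * c2) * c1 +
  M * (M * c2 * (M * c1)) * 2 + M * c1 * M.
have C0 : 0 <= C by rewrite !addr_ge0 // !mulr_ge0.
have c11 : 0 < c1 + 1 by rewrite ltr_wpDl.
(* This radius puts [1 + Lam w] where [near_one] bounds it and its inverse by 2. *)
exists (d / (c1 + 1)), (M * 2 * C); split; [exact: divr_gt0|by rewrite !mulr_ge0|].
move=> w; rewrite ltr_pdivlMr // => wd; set t := `|w| in wd *.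
have t0 : 0 <= t by exact: normr_ge0.
have Lt : `|Lam w| <= c1 * t by exact: c1P.
have ht : `|hor w| <= c2 * t by exact: c2P.
have [|GT T2 N2 _] := dP (1%:M + Lam w).
  by rewrite addrC addKr; apply: le_lt_trans Lt _; apply: le_lt_trans wd; nra.
apply: mx_norm_le => [|p k]; first by rewrite !mulr_ge0 // sqr_ge0.
case/mxvec_indexP: p => i j.
rewrite -/(chr _ i j k) -lmul_delta slice_remainder //.
apply: le_trans (ler_entry_norm _ _ _) _; apply: le_trans (norm_mulmx _ _) _.
rewrite -[M * 2 * C * _]mulrA; apply: ler_pM => //; first by rewrite ler_wpM2l.
set u : 'cV[R]_m := delta_mx i 0.
have u1 : `|u| <= 1.
  apply: mx_norm_le => // a b; rewrite mxE; case: (_ && _); first by rewrite normr1.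
  by rewrite normr0.
have mulb n1 n2 (A : 'M[R]_(n1, m)) (B : 'M[R]_(m, n2)) p q :
    `|A| <= p -> `|B| <= q -> `|A *m B| <= M * p * q.
  move=> Ap Bq; apply: le_trans (norm_mulmx _ _) _.
  by apply: ler_pM => //; rewrite ler_wpM2l.
have lmb x v p q : `|x| <= p -> `|v| <= q -> `|lmul x v| <= M * p * q.
  move=> xp vq; apply: le_trans (norm_lmul _ _) _.
  by apply: ler_pM => //; rewrite ler_wpM2l.
have Lu : `|Lam w *m u| <= M * (c1 * t) * 1 by apply: mulb.
have b1 : `|lmul x0 (Lam w *m u) *m Lam w| <= M * (M * `|x0| * (M * (c1 * t) * 1)) * (c1 * t).
  by apply: mulb => //; apply: lmb.
have b2 : `|lmul (hor w) u *m Lam w| <= M * (M * (c2 * t) * 1) * (c1 * t).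
  by apply: mulb => //; apply: lmb.
have b3 : `|lmul (hor w) (Lam w *m u) *m (1%:M + Lam w)| <=
    M * (M * (c2 * t) * (M * (c1 * t) * 1)) * 2.
  by apply: mulb => //; apply: lmb.
have b4 : `|Lam w *m lmul w u| <= M * (c1 * t) * (M * t * 1).
  by apply: mulb => //; apply: lmb.
apply: le_trans (ler_normB _ _) _; apply: le_trans (lerD (ler_normD _ _) b4) _.
apply: le_trans (lerD (lerD (ler_normD _ _) b3) (lexx _)) _.
apply: le_trans (lerD (lerD (lerD b1 b2) (lexx _)) (lexx _)) _.
by rewrite le_eqVlt; apply/orP; left; apply/eqP; rewrite /C; ring.
Qed.

Lemma slice_diff v : 'd F 0 v = v.
Proof.
have F0 : F 0 = 0.
  by rewrite /F (linear_mx0 slice_hor_linear) Lam0 !addr0 chr_act1 subrr.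
have [r [C [r0 C0 CP]]] := slice_quadratic.
suff [_ ->] : is_diff (0 : W) F idfun by [].
apply/(@is_diffP _ _ _ F idfun) => [x|e e0]; first exact: cvg_id.
have C1 : 0 < C + 1 by rewrite ltr_wpDl.
apply/nbhs_mxP; exists (Num.min r (e / (C + 1))); first by rewrite lt_min r0 divr_gt0.
move=> h; rewrite subr0 lt_min ltr_pdivlMr // => /andP[hr he]; rewrite addr0 F0 subr0.
apply: le_trans (CP h hr) _; have := normr_ge0 h.
move: he; set t := `|h|; nra.
Qed.

Section Coordinates.
Hypothesis Px0 : P x0.
Variables (K : {vspace W}) (d : nat) (b : 'rV[R]_d -> W) (co : W -> 'rV[R]_d).
Hypothesis K_Lam : forall k, k \in K -> Lam k = 0 /\ k \in E.
Hypothesis hor_K : forall w, w \in E -> hor w \in K.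
Hypotheses (lb : linear b) (lco : linear co).
Hypotheses (bK : forall z, b z \in K) (coK : forall z, co (b z) = z).
Hypothesis bcoK : forall k, k \in K -> b (co k) = k.

Lemma local_slice_coord : exists (N : set 'rV[R]_d) (kap : W -> 'rV[R]_d)
    (th : W -> 'M[R]_m),
  [/\ open N, N 0, forall z, N z -> P (x0 + b z) &
   forall z g, N z -> GLplus R m g ->
     kap (chr_act (x0 + b z) g) = z /\ th (chr_act (x0 + b z) g) = g] /\
  forall z1 g1, N z1 -> GLplus R m g1 -> exists O (Fk : W -> 'rV[R]_d) (Ft : W -> 'M[R]_m),
    [/\ open O, O (chr_act (x0 + b z1) g1), smooth_mx O Fk, smooth_mx O Ft &
     forall y, P y -> O y ->
       [/\ N (Fk y), GLplus R m (Ft y) & y = chr_act (x0 + b (Fk y)) (Ft y)]].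
Proof.
have [x0E Dx0 fx0] := Px0.
have [V0 [V [Gi [[oV0 V00 V0U oV] [FK GK sG]]]]] :=
  inverse_function slice_U_open slice_U0 slice_smooth slice_diff.
have [rho rho0 rhoP] := (open_mxP _).1 oV0 _ V00.
have [cL cL0 cLP] := linear_mx_bound (chr_deriv_linear x0).
have cL1 : 0 < cL + 1 by rewrite ltr_wpDl.
(* If [|h - 1| < r1] then [L (h - 1)] has norm at most [rho / 2]; added to a slice vector shorter
   than [rho / 2] it stays in [V0]. *)
pose r1 := rho / 2 / (cL + 1).
have r10 : 0 < r1 by rewrite !divr_gt0.
have [||d1 d10 d1P] := @proper_near R m eps eps2 x0 x0 [set g | `|g - 1%:M| < r1] Dx0 Dx0.
- exact: open_ball_mx.
- by move=> g Gg /fx0 -> //=; rewrite subrr normr0.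
have [d2 d20 d2P] := stab_trivial_near eps2 Dx0 fx0.
have [d3 d30 d3P] := (open_mxP _).1 (open_definite (m := m) eps2) _ Dx0.
(* [d1] forces group elements joining slice points to be near 1, [d2] keeps stabilizers trivial,
   [d3] keeps definiteness, and [rho / 2] keeps the slice in [V0]. *)
pose r := Num.min (Num.min d1 d2) (Num.min d3 (rho / 2)).
have r0 : 0 < r by rewrite !lt_min d10 d20 d30 divr_gt0.
have rle z : `|b z| < r -> [/\ `|b z| < d1, `|b z| < d2, `|b z| < d3 & `|b z| < rho / 2].
  by rewrite !lt_min => /andP[/andP[? ?] /andP[? ?]].
pose N := [set z : 'rV[R]_d | `|b z| < r].
have oN : open N.
  apply: (@open_comp _ _ b [set w | `|w| < r]); first by move=> z _; exact: linear_mx_continuous.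
  by have := @open_ball_mx R _ _ (0 : W) r; congr open; apply/seteqP; split=> w /=; rewrite subr0.
have NP z : N z -> P (x0 + b z).
  move=> /rle [_ z2 z3 _].
  have Dz : definite eps (x0 + b z) by apply: d3P; rewrite addrC addKr.
  split=> //; first by rewrite memvD // (K_Lam (bK z)).2.
  by apply: d2P => //; rewrite addrC addKr.
have LamB z : Lam (b z) = 0 by exact: (K_Lam (bK z)).1.
have horB z : hor (b z) = b z by rewrite /hor LamB (linear_mx0 (chr_deriv_linear x0)) subr0.
have FB z : F (b z) = b z by rewrite /F horB LamB addr0 chr_act1 addrC addKr.
have lamP u v : Lam (u + v) = Lam u + Lam v by have := lLam 1 u v; rewrite !scale1r.
have horP u v : hor (u + v) = hor u + hor v.
  by have := slice_hor_linear 1 u v; rewrite !scale1r.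
have BV z : N z -> V0 (b z).
  by move=> /rle [_ _ _ z4]; apply: rhoP; rewrite subr0; apply: lt_trans z4 _; lra.
(* Properness puts [h] near 1, so [w = b z + L (h - 1)] lies in [V0]. As [F w = F (b z')],
   injectivity of [F] there gives [w = b z'], and applying [Lam] yields [h = 1]. *)
have uniq1 z z' h : N z -> N z' -> GLplus R m h ->
    chr_act (x0 + b z) h = x0 + b z' -> z = z' /\ h = 1%:M.
  move=> Nz Nz' Gh e; have [z1 _ _ z4] := rle _ Nz; have [z'1 _ _ _] := rle _ Nz'.
  have [_ Dz _] := NP z Nz.
  have hr : `|h - 1%:M| < r1.
    by apply: (d1P (x0 + b z)) => //; rewrite ?e addrC addKr.
  pose w := b z + chr_deriv x0 (h - 1%:M).
  have Lw : Lam w = h - 1%:M by rewrite lamP LamB LamL add0r.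
  have hw : hor w = b z by rewrite horP horB /hor LamL subrr addr0.
  have Fw : F w = F (b z') by rewrite FB /F hw Lw [1%:M + _]addrC subrK e addrC addKr.
  have V0w : V0 w.
    apply: rhoP; rewrite subr0; apply: le_lt_trans (ler_normD _ _) _.
    have : cL * `|h - 1%:M| <= rho / 2.
      have : `|h - 1%:M| * (cL + 1) <= rho / 2.
        by rewrite -ler_pdivlMr // ltW.
      by have := normr_ge0 (h - 1%:M); move: `|h - _| => t; lra.
    have := cLP (h - 1%:M); move: z4; lra.
  have wz : w = b z'.
    have [_ <-] := FK _ V0w; have [_ e2] := FK _ (BV _ Nz').
    by rewrite Fw e2.
  have h1 : h = 1%:M by apply/eqP; rewrite -subr_eq0 -Lw wz LamB.
  split=> //; rewrite -(coK z) -(coK z') -wz /w h1 subrr.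
  by rewrite (linear_mx0 (chr_deriv_linear x0)) addr0.
have uniq2 z z' g g' : N z -> N z' -> GLplus R m g -> GLplus R m g' ->
    chr_act (x0 + b z) g = chr_act (x0 + b z') g' -> z = z' /\ g = g'.
  move=> Nz Nz' Gg Gg' e; have ug := GLplus_unit Gg; have ug' := GLplus_unit Gg'.
  have [||zz gg] := @uniq1 z z' (g *m invmx g') Nz Nz'.
  - by apply: GLplusM => //; exact: GLplusV.
  - by rewrite -chr_actM ?unitmx_inv // e chr_actK.
  by split=> //; rewrite -[g](mulmxKV ug') gg mul1mx.
(* [sel] picks a decomposition of [y], unique by [uniq2]; off the saturation it takes the default
   [(0, 1)]. *)
pose Q y (p : 'rV[R]_d * 'M[R]_m) := [/\ N p.1, GLplus R m p.2 & y = chr_act (x0 + b p.1) p.2].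
pose sel y := xget (0, 1%:M) (Q y).
exists N, (fun y => (sel y).1), (fun y => (sel y).2).
have N0 : N 0 by rewrite /N /= (linear_mx0 lb) normr0.
have selP z g : N z -> GLplus R m g -> sel (chr_act (x0 + b z) g) = (z, g).
  move=> Nz Gg; rewrite /sel; case: xgetP => [p _ [Np Gp e]|nQ].
    by have [-> ->] := uniq2 _ _ _ _ Nz Np Gg Gp e; case: (p).
  by case: (nQ (z, g)).
split; first by split=> // z g Nz Gg; rewrite selP.
move=> z1 g1 Nz1 Gg1; have ug1 := GLplus_unit Gg1.
(* The local inverse [Gi] lives near [x0] only; elsewhere on the orbit, [y] is first brought back by
   [invmx g1]. *)
pose y' y := chr_act y (invmx g1) - x0.
pose Fk y := co (hor (Gi (y' y))).
pose Ft y := (1%:M + Lam (Gi (y' y))) *m g1.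
pose O1 := [set y | V (y' y)].
have y'C n U' : Ck_mx n U' y'.
  apply: Ck_mx_sub; last exact: Ck_mx_cst.
  apply: (@Ck_mx_lin _ _ _ _ _ _ _ _ (chr_act ^~ (invmx g1)) id); last exact: Ck_mx_id.
  by apply: chr_act_linear; rewrite unitmx_inv.
have oO1 : open O1.
  apply: (@open_comp _ _ y' V) => // y _; exact: (@Ck_mx_continuous _ _ 0 setT).
have GiC n : Ck_mx n O1 (fun y => Gi (y' y)).
  by apply: (@Ck_mx_comp _ _ _ _ _ _ _ _ V Gi y') => //; exact: sG.
have FkC n : Ck_mx n O1 Fk.
  apply: (@Ck_mx_lin _ _ _ _ _ _ _ _ (co \o hor) (fun y => Gi (y' y))) => //.
  by move=> a u v; rewrite /= slice_hor_linear lco.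
have FtC n : Ck_mx n O1 Ft.
  apply: Ck_mx_mul; last exact: Ck_mx_cst.
  apply: Ck_mx_add; first exact: Ck_mx_cst.
  exact: (@Ck_mx_lin _ _ _ _ _ _ _ _ Lam (fun y => Gi (y' y))).
pose O := O1 `&` [set y | N (Fk y)].
have oO : open O.
  apply/open_mxP => y [yO1 Ny].
  have [e1 e10 e1P] := (open_mxP _).1 oO1 _ yO1.
  have [e2 e20 e2P] := (open_mxP _).1 oN _ Ny.
  have [e3 e30 e3P] := (continuous_mxP _ _).1 (Ck_mx_continuous (FkC 0) yO1) e2 e20.
  exists (Num.min e1 e3); first by rewrite lt_min e10.
  by move=> y2; rewrite lt_min => /andP[h1 h2]; split; [exact: e1P|exact/e2P/e3P].
have y'1 : y' (chr_act (x0 + b z1) g1) = b z1 by rewrite /y' chr_actK // addrC addKr.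
have [Vz1 Gz1] := FK _ (BV _ Nz1); rewrite FB in Vz1 Gz1.
exists O, Fk, Ft; split=> //.
- split; first by rewrite /O1 /= y'1.
  by rewrite /= /Fk y'1 Gz1 horB coK.
- by move=> n i j; apply: Ck_sub (FkC n i j) => y [].
- by move=> n i j; apply: Ck_sub (FtC n i j) => y [].
move=> y [yE _ _] [yO1 Ny].
have [V0w Fw] := GK _ yO1; set w := Gi (y' y) in V0w Fw *.
have GT : GLplus R m (1%:M + Lam w) by exact: V0U.
have uT := GLplus_unit GT.
have e : chr_act (x0 + hor w) (1%:M + Lam w) = chr_act y (invmx g1).
  by move: Fw; rewrite /F /y' => /(congr1 (+%R ^~ x0)); rewrite !subrK.
(* The inverse function theorem only gives an array [w]; stability of [E] under the action puts
   [x0 + hor w] in [E], and stability under [L] then puts [w] there. *)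
have wE : w \in E.
  have : x0 + hor w \in E.
    rewrite -(chr_actK (x0 + hor w) uT) e.
    by apply: E_act; rewrite ?unitmx_inv //; apply: E_act => //; rewrite unitmx_inv.
  move=> xE; have -> : w = (x0 + hor w) - x0 + chr_deriv x0 (Lam w).
    by rewrite [x0 + _]addrC addrK /hor subrK.
  by rewrite memvD ?memvB // E_deriv.
split=> //; first exact: GLplusM.
rewrite /Fk -/w bcoK ?hor_K // /Ft -/w -chr_actM // e.
by rewrite chr_actM ?unitmx_inv // mulVmx // chr_act1.
Qed.

End Coordinates.
End AtPoint.

Lemma local_slice x0 : P x0 -> exists (b : 'rV[R]_(\dim E - m * m) -> W)
    (N : set 'rV[R]_(\dim E - m * m)) (kap : W -> 'rV[R]_(\dim E - m * m))
    (th : W -> 'M[R]_m),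
  [/\ linear b, b 0 = 0, open N & N 0] /\
  [/\ forall z, N z -> P (x0 + b z),
   forall z g, N z -> GLplus R m g ->
     kap (chr_act (x0 + b z) g) = z /\ th (chr_act (x0 + b z) g) = g &
  forall z1 g1, N z1 -> GLplus R m g1 ->
    exists O (Fk : W -> 'rV[R]_(\dim E - m * m)) (Ft : W -> 'M[R]_m),
    [/\ open O, O (chr_act (x0 + b z1) g1), smooth_mx O Fk, smooth_mx O Ft &
     forall y, P y -> O y ->
       [/\ N (Fk y), GLplus R m (Ft y) & y = chr_act (x0 + b (Fk y)) (Ft y)]]].
Proof.
move=> Px0; have [x0E Dx0 fx0] := Px0.
have [Lam [K [lLam dK LamL KL hK]]] := complement_projection (chr_deriv_linear x0)
  (fun A => @chr_deriv_inj R m eps eps2 x0 A Dx0 fx0) (fun A => E_deriv A x0E).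
have [b [co [lb lco bK coK bcoK]]] := vspace_coordinates dK.
have [N [kap [th [[oN N0 NP Nk] H]]]] := local_slice_coord lLam LamL Px0 KL hK lb lco bK coK bcoK.
by exists b, N, kap, th; split=> //; split=> //; exact: linear_mx0.
Qed.

End Slice.

(** * The orbit space as a smooth manifold and the principal bundle *)

Section SubsetTopology.
Context {R : realType} {a b : nat}.
Variable P : set 'M[R]_(a, b).

Lemma open_set_typeP (A : set P) :
  open A <-> forall x, A x -> exists2 r, 0 < r & forall y : P,
    `|set_val y - set_val x| < r -> A y.
Proof.
split=> [[D oD <-] x Dx|H].
  have [r r0 rP] := (open_mxP _).1 oD _ Dx.
  by exists r => // y /rP.
exists [set w | exists (x : P) r, [/\ 0 < r, forall y : P, `|set_val y - set_val x| < r -> A y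
   & `|w - set_val x| < r]].
  apply/open_mxP => w [x [r [r0 rA wx]]].
  have [s s0 sP] := (open_mxP _).1 (@open_ball_mx _ _ _ (set_val x) r) w wx.
  by exists s => // z /sP zx; exists x, r.
apply/seteqP; split=> x /=; first by move=> [z [r [_ rA xz]]]; exact: rA.
move=> Ax; have [r r0 rA] := H x Ax; exists x, r; split=> //.
by rewrite subrr normr0.
Qed.

Lemma set_val_in (x : P) : P (set_val x).
Proof. by case: x => x Px; rewrite set_valE /=; exact: set_mem. Qed.

Definition to_sub (x0 : P) (w : 'M[R]_(a, b)) : P :=
  if pselect (P w) is left h then exist _ w (mem_set h) else x0.

Lemma to_subK x0 w : P w -> set_val (to_sub x0 w) = w.
Proof. by move=> Pw; rewrite /to_sub; case: pselect => // h; rewrite set_valE. Qed.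

Lemma to_sub_val x0 (x : P) : to_sub x0 (set_val x) = x.
Proof. by apply: val_inj; rewrite -!set_valE to_subK //; exact: set_val_in. Qed.

End SubsetTopology.

Section SliceDef.
Context {R : realType} {m : nat}.
Local Notation W := 'M[R]_((m * m)%N, m).

(* [b] parametrizes the affine slice through [x0] by [N]; on the saturation of
   the slice, [kap] and [th] are the coordinates of [chr_act (x0 + b z) g]. *)
Definition is_slice (P : set W) d (x0 : W) (b : 'rV[R]_d -> W) (N : set 'rV[R]_d)
    (kap : W -> 'rV[R]_d) (th : W -> 'M[R]_m) : Prop :=
  [/\ linear b, b 0 = 0, open N & N 0] /\
  [/\ forall z, N z -> P (x0 + b z),
   forall z g, N z -> GLplus R m g ->
     kap (chr_act (x0 + b z) g) = z /\ th (chr_act (x0 + b z) g) = g &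
  forall z1 g1, N z1 -> GLplus R m g1 ->
    exists O (Fk : W -> 'rV[R]_d) (Ft : W -> 'M[R]_m),
    [/\ open O, O (chr_act (x0 + b z1) g1), smooth_mx O Fk, smooth_mx O Ft &
     forall y, P y -> O y ->
       [/\ N (Fk y), GLplus R m (Ft y) & y = chr_act (x0 + b (Fk y)) (Ft y)]]].

Definition saturation d (x0 : W) (b : 'rV[R]_d -> W) (N : set 'rV[R]_d) : set W :=
  [set y | exists z g, [/\ N z, GLplus R m g & y = chr_act (x0 + b z) g]].

End SliceDef.

Section Bundle.
Context {R : realType} {m : nat}.
Local Notation W := 'M[R]_((m * m)%N, m).
Variables (P : set W) (d : nat) (B : topologicalType) (pr : P -> B).
Local Notation G := (GLplus R m).
Hypothesis P_act : forall x g, P x -> G g -> P (chr_act x g).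
Hypothesis P_inj : forall x g h, P x -> G g -> G h ->
  chr_act x g = chr_act x h -> g = h.
Hypothesis P_near : forall a b (O : set 'M[R]_m), P a -> P b -> open O ->
  (forall g, G g -> chr_act a g = b -> O g) ->
  exists2 e, 0 < e & forall x g, P x -> G g ->
    `|x - a| < e -> `|chr_act x g - b| < e -> O g.
Hypothesis pr_surj : forall c, exists x, pr x = c.
Hypothesis prP : forall x y, pr x = pr y <->
  exists2 g, G g & set_val y = chr_act (set_val x) g.
Hypothesis pr_openP : forall A : set B, open A <-> open (pr @^-1` A).

(** The saturation of an open set is a union of its translates under the linear homeomorphisms
    [chr_act ^~ g]. *)
Lemma pr_open_image (O : set W) : open O -> open (pr @` (set_val @^-1` O)).
Proof.
move=> oO; apply/pr_openP/open_set_typeP => y [x Ox /prP [g Gg yx]].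
have ug := GLplus_unit Gg.
have xy : set_val x = chr_act (set_val y) (invmx g) by rewrite yx chr_actK.
have [r r0 rP] := (open_mxP _).1 oO _ Ox.
have cont : {for set_val y, continuous (chr_act ^~ (invmx g))}.
  by apply: linear_mx_continuous; apply: chr_act_linear; rewrite unitmx_inv.
have [s s0 sP] := (continuous_mxP _ _).1 cont r r0.
exists s => // z /sP; rewrite -xy => zx.
have Pz : P (chr_act (set_val z) (invmx g)) by apply: P_act (set_val_in z) (GLplusV Gg).
exists (to_sub z (chr_act (set_val z) (invmx g))); first by rewrite /= to_subK //; exact: rP.
apply/prP; exists g => //; rewrite to_subK // chr_actM ?unitmx_inv //.
by rewrite mulVmx // chr_act1.
Qed.

(** No group element joins points of distinct orbits, so properness applies with the empty set as
    target and gives balls with disjoint saturations. *)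
Lemma quotient_hausdorff : hausdorff_space B.
Proof.
rewrite open_hausdorff => c1 c2.
have [a <-] := pr_surj c1; have [b <-] := pr_surj c2 => ab.
have [g Gg e|e e0 eP] := @P_near _ _ set0 (set_val_in a) (set_val_in b) open0.
  by move/eqP: ab; apply; apply/prP; exists g.
exists (pr @` (set_val @^-1` [set w | `|w - set_val a| < e]),
        pr @` (set_val @^-1` [set w | `|w - set_val b| < e])); split=> /=.
- by apply/mem_set; exists a => //=; rewrite subrr normr0.
- by apply/mem_set; exists b => //=; rewrite subrr normr0.
- exact/pr_open_image/open_ball_mx.
- exact/pr_open_image/open_ball_mx.
apply/eqP/seteqP; split=> // c [[x xa <-] [y yb /esym /prP [g Gg yx]]].
by apply: (eP (set_val x) g (set_val_in x) Gg xa); rewrite -yx.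
Qed.

Lemma quotient_second_countable : @second_countable B.
Proof.
(* The rational centres need not lie in [P]; a radius below [r / 2] leaves room for this. *)
pose bb (z : 'M[rat]_((m * m)%N, m) * nat) : set B :=
  pr @` (set_val @^-1` [set w | `|w - map_mx ratr z.1| < z.2.+1%:R^-1]).
exists (range bb); first exact: (sub_countable (card_image_le _ _)).
split; first by move=> _ [z _ <-]; exact/pr_open_image/open_ball_mx.
move=> c A; rewrite nbhsE => -[A' [oA' A'c] A'A].
have [y yc] := pr_surj c; rewrite -yc in A'c.
have [r r0 rP] := (open_set_typeP _).1 ((pr_openP _).1 oA') y A'c.
have [n _ nP] := near_infty_natSinv_lt (PosNum (divr_gt0 r0 (ltr0Sn R 1))).
have {}nP : n.+1%:R^-1 < r / 2 by exact: nP (leqnn n).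
have n0 : 0 < n.+1%:R^-1 :> R by rewrite invr_gt0.
pose e : R := n.+1%:R^-1; rewrite -/e in nP n0.
have H i j : exists q : rat, `|set_val y i j - ratr q| < e / 2.
  have /rat_in_itvoo [q] : set_val y i j - e / 2 < set_val y i j + e / 2.
    by lra.
  by rewrite in_itv /= => /andP[q1 q2]; exists q; rewrite ltr_norml; apply/andP; split; lra.
pose q := \matrix_(i, j) sval (cid (H i j)).
have qy : `|set_val y - map_mx ratr q| < e.
  apply: (@le_lt_trans _ _ (e / 2)); last by lra.
  apply: mx_norm_le => [|i j]; first by lra.
  by rewrite !mxE ltW //; exact: svalP (cid (H i j)).
exists (bb (q, n)).
  by split; [exists (q, n)|rewrite -yc; exists y].
move=> _ [z /= zq <-]; apply: A'A; apply: rP.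
rewrite -[_ - _](subrKA (map_mx ratr q)).
apply: le_lt_trans (ler_normD _ _) _; rewrite (distrC (map_mx _ _)).
by move: zq; rewrite -/e; lra.
Qed.


(** The chart is described by its values on representatives in [P], so that its construction is
    never unfolded later. *)
Definition is_slice_chart (x0 : W) (b : 'rV[R]_d -> W) (N : set 'rV[R]_d)
    (kap : W -> 'rV[R]_d) (c : chart R B d) : Prop :=
  [/\ forall y, chart_dom c (pr y) <-> saturation x0 b N (set_val y),
      forall y, saturation x0 b N (set_val y) -> chart_fun c (pr y) = kap (set_val y),
      forall z, (chart_fun c @` chart_dom c) z <-> N z &
      forall z, N z -> exists y, set_val y = x0 + b z /\ chart_inv c z = pr y].

Section OneSlice.
Variables (x0 : P) (b : 'rV[R]_d -> W) (N : set 'rV[R]_d).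
Variables (kap : W -> 'rV[R]_d) (th : W -> 'M[R]_m).
Hypothesis S : is_slice P (set_val x0) b N kap th.
Local Notation U := (saturation (set_val x0) b N).

Lemma slice_recon y : U y ->
  [/\ N (kap y), G (th y) & y = chr_act (set_val x0 + b (kap y)) (th y)].
Proof.
by case: S => _ [_ Sk _] [z [g [Nz Gg ->]]]; have [-> ->] := Sk z g Nz Gg.
Qed.

Lemma saturation_slice z : N z -> U (set_val x0 + b z).
Proof. by move=> Nz; exists z, 1%:M; split=> //; [exact: GLplus1|rewrite chr_act1]. Qed.

Lemma saturation_act y g : U y -> G g ->
  [/\ U (chr_act y g), kap (chr_act y g) = kap y & th (chr_act y g) = th y *m g].
Proof.
case: S => _ [_ Sk _] [z [h [Nz Gh ->]]] Gg.
rewrite chr_actM ?GLplus_unit //.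
have [-> ->] := Sk z _ Nz (GLplusM Gh Gg); have [-> ->] := Sk z h Nz Gh.
by split=> //; exists z, (h *m g); split=> //; exact: GLplusM.
Qed.

Lemma slice_local y1 : U y1 -> exists O (Fk : W -> 'rV[R]_d) (Ft : W -> 'M[R]_m),
  [/\ open O, O y1, smooth_mx O Fk, smooth_mx O Ft &
   forall y, P y -> O y -> [/\ U y, kap y = Fk y & th y = Ft y]].
Proof.
case: S => _ [_ Sk SO] [z [g [Nz Gg ->]]].
have [D [Fk [Ft [oD Dy sk st DP]]]] := SO z g Nz Gg.
exists D, Fk, Ft; split=> // y Py Dy1; have [Nk Gt e] := DP y Py Dy1.
have [k t] := Sk _ _ Nk Gt; rewrite -e in k t.
by split=> //; exists (Fk y), (Ft y).
Qed.

Lemma saturation_pr y y' : pr y = pr y' -> U (set_val y) ->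
  U (set_val y') /\ kap (set_val y') = kap (set_val y).
Proof. by move=> /prP [g Gg ->] Uy; have [] := saturation_act Uy Gg. Qed.

Let dom : set B := [set c | exists2 y, pr y = c & U (set_val y)].
(** The choice of representative is immaterial, since [kap] is constant on orbits. *)
Let rep c := sval (cid (pr_surj c)).
Let fn c := kap (set_val (rep c)).
Let iv z := pr (to_sub x0 (set_val x0 + b z)).

Let domE y : dom (pr y) <-> U (set_val y).
Proof.
split=> [[y' e Uy']|Uy]; last by exists y.
by have [] := saturation_pr e Uy'.
Qed.

Let fnE y : U (set_val y) -> fn (pr y) = kap (set_val y).
Proof.
move=> Uy; rewrite /fn; set c := pr y.
have e : pr y = pr (rep c) by rewrite /rep (svalP (cid (pr_surj c))).
by have [_ ->] := saturation_pr e Uy.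
Qed.

Let ivE z : N z -> exists y, set_val y = set_val x0 + b z /\ iv z = pr y.
Proof.
move=> Nz; have [_ [Pz _ _]] := S.
by exists (to_sub x0 (set_val x0 + b z)); rewrite to_subK //; exact: Pz.
Qed.

Let fn_iv z : N z -> dom (iv z) /\ fn (iv z) = z.
Proof.
move=> Nz; have [y [ye ->]] := ivE Nz.
have Uy : U (set_val y) by rewrite ye; exact: saturation_slice.
split; first exact/domE.
have [_ [_ Sk _]] := S; have [<- _] := Sk z _ Nz GLplus1.
by rewrite chr_act1 -ye; exact: fnE.
Qed.

Let fn_img : fn @` dom = N.
Proof.
apply/seteqP; split=> [_ [c [y <- Uy] <-]|z Nz].
  by rewrite fnE //; have [] := slice_recon Uy.
by have [dz fz] := fn_iv Nz; exists (iv z).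
Qed.

(** With [A] everything this gives an open domain, with [A] a ball continuity of the chart. *)
Let open_dom_fn (A : set 'rV[R]_d) : open A -> open (dom `&` fn @^-1` A).
Proof.
move=> oA; apply/pr_openP/open_set_typeP => y [/domE Uy] /=; rewrite fnE // => Ay.
have [D [Fk [Ft [oD Dy sk _ DP]]]] := slice_local Uy.
have [_ ky _] := DP _ (set_val_in y) Dy; rewrite ky in Ay.
have [r r0 rP] := (open_mxP _).1 oA _ Ay.
have [r1 r10 r1P] := (open_mxP _).1 oD _ Dy.
have [r2 r20 r2P] := (continuous_mxP _ _).1 (Ck_mx_continuous (sk 0) Dy) r r0.
exists (Num.min r1 r2); first by rewrite lt_min r10.
move=> z; rewrite lt_min => /andP[/r1P Dz /r2P /rP Az].
have [Uz kz _] := DP _ (set_val_in z) Dz.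
by split; [exact/domE|rewrite /= fnE // kz].
Qed.

Let open_dom : open dom.
Proof. by have := open_dom_fn openT; rewrite preimage_setT setIT. Qed.

Let fnK c : dom c -> iv (fn c) = c.
Proof.
move=> [y <- Uy]; rewrite fnE //; have [Nk Gt e] := slice_recon Uy.
have [y' [y'e ->]] := ivE Nk.
by apply/prP; exists (th (set_val y)) => //; rewrite y'e.
Qed.

Let fn_continuous : {within dom, continuous fn}.
Proof.
rewrite continuous_open_subspace // => c /set_mem dc.
apply/cvgrPdist_lt => e e0.
have oS := open_dom_fn (@open_ball_mx R _ _ (fn c) e).
have : nbhs c (dom `&` fn @^-1` [set z | `|z - fn c| < e]).
  by apply: open_nbhs_nbhs; split=> //; split=> //=; rewrite subrr normr0.
by apply: filterS => c' [_ /=]; rewrite distrC.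
Qed.

Let iv_continuous : {within fn @` dom, continuous iv}.
Proof.
have [[lb b0 oN N0] [Pz _ _]] := S.
rewrite fn_img continuous_open_subspace // => z /set_mem Nz A.
rewrite nbhsE => -[A' [oA' A'z] A'A]; apply/nbhs_mxP.
have [r r0 rP] := (open_set_typeP _).1 ((pr_openP _).1 oA') _ A'z.
have [r1 r10 r1P] := (open_mxP _).1 oN _ Nz.
have [r2 r20 r2P] := (continuous_mxP _ _).1 (linear_mx_continuous lb (x := z)) r r0.
exists (Num.min r1 r2); first by rewrite lt_min r10.
move=> z'; rewrite lt_min => /andP[/r1P Nz' /r2P bz]; apply: A'A; apply: rP.
rewrite !to_subK; [|exact: Pz|exact: Pz].
by rewrite opprD addrACA subrr add0r.
Qed.

Let open_img : open (fn @` dom).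
Proof. by rewrite fn_img; have [[]] := S. Qed.

Lemma slice_chart_ex : exists c, is_slice_chart (set_val x0) b N kap c.
Proof.
exists (Chart open_dom open_img fnK fn_continuous iv_continuous).
split; [exact: domE|exact: fnE| |exact: ivE].
by move=> z; change ((fn @` dom) z <-> N z); rewrite fn_img.
Qed.

End OneSlice.

Hypothesis P_slice : forall x0, P x0 -> exists b N kap th, @is_slice R m P d x0 b N kap th.

Definition slice_atlas : set (chart R B d) := [set c | exists (x0 : P) b N kap th,
  is_slice P (set_val x0) b N kap th /\ is_slice_chart (set_val x0) b N kap c].

Lemma slice_atlas_smooth : smooth_structure slice_atlas.
Proof.
split; [exact: quotient_hausdorff|exact: quotient_second_countable| |].
  move=> c; have [x0 <-] := pr_surj c.
  have [b [N [kap [th S]]]] := P_slice (set_val_in x0).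
  have [ch Hch] := slice_chart_ex S.
  exists ch; first by exists x0, b, N, kap, th.
  have [chP _ _ _] := Hch; apply/chP.
  have [[_ b0 _ N0] _] := S.
  by have := saturation_slice x0 b N0; rewrite b0 addr0.
move=> c c' [x0 [b [N [kap [th [S [domE fnE imE ivE]]]]]]]
  [x0' [b' [N' [kap' [th' [S' [domE' fnE' imE' ivE']]]]]]].
have [[lb b0 oN N0] [Pz Sk SO]] := S.
have key z : (chart_fun c @` (chart_dom c `&` chart_dom c')) z ->
  [/\ N z, P (set_val x0 + b z) & saturation (set_val x0') b' N' (set_val x0 + b z)].
  move=> [q [dq dq'] qz].
  have Nz : N z by apply/imE; exists q.
  have [y [ye yi]] := ivE z Nz.
  have qe : pr y = q by rewrite -yi -qz chart_funK.
  by split=> //; [exact: Pz|rewrite -ye; apply/domE'; rewrite qe].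
move=> z /key [Nz Pbz Uz'].
have [D [Fk [Ft [oD Dy sk _ DP]]]] := slice_local S' Uz'.
(* The transition map is [kap'] on the affine slice; [kap'] is controlled on [P] only and is
   replaced by its smooth local extension [Fk]. *)
pose aff (z : 'rV[R]_d) : W := set_val x0 + b z.
have affC n V : Ck_mx n V aff.
  apply: Ck_mx_add; first exact: Ck_mx_cst.
  by apply: (@Ck_mx_lin _ _ _ _ _ _ _ _ b id) => //; exact: Ck_mx_id.
exists (aff @^-1` D), (Fk \o aff).
have oV : open (aff @^-1` D).
  by apply: open_comp => // u _; apply: (@Ck_mx_continuous _ _ 0 setT).
split=> //.
  by apply: Coo_on_smooth => // n; apply: (@Ck_mx_comp _ _ _ _ _ _ _ _ D) => //; exact: sk.
move=> z2 /key [Nz2 Pbz2 Uz2] Dz2 /=.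
have [y2 [ye2 ->]] := ivE z2 Nz2.
by rewrite fnE' ye2 //; have [] := DP _ Pbz2 Dz2.
Qed.

Theorem quotient_bundle : smooth_principal_bundle G chr_act slice_atlas pr.
Proof.
have uG := @GLplus_unit R m.
split.
- split.
    split=> [x g Px Gg|x _|x g h _ /uG gu /uG hu]; first exact: P_act.
      exact: chr_act1.
    exact: chr_actM.
  move=> [x g] [/= Px Gg].
  pose V := [set z : (W * 'M[R]_m)%type | z.2 \in unitmx].
  have oV : open V.
    apply: (@open_comp _ _ (@snd W 'M[R]_m) [set A | A \in unitmx]); last exact: open_unitmx.
    by move=> z _; exact: cvg_snd.
  exists V, (fun z => chr_act z.1 z.2); split=> //; first exact: uG.
  apply: Coo_on_smooth => // n; apply: Ck_chr_act => //; [exact: Ck_mx_fst|exact: Ck_mx_snd].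
- by move=> x g Px Gg e; apply: (P_inj Px Gg GLplus1); rewrite chr_act1.
- by [].
- split.
    by apply/continuousP => A /pr_openP.
  move=> c [x0 [b [N [kap [th [S [domE fnE imE ivE]]]]]]] x /domE Ux.
  have [D [Fk [Ft [oD Dx sk _ DP]]]] := slice_local S Ux.
  exists D, Fk; split=> //; first exact: Coo_on_smooth.
  move=> y /domE Uy Dy /=; rewrite fnE //.
  by have [] := DP _ (set_val_in y) Dy.
move=> q; have [x0 <-] := pr_surj q.
have [b [N [kap [th S]]]] := P_slice (set_val_in x0).
have [c [domE fnE imE ivE]] := slice_chart_ex S.
have [[lb b0 oN N0] [Pz Sk SO]] := S.
(* A point [(x0 + b z) T] is sent to [T]; the inverse moves the slice point over [q] by [g]. *)
exists (chart_dom c), (fun y => th (set_val y)),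
  (fun q g => to_sub x0 (chr_act (set_val x0 + b (chart_fun c q)) g)).
split; first exact: chart_dom_open.
  by apply/domE; have := saturation_slice x0 b N0; rewrite b0 addr0.
split.
- move=> x /domE Ux; have [Nk Gt e] := slice_recon S Ux; split=> //.
  by rewrite fnE // -e to_sub_val.
- move=> q' g dq Gg; have [y yq] := pr_surj q'; rewrite -yq in dq *.
  have Uy := (domE y).1 dq; have [Nk Gt e] := slice_recon S Uy.
  rewrite fnE // to_subK; last exact: P_act (Pz _ Nk) Gg.
  have [_ thE] := Sk _ _ Nk Gg; split=> //.
  apply/prP; exists (invmx g *m th (set_val y)); first exact: GLplusM (GLplusV Gg) Gt.
  rewrite to_subK; last exact: P_act (Pz _ Nk) Gg.
  rewrite [LHS]e chr_actM ?unitmx_mul ?unitmx_inv ?uG // mulKVmx //; exact: uG.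
- by move=> x y g /domE Ux Gg ->; have [] := saturation_act S Ux Gg.
- move=> x /domE Ux.
  have [D [Fk [Ft [oD Dx _ st DP]]]] := slice_local S Ux.
  exists D, Ft; split=> //; first exact: Coo_on_smooth.
  by move=> y _ Dy; have [] := DP _ (set_val_in y) Dy.
move=> c' [x0' [b' [N' [kap' [th' [S' [domE' fnE' imE' ivE']]]]]]].
have [[lb' b0' oN' N0'] [Pz' Sk' SO']] := S'.
have key z : (chart_fun c' @` (chart_dom c `&` chart_dom c')) z ->
  [/\ N' z, P (set_val x0' + b' z) & saturation (set_val x0) b N (set_val x0' + b' z)].
  move=> [r [dr dr'] rz].
  have Nz : N' z by apply/imE'; exists r.
  have [y [ye yi]] := ivE' z Nz.
  have re : pr y = r by rewrite -yi -rz chart_funK.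
  by split=> //; [exact: Pz'|rewrite -ye; apply/domE; rewrite re].
move=> [z g] [/= /key [Nz Pbz Uz] Gg].
have [D [Fk [Ft [oD Dy sk _ DP]]]] := slice_local S Uz.
pose aff (p : 'rV[R]_d * 'M[R]_m) : W := set_val x0' + b' p.1.
have affC n V : Ck_mx n V aff.
  apply: Ck_mx_add; first exact: Ck_mx_cst.
  by apply: (@Ck_mx_lin _ _ _ _ _ _ _ _ b' (fun p => p.1)) => //; exact: Ck_mx_fst.
pose V := (aff @^-1` D) `&` [set p | p.2 \in unitmx].
have oV : open V.
  apply: openI.
    by apply: open_comp => // u _; apply: (@Ck_mx_continuous _ _ 0 setT).
  apply: (@open_comp _ _ (@snd 'rV[R]_d 'M[R]_m) [set A | A \in unitmx]); last exact: open_unitmx.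
  by move=> p _; exact: cvg_snd.
exists V, (fun p => chr_act (set_val x0 + b (Fk (aff p))) p.2); split=> //.
- by split=> //=; exact: uG.
- apply: Coo_on_smooth => // n; apply: Ck_chr_act => //; first by move=> p [].
    apply: Ck_mx_add; first exact: Ck_mx_cst.
    apply: (@Ck_mx_lin _ _ _ _ _ _ _ _ b (fun p => Fk (aff p))) => //.
    by apply: (@Ck_mx_comp _ _ _ _ _ _ _ _ D Fk aff);
      [move=> p []|exact: affC|exact: sk].
  exact: Ck_mx_snd.
move=> [z2 g2] [/= /key [Nz2 Pbz2 Uz2] Gg2] [/= Dz2 _].
have [y2 [ye2 ->]] := ivE' z2 Nz2.
have Uy2 : saturation (set_val x0) b N (set_val y2) by rewrite ye2.
have [Nk Gt e] := slice_recon S Uy2.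
rewrite fnE // to_subK; last exact: P_act (Pz _ Nk) Gg2.
by rewrite /aff /= -ye2; have [_ -> _] := DP _ (set_val_in y2) ltac:(by rewrite ye2).
Qed.

End Bundle.

(** * The two cases: all symbols and torsion free symbols *)

Section TorsionFree.
Context {R : realType} {m : nat}.
Local Notation W := 'M[R]_((m * m)%N, m).

Definition torsion (Gam : W) : W := chr_of (fun i j k => chr Gam i j k - chr Gam j i k).

Lemma torsion_linear : linear torsion.
Proof.
move=> a G1 G2; apply: chr_inj => i j k.
by rewrite chrP !chr_ofE !chrP; ring.
Qed.

Definition torsion_free_space : {vspace W} :=
  lker (linfun (HB.pack_for {linear W -> W} torsion
    (GRing.isLinear.Build _ _ _ _ _ torsion_linear))).

Lemma mem_torsion_free_space Gam : Gam \in torsion_free_space <-> torsion_free Gam.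
Proof.
rewrite memv_ker lfunE /=; split=> [/eqP t0 i j k|tf].
  have := chr_ofE (fun i j k => chr Gam i j k - chr Gam j i k) i j k.
  by rewrite -/(torsion Gam) t0 /chr mxE => /esym /eqP; rewrite subr_eq0 => /eqP.
apply/eqP/chr_inj => i j k; rewrite chr_ofE tf subrr.
by rewrite /chr mxE.
Qed.

End TorsionFree.

Section Assembly.
Context {R : realType} {m : nat}.
Local Notation W := 'M[R]_((m * m)%N, m).
Local Notation G := (GLplus R m).

Lemma W_pq_definite p q : (p, q) = (m, 0%N) \/ (p, q) = (0%N, m) ->
  exists2 eps : R, eps * eps = 1 & W_pq R m p q = definite eps.
Proof.
have sigE k l (eps : R) : (k + l)%N = m ->
    (forall i : 'I_m, (if (i < k)%N then -1 else 1) = eps) ->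
    W_pq R m k l = definite eps.
  move=> klm e; have dE : diag_mx (\row_(i < m) (if (i < k)%N then -1 else 1)) = eps%:M.
    by apply/matrixP => i j; rewrite !mxE e.
  apply/seteqP; split=> x; first by case=> _ [S uS]; rewrite dE => Se; exists S.
  by case=> S uS Se; split=> //; exists S => //; rewrite dE.
case=> -[-> ->].
  by exists (-1); [rewrite mulrNN mulr1|apply: sigE => [|i]; rewrite ?addn0 ?ltn_ord].
by exists 1; [rewrite mulr1|apply: sigE].
Qed.

Section Uniform.
Variables (eps : R) (E : {vspace W}).
Hypothesis eps2 : eps * eps = 1.
Hypothesis E_act : forall x T, T \in unitmx -> x \in E -> chr_act x T \in E.
Hypothesis E_deriv : forall x A, x \in E -> chr_deriv x A \in E.

Definition definite_part : set W := [set x | x \in E /\ definite eps x].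

Lemma proper_definite_part : proper_action G definite_part chr_act.
Proof.
have [[A1 A2 A3] H] := proper_definite (m := m) eps2; split.
  split=> [x g [xE Px] Gg|x [_ Px]|x g h [_ Px]].
  - by split; [apply: E_act => //; exact: GLplus_unit|exact: A1].
  - exact: A2.
  - exact: A3.
move=> x g a b Px Gg [_ Pa] [_ Pb]; apply: H => // k.
by have [] := Px k.
Qed.

Lemma open_dense_free_part : (forall x r, x \in E -> 0 < r ->
    exists y, [/\ y \in E, `|y - x| < r & stab_trivial y]) ->
  open_dense_in (free_part eps E) definite_part.
Proof.
move=> dense; split.
- by move=> x [].
- exists [set y | exists x r, [/\ `|y - x| < r &
    forall z, definite eps z -> `|z - x| < r -> stab_trivial z]].
    apply/open_mxP => y [x [r [yx rP]]].
    have [s s0 sP] := (open_mxP _).1 (@open_ball_mx _ _ _ x r) y yx.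
    by exists s => // z /sP zx; exists x, r.
  apply/seteqP; split=> [x [xE Dx fx]|x [[xE Dx] [y [r [xy rP]]]]].
    split=> //; have [r r0 rP] := stab_trivial_near eps2 Dx fx.
    by exists x, r; split=> //; rewrite subrr normr0.
  by split=> //; exact: rP.
move=> x [xE Dx] V /nbhs_mxP [r r0 rP].
have [s s0 sP] := (open_mxP _).1 (open_definite (m := m) eps2) x Dx.
have [|y [yE yx fy]] := dense x (Num.min r s) xE; first by rewrite lt_min r0.
move: yx; rewrite lt_min => /andP[yr ys].
by exists y; split; [split=> //; exact: sP|exact: rP].
Qed.

Lemma bundle_free_part :
  quotient_is_smooth_principal_bundle G (free_part eps E) chr_act.
Proof.
pose P := free_part eps E; pose B := orbit_space G P chr_act.
pose pr : P -> B := orbit_proj G chr_act.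
have P_act x g : P x -> G g -> P (chr_act x g) by exact: free_part_act.
have P_inj x g h : P x -> G g -> G h -> chr_act x g = chr_act x h -> g = h.
  exact: free_part_act_inj.
have P_near a b (D : set 'M[R]_m) : P a -> P b -> open D ->
  (forall g, G g -> chr_act a g = b -> D g) ->
  exists2 e, 0 < e & forall x g, P x -> G g ->
    `|x - a| < e -> `|chr_act x g - b| < e -> D g.
  move=> [_ Da _] [_ Db _] oD H; have [e e0 eP] := proper_near eps2 Da Db oD H.
  by exists e => // x g [_ Dx _]; exact: eP.
have pr_surj c : exists x, pr x = c.
  by exists (repr (c : {eq_quot @orbit_equiv R _ m G P chr_act}%qT)); exact: reprK.
have prP x y : pr x = pr y <->
    exists2 g, G g & set_val y = chr_act (set_val x) g.
  have Px := set_val_in x; have Py := set_val_in y.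
  split=> [/eqmodP /eqP e|[g Gg e]].
    have : orbit_of G chr_act (set_val x) (set_val y).
      by rewrite e; exists 1%:M; [exact: GLplus1|exact: chr_act1].
    by case=> g Gg <-; exists g.
  apply/eqmodP/eqP/seteqP; have ug := GLplus_unit Gg; split=> _ [h Gh <-].
    exists (invmx g *m h); first exact: GLplusM (GLplusV Gg) Gh.
    rewrite e chr_actM ?unitmx_mul ?unitmx_inv ?ug ?(GLplus_unit Gh) //.
    by rewrite mulKVmx.
  exists (g *m h); first exact: GLplusM.
  by rewrite e chr_actM // GLplus_unit.
have pr_openP (A : set B) : open A <-> open (pr @^-1` A) by [].
have P_slice x0 : P x0 -> exists b N kap th,
    @is_slice R m P (\dim E - m * m) x0 b N kap th.
  exact: local_slice.
exists (\dim E - m * m)%N, (@slice_atlas R m P (\dim E - m * m)%N B pr).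
split; first exact: slice_atlas_smooth.
exact: quotient_bundle.
Qed.

End Uniform.
End Assembly.

Theorem theorem1p8 (R : realType) (m p q : nat) (hm : (3 <= m)%N)
    (hpq : (p, q) = (m, 0%N) \/ (p, q) = (0%N, m)) :
  (proper_action (GLplus R m) (W_pq R m p q) chr_act /\
   proper_action (GLplus R m) (Z_pq R m p q) chr_act) /\
  (open_dense_in (tildeW_pq R m p q) (W_pq R m p q) /\
   open_dense_in (tildeZ_pq R m p q) (Z_pq R m p q)) /\
  (quotient_is_smooth_principal_bundle
     (GLplus R m) (tildeW_pq R m p q) chr_act /\
   quotient_is_smooth_principal_bundle
     (GLplus R m) (tildeZ_pq R m p q) chr_act).
Proof.
have [eps eps2 WE] := W_pq_definite (R := R) hpq.
(* Writing [m] as a successor provides the index 0 used by [rigid_witness]. *)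
case: m hm hpq WE => // m' _ _ WE.
set TF := @torsion_free_space R m'.+1.
have W1 : W_pq R m'.+1 p q = definite_part eps fullv.
  by rewrite WE; apply/seteqP; split=> x; [split=> //; exact: memvf|case].
have Z1 : Z_pq R m'.+1 p q = definite_part eps TF.
  rewrite /Z_pq WE; apply/seteqP; split=> x [h1 h2]; split=> //.
    exact/mem_torsion_free_space.
  exact/mem_torsion_free_space.
have W2 : tildeW_pq R m'.+1 p q = free_part eps fullv.
  rewrite /tildeW_pq W1; apply/seteqP; split=> x.
    by move=> [[xE Dx] /stab_trivialP fx].
  by move=> [xE Dx fx]; split=> //; exact/stab_trivialP.
have Z2 : tildeZ_pq R m'.+1 p q = free_part eps TF.
  rewrite /tildeZ_pq Z1; apply/seteqP; split=> x.
    by move=> [[xE Dx] /stab_trivialP fx].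
  by move=> [xE Dx fx]; split=> //; exact/stab_trivialP.
have act1 (x : 'M[R]_((m'.+1 * m'.+1)%N, m'.+1)) T :
  T \in unitmx -> x \in fullv -> chr_act x T \in fullv by move=> _ _; exact: memvf.
have der1 (x : 'M[R]_((m'.+1 * m'.+1)%N, m'.+1)) A :
  x \in fullv -> chr_deriv x A \in fullv by move=> _; exact: memvf.
have act2 x T : T \in unitmx -> x \in TF -> chr_act x T \in TF.
  by move=> uT /mem_torsion_free_space tf; apply/mem_torsion_free_space/torsion_free_act.
have der2 x A : x \in TF -> chr_deriv x A \in TF.
  by move=> /mem_torsion_free_space tf; apply/mem_torsion_free_space/torsion_free_deriv.
have dens (E : {vspace 'M[R]_((m'.+1 * m'.+1)%N, m'.+1)}) :
  rigid_witness \in E -> forall x r, x \in E -> 0 < r ->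
    exists y, [/\ y \in E, `|y - x| < r & stab_trivial y].
  (* A parameter [t < r / k] moves [x] by less than [r] along the segment; the 1 in [k] covers the
     case where [x] is the witness. *)
  move=> wE x r xE r0; pose k := `|rigid_witness - x| + 1.
  have k0 : 0 < k by rewrite ltr_wpDl.
  have [t [t0 tr ft]] := stab_trivial_segment x (divr_gt0 r0 k0).
  exists (x + t *: (rigid_witness - x)); split=> //.
    by rewrite memvD // memvZ // memvB.
  rewrite addrC addKr normrZ gtr0_norm //.
  by move: tr; rewrite ltr_pdivlMr //; apply: le_lt_trans; rewrite ler_pM2l // lerDl.
have w1 : rigid_witness (R := R) (m' := m') \in fullv by exact: memvf.
have w2 : rigid_witness (R := R) (m' := m') \in TF.
  exact/mem_torsion_free_space/rigid_witness_tf.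
rewrite W2 Z2 W1 Z1; split; [|split]; split.
- exact: proper_definite_part.
- exact: proper_definite_part.
- by apply: open_dense_free_part => //; exact: dens.
- by apply: open_dense_free_part => //; exact: dens.
- exact: bundle_free_part.
- exact: bundle_free_part.
Qed.
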